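(* Let $H$ be a quasitriangular Hopf algebra over a field $\Bbbk$ with universal R-matrix $R$, let $C,B$ be weakly dual bialgebras in $\mathcal{B}=H\text{-}\mathbf{Mod}$, and let $A$ be a left $B$-comodule algebra in $\mathcal{B}$. Then $A\rtimes {}^{\mathrm{cop}}C\rtimes H$ is a left $\mathrm{Drin}_H(C,B)$-comodule algebra (with $A\rtimes {}^{\mathrm{cop}}C$ as a comodule subalgebra). The coaction $\delta_{\mathrm{Drin}}$ is given by $$\delta_{\mathrm{Drin}}(a)=a^{(-1)}R^{(2)}\otimes (R^{(1)}\triangleright a^{(0)}),\qquad \delta_{\mathrm{Drin}}(c)=R^{-(1)}c_{(2)}\otimes (R^{-(2)}\triangleright c_{(1)}),\qquad \delta_{\mathrm{Drin}}(h)=h_{(1)}\otimes h_{(2)},$$ for $a\in A$, $c\in C$, $h\in H$, where $\delta(a)=a^{(-1)}\otimes a^{(0)}$ denotes the $B$-coaction on $A$.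
   Context: Conventions: Sweedler notation with implicit sums; $R=R^{(1)}\otimes R^{(2)}\in H\otimes H$ is the universal R-matrix, with inverse $R^{-1}=R^{-(1)}\otimes R^{-(2)}$, satisfying ${R^{(1)}}_{(1)}\otimes {R^{(1)}}_{(2)}\otimes R^{(2)}=R_1^{(1)}\otimes R_2^{(1)}\otimes R_1^{(2)}R_2^{(2)}$, $R^{(1)}\otimes {R^{(2)}}_{(1)}\otimes {R^{(2)}}_{(2)}=R_1^{(1)}R_2^{(1)}\otimes R_2^{(2)}\otimes R_1^{(2)}$ (subscripts $1,2$ on $R$ denote different copies of $R$), and $R^{(1)}h_{(1)}\otimes R^{(2)}h_{(2)}=h_{(2)}R^{(1)}\otimes h_{(1)}R^{(2)}$ for $h\in H$. All Hopf algebras have invertible antipode. $H\text{-}\mathbf{Mod}$ denotes left $H$-modules (action written $\triangleright$), braided by $\Psi_{V,W}(v\otimes w)=(R^{(2)}\triangleright w)\otimes(R^{(1)}\triangleright v)$. Bialgebras in $\mathcal{B}$: algebra and coalgebra structures in $\mathcal{B}$ with $\Delta m=(m\otimes m)(\mathrm{Id}\otimes\Psi\otimes\mathrm{Id})(\Delta\otimes\Delta)$, and $\Delta$, $\varepsilon$ unital, $\varepsilon$ multiplicative. $\Delta(b)=b_{(1)}\otimes b_{(2)}$ and $\Delta(c)=c_{(1)}\otimes c_{(2)}$ denote the coproducts in $\mathcal{B}$ of $B$ and $C$. Weakly dual bialgebras $C,B$: there is a morphism $\mathrm{ev}\colon C\otimes B\to\Bbbk$ in $\mathcal{B}$ (not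 necessarily non-degenerate) with $\mathrm{ev}(cc',b)=\mathrm{ev}(c,b_{(2)})\mathrm{ev}(c',b_{(1)})$, $\mathrm{ev}(c,bb')=\mathrm{ev}(c_{(2)},b)\mathrm{ev}(c_{(1)},b')$, $\mathrm{ev}(1,b)=\varepsilon(b)$, $\mathrm{ev}(c,1)=\varepsilon(c)$. $\mathrm{Drin}_H(C,B)$ (braided Drinfeld double) is the $\Bbbk$-bialgebra generated by $C,H,B$ as subalgebras with relations, for $b\in B,c\in C,h\in H$, $$(R^{-(1)}\triangleright b_{(2)})(R^{-(2)}\triangleright c_{(1)})\,\mathrm{ev}(c_{(2)},b_{(1)})=R^{-(1)}c_{(2)}b_{(1)}R^{(2)}\,\mathrm{ev}(R^{-(2)}\triangleright c_{(1)},R^{(1)}\triangleright b_{(2)}),$$ $hb=(h_{(1)}\triangleright b)h_{(2)}$, $hc=(h_{(1)}\triangleright c)h_{(2)}$, and coproduct $\Delta(h)=h_{(1)}\otimes h_{(2)}$, $\Delta(b)=b_{(1)}R^{(2)}\otimes(R^{(1)}\triangleright b_{(2)})$, $\Delta(c)=R^{-(1)}c_{(2)}\otimes(R^{-(2)}\triangleright c_{(1)})$; the counit is the multiplicative extension of the counits of $C,H,B$. A left $B$-comodule algebra $A$ in $\mathcal{B}$ is an algebra in $\mathcal{B}$ with a left $B$-coaction $\delta$ in $\mathcal{B}$ satisfying $\delta m_A=(m_B\otimes m_A)(\mathrm{Id}_B\otimes\Psi_{A,B}\otimes\mathrm{Id}_A)(\delta\otimes\delta)$ and $\delta 1_A=1_B\otimes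 1_A$. $A\rtimes{}^{\mathrm{cop}}C\rtimes H$ is the algebra on the vector space $A\otimes C\otimes H$ with $A$, $C$, $H$ as subalgebras and relations $$ca=(R^{-(1)}\triangleright a^{(0)})(R^{-(2)}\triangleright c_{(1)})\,\mathrm{ev}(c_{(2)},a^{(-1)}),\quad ha=(h_{(1)}\triangleright a)h_{(2)},\quad hc=(h_{(1)}\triangleright c)h_{(2)};$$ $A\rtimes{}^{\mathrm{cop}}C$ is the subalgebra $A\otimes C$. *)

(* Defs.v *)
From HB Require Import structures.
From mathcomp Require Import all_boot all_algebra.
From mathcomp Require Import boolp.

Set Implicit Arguments.
Unset Strict Implicit.
Unset Printing Implicit Defensive.

Import GRing.Theory.
Local Open Scope ring_scope.
Local Open Scope quotient_scope.

Reserved Notation "V ⊗ W" (at level 40, left associativity).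
Reserved Notation "x ∙ y" (at level 40, left associativity).
Reserved Notation "h ▷ v" (at level 38, right associativity).
Reserved Notation "\sw_ ( x , y <- t ) e"
  (at level 41, x name, y name, e at level 41,
   format "'[' \sw_ ( x ,  y  <-  t ) '/  '  e ']'").

Definition is_bilinear (K : fieldType) (V W U : lmodType K) (f : V -> W -> U) :=
  (forall w, linear (f^~ w)) /\ (forall v, linear (f v)).

(* V ⊗ W is the quotient of the finite formal sums of pure tensors (scalars are
   absorbed in the left entries) by the relation of having the same image under
   every bilinear map, so that the universal property [tfold_tens],
   [tfold_linear], [tens_ext] holds by construction. *)
Section Tensor.
Variables (K : fieldType) (V W : lmodType K).

Definition fsum (U : zmodType) (f : V -> W -> U) (s : seq (V * W)) : U :=
  \sum_(p <- s) f p.1 p.2.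

Definition tens_eqv (s t : seq (V * W)) : bool :=
  `[< forall (U : lmodType K) (f : V -> W -> U),
        is_bilinear f -> fsum f s = fsum f t >].

Lemma tens_eqv_refl : reflexive tens_eqv.
Proof. by move=> s; apply/asboolP. Qed.

Lemma tens_eqv_sym : symmetric tens_eqv.
Proof.
by move=> s t; apply/asboolP/asboolP => e U f fb; rewrite (e U f fb).
Qed.

Lemma tens_eqv_trans : transitive tens_eqv.
Proof.
move=> t s u /asboolP st /asboolP tu; apply/asboolP => U f fb.
by rewrite st // tu.
Qed.

Canonical tens_equiv :=
  EquivRel tens_eqv tens_eqv_refl tens_eqv_sym tens_eqv_trans.

Definition tensor : Type := {eq_quot tens_equiv}.
HB.instance Definition _ := Choice.on tensor.
HB.instance Definition _ := EqQuotient.on tensor.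

Definition tens (v : V) (w : W) : tensor := \pi_tensor [:: (v, w)].

(* The meaning of an expression f v w in Sweedler notation v ⊗ w for t: the sum
   over a chosen decomposition of t into pure tensors.  It does not depend on
   the choice as soon as f is bilinear. *)
Definition tfold (U : zmodType) (f : V -> W -> U) (t : tensor) : U :=
  fsum f (repr t).

Lemma tensP (s t : seq (V * W)) :
  (forall (U : lmodType K) (f : V -> W -> U),
     is_bilinear f -> fsum f s = fsum f t) -> \pi_tensor s = \pi_tensor t.
Proof. by move=> e; apply/eqmodP/asboolP. Qed.

Lemma tfold_pi (U : lmodType K) (f : V -> W -> U) (s : seq (V * W)) :
  is_bilinear f -> tfold f (\pi_tensor s) = fsum f s.
Proof.
move=> fb; rewrite /tfold.
have /eqmodP/asboolP -> // : repr (\pi_tensor s) = s %[mod tensor].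
by rewrite reprK.
Qed.

Lemma fsum_cat (U : zmodType) (f : V -> W -> U) s t :
  fsum f (s ++ t) = fsum f s + fsum f t.
Proof. by rewrite /fsum big_cat. Qed.

Lemma fsum_scale (U : lmodType K) (f : V -> W -> U) k s : is_bilinear f ->
  fsum f [seq (k *: p.1, p.2) | p <- s] = k *: fsum f s.
Proof.
move=> [fl _]; rewrite /fsum big_map scaler_sumr; apply: eq_bigr => p _ /=.
have f0 : f 0 p.2 = 0.
  by have := fl p.2 (-1) 0 0; rewrite /= scaler0 addr0 scaleN1r addNr.
by have := fl p.2 k p.1 0; rewrite /= f0 !addr0.
Qed.

Definition tadd (t u : tensor) : tensor := \pi_tensor (repr t ++ repr u).
Definition tscale (k : K) (t : tensor) : tensor :=
  \pi_tensor [seq (k *: p.1, p.2) | p <- repr t].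
Definition tzero : tensor := \pi_tensor [::].
Definition topp : tensor -> tensor := tscale (-1).

Lemma tens_eq (t u : tensor) :
  (forall (U : lmodType K) (f : V -> W -> U),
     is_bilinear f -> tfold f t = tfold f u) -> t = u.
Proof. by move=> e; rewrite -[t]reprK -[u]reprK; apply: tensP => U f /e. Qed.

Lemma tfold_add (U : lmodType K) (f : V -> W -> U) t u : is_bilinear f ->
  tfold f (tadd t u) = tfold f t + tfold f u.
Proof. by move=> fb; rewrite tfold_pi // fsum_cat. Qed.

Lemma tfold_scale (U : lmodType K) (f : V -> W -> U) k t : is_bilinear f ->
  tfold f (tscale k t) = k *: tfold f t.
Proof. by move=> fb; rewrite tfold_pi // fsum_scale. Qed.

Lemma tfold_zero (U : lmodType K) (f : V -> W -> U) : is_bilinear f ->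
  tfold f tzero = 0.
Proof. by move=> fb; rewrite tfold_pi // /fsum big_nil. Qed.

Let tfoldE := (tfold_add, tfold_scale, tfold_zero).

Lemma taddA : associative tadd.
Proof. by move=> t u v; apply: tens_eq => U f fb; rewrite !tfoldE // addrA. Qed.
Lemma taddC : commutative tadd.
Proof. by move=> t u; apply: tens_eq => U f fb; rewrite !tfoldE // addrC. Qed.
Lemma tadd0 : left_id tzero tadd.
Proof. by move=> t; apply: tens_eq => U f fb; rewrite !tfoldE // add0r. Qed.
Lemma taddN : left_inverse tzero topp tadd.
Proof.
by move=> t; apply: tens_eq => U f fb; rewrite !tfoldE // scaleN1r addNr.
Qed.
HB.instance Definition _ :=
  GRing.isZmodule.Build tensor taddA taddC tadd0 taddN.

Lemma tscaleA k l t : tscale k (tscale l t) = tscale (k * l) t.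
Proof. by apply: tens_eq => U f fb; rewrite !tfoldE // scalerA. Qed.
Lemma tscale1 : left_id 1 tscale.
Proof. by move=> t; apply: tens_eq => U f fb; rewrite !tfoldE // scale1r. Qed.
Lemma tscaleDr : right_distributive tscale +%R.
Proof.
by move=> k t u; apply: tens_eq => U f fb; rewrite !tfoldE // scalerDr.
Qed.
Lemma tscaleDl t : {morph tscale^~ t : k l / k + l}.
Proof.
by move=> k l; apply: tens_eq => U f fb; rewrite !tfoldE // scalerDl.
Qed.
HB.instance Definition _ := GRing.Zmodule_isLmodule.Build K tensor
  tscaleA tscale1 tscaleDr tscaleDl.

Lemma tens_bilinear : is_bilinear tens.
Proof.
split=> x k y z; apply: tens_eq => U f fb; rewrite !tfoldE // !tfold_pi //;
  by rewrite /fsum !big_seq1 /=; case: fb => [f1 f2]; rewrite (f1, f2).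
Qed.

Lemma tfold_tens (U : lmodType K) (f : V -> W -> U) v w :
  is_bilinear f -> tfold f (tens v w) = f v w.
Proof. by move=> fb; rewrite tfold_pi // /fsum big_seq1. Qed.

Lemma tfold_linear (U : lmodType K) (f : V -> W -> U) :
  is_bilinear f -> linear (tfold f).
Proof. by move=> fb k t u; rewrite !tfoldE. Qed.

Lemma tens_sum (t : tensor) : t = tfold tens t.
Proof.
apply: tens_eq => U f fb.
have -> : tfold tens t = \sum_(p <- repr t) tens p.1 p.2 by [].
have fD : {morph tfold f : x y / x + y} by move=> x y; apply: tfold_add.
have f0 : tfold f 0 = 0 by apply: tfold_zero.
rewrite (big_morph _ fD f0).
by apply: eq_bigr => p _; rewrite tfold_tens.
Qed.

Lemma tens_ext (U : lmodType K) (f g : tensor -> U) : linear f -> linear g ->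
  (forall v w, f (tens v w) = g (tens v w)) -> f =1 g.
Proof.
move=> fl gl e t; rewrite [t]tens_sum /tfold /fsum.
have lin h : linear h -> forall s : seq (V * W),
    h (\sum_(p <- s) tens p.1 p.2) = \sum_(p <- s) h (tens p.1 p.2) :> U.
  move=> hl; have h0 : h 0 = 0.
    by have := hl (-1) 0 0; rewrite scaler0 addr0 scaleN1r addNr.
  have hD : {morph h : x y / x + y}.
    by move=> x y; have := hl 1 x y; rewrite !scale1r.
  by move=> s; rewrite (big_morph h hD h0).
by rewrite !lin //; apply: eq_bigr.
Qed.

End Tensor.

Arguments tensor {K} (V W)%_type_scope.
Notation "V ⊗ W" := (tensor V W) : type_scope.
Notation "v ⊗ w" := (tens v w) : ring_scope.
Notation "\sw_ ( x , y <- t ) e" := (tfold (fun x y => e) t) : ring_scope.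

(* MathComp's algType excludes the zero ring, which may occur here as a comodule
   algebra; this is the same notion without that exclusion. *)
Record is_algebra (K : fieldType) (V : lmodType K) (mul : V -> V -> V) (one : V)
    : Prop := {
  alg_bilinear : is_bilinear mul;
  alg_assoc : associative mul;
  alg_mul1l : left_id one mul;
  alg_mul1r : right_id one mul
}.

Lemma algType_is_algebra (K : fieldType) (A : algType K) :
  is_algebra ( *%R : A -> A -> A) 1.
Proof.
split; [|exact: mulrA|exact: mul1r|exact: mulr1].
by split=> x k y z /=; [rewrite mulrDl scalerAl | rewrite mulrDr scalerAr].
Qed.

HB.mixin Record Lmodule_isUAlgebra (K : fieldType) A of GRing.Lmodule K A := {
  amul : A -> A -> A;
  aone : A;
  ualgP : is_algebra amul aone
}.

#[short(type="ualgType")]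
HB.structure Definition UAlgebra (K : fieldType) :=
  {A of GRing.Lmodule K A & Lmodule_isUAlgebra K A}.

Notation "x ∙ y" := (amul x y) : ring_scope.
Notation "𝟙" := aone : ring_scope.

Section UAlgebraLaw.
Variables (K : fieldType) (A : ualgType K).
Lemma amulA : associative (@amul K A). Proof. exact: (alg_assoc ualgP). Qed.
Lemma amul1l : left_id 𝟙 (@amul K A). Proof. exact: (alg_mul1l ualgP). Qed.
Lemma amul1r : right_id 𝟙 (@amul K A). Proof. exact: (alg_mul1r ualgP). Qed.
Lemma amul_bilinear : is_bilinear (@amul K A).
Proof. exact: (alg_bilinear ualgP). Qed.
HB.instance Definition _ := Monoid.isLaw.Build A 𝟙 amul amulA amul1l amul1r.

Lemma amulDl : left_distributive (@amul K A) +%R.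
Proof. by move=> x y z; have := amul_bilinear.1 z 1 x y; rewrite !scale1r. Qed.
Lemma amulDr : right_distributive (@amul K A) +%R.
Proof. by move=> x y z; have := amul_bilinear.2 x 1 y z; rewrite !scale1r. Qed.
Lemma amul0l : left_zero 0 (@amul K A).
Proof. by move=> x; apply: (addrI (0 ∙ x)); rewrite -amulDl !addr0. Qed.
Lemma amul0r : right_zero 0 (@amul K A).
Proof. by move=> x; apply: (addrI (x ∙ 0)); rewrite -amulDr !addr0. Qed.
Lemma ascalel k (x y : A) : (k *: x) ∙ y = k *: (x ∙ y).
Proof. by have := amul_bilinear.1 y k x 0; rewrite /= amul0l !addr0. Qed.
Lemma ascaler k (x y : A) : x ∙ (k *: y) = k *: (x ∙ y).
Proof. by have := amul_bilinear.2 x k y 0; rewrite /= amul0r !addr0. Qed.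
End UAlgebraLaw.

Section Structures.
Variable K : fieldType.

Record is_alg_hom (V W : lmodType K) (mulV : V -> V -> V) (oneV : V)
    (mulW : W -> W -> W) (oneW : W) (f : V -> W) : Prop := {
  alg_hom_linear : linear f;
  alg_homM : forall x y, f (mulV x y) = mulW (f x) (f y);
  alg_hom1 : f oneV = oneW
}.

Definition tmul (V W : lmodType K) (mulV : V -> V -> V) (mulW : W -> W -> W)
    (s t : V ⊗ W) : V ⊗ W :=
  \sw_(v, w <- s) \sw_(v', w' <- t) mulV v v' ⊗ mulW w w'.

Record is_coalgebra (V : lmodType K) (D : V -> V ⊗ V) (e : V -> K) : Prop := {
  comul_linear : linear D;
  counit_linear : scalar e;
  coassoc : forall v,
    \sw_(x, y <- D v) \sw_(x1, x2 <- D x) x1 ⊗ (x2 ⊗ y) =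
    \sw_(x, y <- D v) \sw_(y1, y2 <- D y) x ⊗ (y1 ⊗ y2);
  counitl : forall v, \sw_(x, y <- D v) e x *: y = v;
  counitr : forall v, \sw_(x, y <- D v) e y *: x = v
}.

Record is_bialgebra (A : ualgType K) (D : A -> A ⊗ A) (e : A -> K) : Prop := {
  bialg_coalg : is_coalgebra D e;
  bialg_comul : is_alg_hom amul 𝟙 (tmul amul amul) (𝟙 ⊗ 𝟙) D;
  bialg_counit : is_alg_hom amul 𝟙 *%R 1 (e : A -> K^o)
}.

Record is_comodule_algebra (D : ualgType K) (comul : D -> D ⊗ D)
    (counit : D -> K) (E : lmodType K) (mul : E -> E -> E) (one : E)
    (delta : E -> D ⊗ E) : Prop := {
  comod_bialg : is_bialgebra comul counit;
  comod_alg : is_algebra mul one;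
  comod_coassoc : forall x,
    \sw_(d, y <- delta x) \sw_(d1, d2 <- comul d) d1 ⊗ (d2 ⊗ y) =
    \sw_(d, y <- delta x) \sw_(d', z <- delta y) d ⊗ (d' ⊗ z);
  comod_counit : forall x, \sw_(d, y <- delta x) counit d *: y = x;
  comod_hom : is_alg_hom mul one (tmul amul mul) (𝟙 ⊗ one) delta
}.

End Structures.

Record qtHopf (K : fieldType) := QtHopf {
  qt_alg :> ualgType K;
  hcomul : qt_alg -> qt_alg ⊗ qt_alg;
  hcounit : qt_alg -> K;
  hbialgP : is_bialgebra hcomul hcounit;
  antipode : qt_alg -> qt_alg;
  antipode_linear : linear antipode;
  antipodel : forall h, \sw_(x, y <- hcomul h) antipode x ∙ y = hcounit h *: 𝟙;
  antipoder : forall h, \sw_(x, y <- hcomul h) x ∙ antipode y = hcounit h *: 𝟙;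
  antipode_bij : bijective antipode;
  Rmat : qt_alg ⊗ qt_alg;
  Rinv : qt_alg ⊗ qt_alg;
  RmatK : tmul amul amul Rmat Rinv = 𝟙 ⊗ 𝟙;
  RinvK : tmul amul amul Rinv Rmat = 𝟙 ⊗ 𝟙;
  Rmat_comull :
    \sw_(r, r' <- Rmat) \sw_(x, y <- hcomul r) x ⊗ (y ⊗ r') =
    \sw_(r, r' <- Rmat) \sw_(s, s' <- Rmat) r ⊗ (s ⊗ (r' ∙ s'));
  Rmat_comulr :
    \sw_(r, r' <- Rmat) \sw_(x, y <- hcomul r') r ⊗ (x ⊗ y) =
    \sw_(r, r' <- Rmat) \sw_(s, s' <- Rmat) (r ∙ s) ⊗ (s' ⊗ r');
  Rmat_comm : forall h,
    \sw_(r, r' <- Rmat) \sw_(x, y <- hcomul h) (r ∙ x) ⊗ (r' ∙ y) =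
    \sw_(r, r' <- Rmat) \sw_(x, y <- hcomul h) (y ∙ r) ⊗ (x ∙ r')
}.

Section Braided.
Variables (K : fieldType) (H : qtHopf K).

Record is_module (V : lmodType K) (act : H -> V -> V) : Prop := {
  act_bilinear : is_bilinear act;
  act1 : forall v, act 𝟙 v = v;
  actM : forall g h v, act (g ∙ h) v = act g (act h v)
}.

Definition tens_act (V W : lmodType K) (actV : H -> V -> V) (actW : H -> W -> W)
    (h : H) (t : V ⊗ W) : V ⊗ W :=
  \sw_(h1, h2 <- hcomul h) \sw_(v, w <- t) actV h1 v ⊗ actW h2 w.

Definition braid (V W : lmodType K) (actV : H -> V -> V) (actW : H -> W -> W)
    (t : V ⊗ W) : W ⊗ V :=
  \sw_(v, w <- t) \sw_(r, r' <- Rmat H) actW r' w ⊗ actV r v.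

Record moduleAlg := ModuleAlg {
  ma_alg :> ualgType K;
  act : H -> ma_alg -> ma_alg;
  act_module : is_module act;
  act_mul : forall h x y,
    act h (x ∙ y) = \sw_(h1, h2 <- hcomul h) act h1 x ∙ act h2 y;
  act_one : forall h, act h 𝟙 = hcounit h *: 𝟙
}.

Local Notation "h ▷ v" := (act h v).

Record braidedBialg := BraidedBialg {
  bb_alg :> moduleAlg;
  bcomul : bb_alg -> bb_alg ⊗ bb_alg;
  bcounit : bb_alg -> K;
  bcoalgP : is_coalgebra bcomul bcounit;
  bcomul_act : forall h b,
    bcomul (h ▷ b) = tens_act (@act bb_alg) (@act bb_alg) h (bcomul b);
  bcounit_act : forall h b, bcounit (h ▷ b) = hcounit h * bcounit b;
  bcomulM : forall x y,
    bcomul (x ∙ y) =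
    \sw_(x1, x2 <- bcomul x) \sw_(y1, y2 <- bcomul y)
      \sw_(z, w <- braid (@act bb_alg) (@act bb_alg) (x2 ⊗ y1))
        (x1 ∙ z) ⊗ (w ∙ y2);
  bcomul1 : bcomul 𝟙 = 𝟙 ⊗ 𝟙;
  bcounitM : forall x y, bcounit (x ∙ y) = bcounit x * bcounit y;
  bcounit1 : bcounit 𝟙 = 1
}.

Record weakDuality (C B : braidedBialg) := WeakDuality {
  ev : C ⊗ B -> K;
  ev_linear : scalar ev;
  ev_act : forall h t,
    ev (tens_act (@act C) (@act B) h t) = hcounit h * ev t;
  ev_mull : forall c c' b,
    ev ((c ∙ c') ⊗ b) =
    \sw_(b1, b2 <- bcomul b) (ev (c ⊗ b2) * ev (c' ⊗ b1));
  ev_mulr : forall c b b',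
    ev (c ⊗ (b ∙ b')) =
    \sw_(c1, c2 <- bcomul c) (ev (c2 ⊗ b) * ev (c1 ⊗ b'));
  ev_onel : forall b, ev (𝟙 ⊗ b) = bcounit b;
  ev_oner : forall c, ev (c ⊗ 𝟙) = bcounit c
}.

Record braidedComodAlg (B : braidedBialg) := BraidedComodAlg {
  bca_alg :> moduleAlg;
  coact : bca_alg -> B ⊗ bca_alg;
  coact_linear : linear coact;
  coact_act : forall h a,
    coact (h ▷ a) = tens_act (@act B) (@act bca_alg) h (coact a);
  coact_coassoc : forall a,
    \sw_(b, x <- coact a) \sw_(b1, b2 <- bcomul b) b1 ⊗ (b2 ⊗ x) =
    \sw_(b, x <- coact a) \sw_(b', y <- coact x) b ⊗ (b' ⊗ y);
  coact_counit : forall a, \sw_(b, x <- coact a) bcounit b *: x = a;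
  coactM : forall a a',
    coact (a ∙ a') =
    \sw_(b, x <- coact a) \sw_(b', x' <- coact a')
      \sw_(z, w <- braid (@act bca_alg) (@act B) (x ⊗ b'))
        (b ∙ z) ⊗ (w ∙ x');
  coact1 : coact 𝟙 = 𝟙 ⊗ 𝟙
}.

End Braided.

Notation "h ▷ v" := (act h v) : ring_scope.

(* The algebra generated by G subject to relations P, where P U f says that the
   relations hold in U for the values f of the generators: noncommutative
   polynomials in G modulo equality of all their values in such pairs (U, f).
   This is the quotient of the free algebra by the relations whenever these are
   equations between polynomial expressions in the generators. *)
Section Presented.
Variables (K : fieldType) (G : choiceType).
Variable P : forall U : ualgType K, (G -> U) -> Prop.

Definition ncpoly := seq (K * seq G).

Definition nceval (U : ualgType K) (f : G -> U) (s : ncpoly) : U :=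
  \sum_(m <- s) m.1 *: \big[amul/𝟙]_(g <- m.2) f g.

Definition pres_eqv (s t : ncpoly) : bool :=
  `[< forall (U : ualgType K) (f : G -> U), P f -> nceval f s = nceval f t >].

Lemma pres_eqv_refl : reflexive pres_eqv.
Proof. by move=> s; apply/asboolP. Qed.

Lemma pres_eqv_sym : symmetric pres_eqv.
Proof.
by move=> s t; apply/asboolP/asboolP => e U f fP; rewrite (e U f fP).
Qed.

Lemma pres_eqv_trans : transitive pres_eqv.
Proof.
move=> t s u /asboolP st /asboolP tu; apply/asboolP => U f fP.
by rewrite st // tu.
Qed.

Canonical pres_equiv :=
  EquivRel pres_eqv pres_eqv_refl pres_eqv_sym pres_eqv_trans.

Definition presented : Type := {eq_quot pres_equiv}.
HB.instance Definition _ := Choice.on presented.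
HB.instance Definition _ := EqQuotient.on presented.

Definition pgen (g : G) : presented := \pi_presented [:: (1, [:: g])].

Definition peval (U : ualgType K) (f : G -> U) (x : presented) : U :=
  nceval f (repr x).

Lemma peval_pi (U : ualgType K) (f : G -> U) s :
  P f -> peval f (\pi_presented s) = nceval f s.
Proof.
move=> fP; rewrite /peval.
have /eqmodP/asboolP -> // : repr (\pi_presented s) = s %[mod presented].
by rewrite reprK.
Qed.

Lemma peval_gen (U : ualgType K) (f : G -> U) g : P f -> peval f (pgen g) = f g.
Proof. by move=> fP; rewrite peval_pi // /nceval !big_seq1 scale1r. Qed.

Lemma pres_eq (x y : presented) :
  (forall (U : ualgType K) (f : G -> U), P f -> peval f x = peval f y) -> x = y.
Proof.
by move=> e; rewrite -[x]reprK -[y]reprK; apply/eqmodP/asboolP => U f /e.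
Qed.

Definition padd (x y : presented) : presented := \pi_presented (repr x ++ repr y).
Definition pscale (k : K) (x : presented) : presented :=
  \pi_presented [seq (k * m.1, m.2) | m <- repr x].
Definition pzero : presented := \pi_presented [::].
Definition popp : presented -> presented := pscale (-1).
Definition pone : presented := \pi_presented [:: (1, [::])].
Definition pmul (x y : presented) : presented :=
  \pi_presented [seq (m.1 * n.1, m.2 ++ n.2) | m <- repr x, n <- repr y].

Section Eval.
Variables (U : ualgType K) (f : G -> U) (fP : P f).

Lemma peval_add x y : peval f (padd x y) = peval f x + peval f y.
Proof. by rewrite peval_pi // /nceval big_cat. Qed.

Lemma peval_scale k x : peval f (pscale k x) = k *: peval f x.
Proof.
rewrite peval_pi // /nceval big_map scaler_sumr.
by apply: eq_bigr => m _; rewrite scalerA.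
Qed.

Lemma peval_zero : peval f pzero = 0.
Proof. by rewrite peval_pi // /nceval big_nil. Qed.

Lemma peval_one : peval f pone = 𝟙.
Proof. by rewrite peval_pi // /nceval big_seq1 big_nil scale1r. Qed.

Lemma peval_mul x y : peval f (pmul x y) = peval f x ∙ peval f y.
Proof.
rewrite peval_pi // /nceval big_allpairs_dep.
rewrite (big_morph (amul^~ _) (fun u v => amulDl u v _) (amul0l _)).
apply: eq_bigr => m _; rewrite (big_morph _ (amulDr _) (amul0r _)).
by apply: eq_bigr => n _ /=; rewrite big_cat ascalel ascaler scalerA.
Qed.

Definition pevalE :=
  (peval_add, peval_scale, peval_zero, peval_one, peval_mul).
End Eval.

Local Ltac by_eval := apply: pres_eq => U f fP; rewrite !pevalE //.

Lemma paddA : associative padd.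
Proof. by move=> x y z; by_eval; rewrite addrA. Qed.
Lemma paddC : commutative padd.
Proof. by move=> x y; by_eval; rewrite addrC. Qed.
Lemma padd0 : left_id pzero padd.
Proof. by move=> x; by_eval; rewrite add0r. Qed.
Lemma paddN : left_inverse pzero popp padd.
Proof. by move=> x; by_eval; rewrite scaleN1r addNr. Qed.
HB.instance Definition _ :=
  GRing.isZmodule.Build presented paddA paddC padd0 paddN.

Lemma pscaleA k l x : pscale k (pscale l x) = pscale (k * l) x.
Proof. by by_eval; rewrite scalerA. Qed.
Lemma pscale1 : left_id 1 pscale.
Proof. by move=> x; by_eval; rewrite scale1r. Qed.
Lemma pscaleDr : right_distributive pscale +%R.
Proof. by move=> k x y; by_eval; rewrite scalerDr. Qed.
Lemma pscaleDl x : {morph pscale^~ x : k l / k + l}.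
Proof. by move=> k l; by_eval; rewrite scalerDl. Qed.
HB.instance Definition _ := GRing.Zmodule_isLmodule.Build K presented
  pscaleA pscale1 pscaleDr pscaleDl.

Lemma pmul_is_algebra : is_algebra pmul pone.
Proof.
split=> [|x y z|x|x]; last 3 first.
- by by_eval; rewrite amulA.
- by by_eval; rewrite amul1l.
- by by_eval; rewrite amul1r.
by split=> x k y z; by_eval; rewrite (amulDl, amulDr) (ascalel, ascaler).
Qed.
HB.instance Definition _ :=
  Lmodule_isUAlgebra.Build K presented pmul_is_algebra.

Lemma peval_tfold (U : ualgType K) (f : G -> U) (V W : lmodType K)
    (g : V -> W -> presented) (t : V ⊗ W) : P f ->
  peval f (tfold g t) = \sw_(v, w <- t) peval f (g v w).
Proof.
move=> fP; rewrite /tfold /fsum.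
have fD : {morph (@peval U f) : x y / x + y} by move=> x y; apply: peval_add.
have f0 : @peval U f 0 = 0 by apply: peval_zero.
by rewrite (big_morph _ fD f0).
Qed.

End Presented.

Section Drin.
Variables (K : fieldType) (H : qtHopf K) (C B : braidedBialg H).
Variable d : weakDuality C B.

Record drin_relations (U : ualgType K) (iC : C -> U) (iH : H -> U) (iB : B -> U)
    : Prop := {
  drin_subC : is_alg_hom amul 𝟙 amul 𝟙 iC;
  drin_subH : is_alg_hom amul 𝟙 amul 𝟙 iH;
  drin_subB : is_alg_hom amul 𝟙 amul 𝟙 iB;
  drin_cross : forall (b : B) (c : C),
    \sw_(b1, b2 <- bcomul b) \sw_(c1, c2 <- bcomul c) \sw_(s, s' <- Rinv H)
      (ev d (c2 ⊗ b1) *: (iB (s ▷ b2) ∙ iC (s' ▷ c1))) =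
    \sw_(b1, b2 <- bcomul b) \sw_(c1, c2 <- bcomul c) \sw_(s, s' <- Rinv H)
    \sw_(r, r' <- Rmat H)
      (ev d ((s' ▷ c1) ⊗ (r ▷ b2)) *: (iH s ∙ iC c2 ∙ iB b1 ∙ iH r'));
  drin_HB : forall (h : H) (b : B),
    iH h ∙ iB b = \sw_(h1, h2 <- hcomul h) (iB (h1 ▷ b) ∙ iH h2);
  drin_HC : forall (h : H) (c : C),
    iH h ∙ iC c = \sw_(h1, h2 <- hcomul h) (iC (h1 ▷ c) ∙ iH h2)
}.

Definition drin_gen : choiceType := (C + H + B)%type.

Definition Drin : ualgType K :=
  presented (fun (U : ualgType K) (f : drin_gen -> U) =>
    drin_relations (fun c => f (inl (inl c))) (fun h => f (inl (inr h)))
                   (fun b => f (inr b))).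

Definition inC (c : C) : Drin := pgen _ (inl (inl c)).
Definition inH (h : H) : Drin := pgen _ (inl (inr h)).
Definition inB (b : B) : Drin := pgen _ (inr b).

Lemma drin_relationsP : drin_relations inC inH inB.
Proof.
have al (X : ualgType K) (i : X -> Drin) :
    (forall (U : ualgType K) (f : drin_gen -> U),
       drin_relations (fun c => f (inl (inl c))) (fun h => f (inl (inr h)))
                      (fun b => f (inr b)) ->
       is_alg_hom amul 𝟙 amul 𝟙 (fun x => peval f (i x))) ->
    is_alg_hom amul 𝟙 amul 𝟙 i.
  move=> e; split=> [k x y|x y|]; apply: pres_eq => U f fP.
  - by rewrite peval_add // peval_scale // (alg_hom_linear (e U f fP)).
  - by rewrite peval_mul // (alg_homM (e U f fP)).
  - by rewrite peval_one // (alg_hom1 (e U f fP)).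
split.
- apply: al => U f fP; have [e1 e2 e3] := drin_subC fP.
  by split=> [k x y|x y|]; rewrite !peval_gen; rewrite ?e1 ?e2 ?e3.
- apply: al => U f fP; have [e1 e2 e3] := drin_subH fP.
  by split=> [k x y|x y|]; rewrite !peval_gen; rewrite ?e1 ?e2 ?e3.
- apply: al => U f fP; have [e1 e2 e3] := drin_subB fP.
  by split=> [k x y|x y|]; rewrite !peval_gen; rewrite ?e1 ?e2 ?e3.
- move=> b c; apply: pres_eq => U f fP; rewrite !peval_tfold //.
  etransitivity; last (etransitivity; first exact: (drin_cross fP b c)).
    apply: eq_bigr => ? _; rewrite peval_tfold //; apply: eq_bigr => ? _.
    rewrite peval_tfold //; apply: eq_bigr => ? _.
    by rewrite peval_scale // peval_mul // !peval_gen.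
  apply: eq_bigr => ? _; rewrite peval_tfold //; apply: eq_bigr => ? _.
  rewrite !peval_tfold //; apply: eq_bigr => ? _.
  rewrite !peval_tfold //; apply: eq_bigr => ? _.
  by rewrite peval_scale // !peval_mul // !peval_gen.
- move=> h b; apply: pres_eq => U f fP.
  rewrite peval_mul // !peval_gen // (drin_HB fP h b) peval_tfold //.
  by apply: eq_bigr => p _; rewrite peval_mul // !peval_gen.
- move=> h c; apply: pres_eq => U f fP.
  rewrite peval_mul // !peval_gen // (drin_HC fP h c) peval_tfold //.
  by apply: eq_bigr => p _; rewrite peval_mul // !peval_gen.
Qed.

(* The bialgebra structure of Drin; as C, H, B generate Drin and both maps are
   algebra homomorphisms, they are determined by these conditions. *)
Record is_drin_bialgebra (comul : Drin -> Drin ⊗ Drin) (counit : Drin -> K)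
    : Prop := {
  drin_bialg : is_bialgebra comul counit;
  drin_comulH : forall h, comul (inH h) = \sw_(h1, h2 <- hcomul h) inH h1 ⊗ inH h2;
  drin_comulB : forall b, comul (inB b) =
    \sw_(b1, b2 <- bcomul b) \sw_(r, r' <- Rmat H)
      (inB b1 ∙ inH r') ⊗ inB (r ▷ b2);
  drin_comulC : forall c, comul (inC c) =
    \sw_(c1, c2 <- bcomul c) \sw_(s, s' <- Rinv H)
      (inH s ∙ inC c2) ⊗ inC (s' ▷ c1);
  drin_counitH : forall h, counit (inH h) = hcounit h;
  drin_counitB : forall b, counit (inB b) = bcounit b;
  drin_counitC : forall c, counit (inC c) = bcounit c
}.

Variable A : braidedComodAlg B.

Local Notation E := (A ⊗ (C ⊗ H))%type.

Definition ach (a : A) (c : C) (h : H) : E := a ⊗ (c ⊗ h).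

(* The product (a c h)(a' c' h') put in the order A, C, H: h is moved to the
   right of a' and c', and then c to the right of the resulting element of A. *)
Definition cross_mul (x y : E) : E :=
  \sw_(a, ch <- x) \sw_(c, h <- ch) \sw_(a', ch' <- y) \sw_(c', h' <- ch')
  \sw_(h1, h23 <- hcomul h) \sw_(h2, h3 <- hcomul h23)
  \sw_(b, a0 <- coact (h1 ▷ a')) \sw_(c1, c2 <- bcomul c) \sw_(s, s' <- Rinv H)
    ev d (c2 ⊗ b) *:
      ach (a ∙ (s ▷ a0)) ((s' ▷ c1) ∙ (h2 ▷ c')) (h3 ∙ h').

Definition cross_one : E := ach 𝟙 𝟙 𝟙.

Local Notation "x ⋆ y" := (cross_mul x y) (at level 40, left associativity).
Local Notation fA a := (ach a 𝟙 𝟙).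
Local Notation fC c := (ach 𝟙 c 𝟙).
Local Notation fH h := (ach 𝟙 𝟙 h).

(* These conditions determine the product, so they confirm the formula for
   cross_mul. *)
Record crossed_algebra : Prop := {
  cross_alg : is_algebra cross_mul cross_one;
  cross_subA : is_alg_hom amul 𝟙 cross_mul cross_one (fun a => fA a);
  cross_subC : is_alg_hom amul 𝟙 cross_mul cross_one (fun c => fC c);
  cross_subH : is_alg_hom amul 𝟙 cross_mul cross_one (fun h => fH h);
  cross_ach : forall a c h, ach a c h = fA a ⋆ fC c ⋆ fH h;
  cross_CA : forall c a, fC c ⋆ fA a =
    \sw_(b, a0 <- coact a) \sw_(c1, c2 <- bcomul c) \sw_(s, s' <- Rinv H)
      (ev d (c2 ⊗ b) *: (fA (s ▷ a0) ⋆ fC (s' ▷ c1)));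
  cross_HA : forall h a, fH h ⋆ fA a =
    \sw_(h1, h2 <- hcomul h) (fA (h1 ▷ a) ⋆ fH h2);
  cross_HC : forall h c, fH h ⋆ fC c =
    \sw_(h1, h2 <- hcomul h) (fC (h1 ▷ c) ⋆ fH h2)
}.

Definition incl_AC (t : A ⊗ C) : E := \sw_(a, c <- t) ach a c 𝟙.

Definition in_AC (x : E) : Prop := exists t : A ⊗ C, x = incl_AC t.

Record AC_comodule_subalgebra (delta : E -> Drin ⊗ E) : Prop := {
  AC_one : in_AC cross_one;
  AC_mul : forall x y, in_AC x -> in_AC y -> in_AC (x ⋆ y);
  AC_coact : forall x, in_AC x ->
    exists u : Drin ⊗ (A ⊗ C), delta x = \sw_(g, t <- u) g ⊗ incl_AC t
}.

End Drin.

(* Main.v *)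
Require Import Defs.
From HB Require Import structures.
From mathcomp Require Import all_boot all_algebra.
From mathcomp Require Import boolp ring.

(** The crossed product A ⋊ C ⋊ H is an ordinary smash product. Let X = C ⋊ H
    with the coproduct Δ(c) = R^{-(1)} c_2 ⊗ R^{-(2)} ▷ c_1, Δ(h) = h_1 ⊗ h_2.
    This is the Radford biproduct of H with the braided co-opposite of C, hence
    an ordinary bialgebra ([boson_bialgebra]). The formula
    c ▶ a = ev(c, a^(-1)) a^(0), together with the action of H, makes A an
    X-module algebra ([boson_act_module_algebra]); the one point which is not
    formal is that invariance of the pairing moves the R-matrix from one of its
    arguments to the other ([ev_adjoint]). The relations of the crossed product
    read x a = (x_1 ▶ a) x_2 for x in X, so the crossed product is A # X
    ([cross_mulE]) and its associativity is that of a smash product.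

    The coaction rests on a Yetter-Drinfeld condition. Put
    a^[-1] ⊗ a^[0] = a^(-1) R^(2) ⊗ R^(1) ▷ a^(0). In every algebra satisfying
    the relations of the double,
      x_1 a^[-1] ⊗ x_2 ▶ a^[0] = (x_1 ▶ a)^[-1] x_2 ⊗ (x_1 ▶ a)^[0]
    for all x in X. The set of such x is closed under products ([yd_mul]), so
    this is a statement about H ([yd_H]) and about C ([yd_C]); for C it is the
    cross relation of the double, applied to a^(-1). Multiplying the second leg
    by a further component of x and using coassociativity of X, one gets
    δ(x) δ(a) = δ(x_1 ▶ a) δ(x_2) ([boson_cross]): this is the condition for the
    coactions of A and X to extend to an algebra map on A # X.

    The coproduct of the double comes from the same condition. For B coacting on
    itself it transforms one side of the cross relation for the values Δ(c),
    Δ(h), Δ(b) into a sum whose second leg is a side of the cross relation in the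
    double itself, and applying that relation gives the other side
    ([drin_comul_relations]).

    Coassociativity and the counit axioms, for X, for the double and for the
    coaction on A # X, are equalities between algebra maps and are tested on
    generators, where they follow from the hexagon identities for R and
    coassociativity in the braided category ([coactC_coassoc],
    [coactA_coassoc]). The three coactions are instances of maps into a tensor
    product of two algebras in which C, H and B (or A) are represented, so that
    each identity is proved once and used three times. *)

Set Implicit Arguments.
Unset Strict Implicit.
Unset Printing Implicit Defensive.

Import GRing.Theory.
Local Open Scope ring_scope.

(** * Linearity and Sweedler sums *)

Section Linear.
Variable K : fieldType.
Implicit Types V W U : lmodType K.

Lemma lin_id V : linear (fun x : V => x). Proof. by []. Qed.

Lemma lin_comp V W U (f : W -> U) (g : V -> W) :
  linear f -> linear g -> linear (fun x => f (g x)).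
Proof. by move=> fl gl k x y; rewrite gl fl. Qed.

(** The base field as codomain has to be read as a module over itself, which
    unification does not guess; this variant of [lin_comp] says so. *)
Lemma lin_compK V W (f : W -> K) (g : V -> W) :
  linear (f : W -> K^o) -> linear g -> linear (fun x => f (g x) : K^o).
Proof. by move=> fl gl k x y; rewrite gl fl. Qed.

Lemma lin_bil_l V W U (f : V -> W -> U) w : is_bilinear f -> linear (f^~ w).
Proof. by case=> fl _; apply: fl. Qed.

Lemma lin_bil_r V W U (f : V -> W -> U) v : is_bilinear f -> linear (f v).
Proof. by case=> _; apply. Qed.

Lemma lin0 V W (f : V -> W) : linear f -> f 0 = 0.
Proof.
by move=> fl; have := fl (-1) 0 0; rewrite scaler0 addr0 scaleN1r addNr.
Qed.

Lemma linD V W (f : V -> W) : linear f -> {morph f : x y / x + y}.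
Proof. by move=> fl x y; have := fl 1 x y; rewrite !scale1r. Qed.

Lemma linZ V W (f : V -> W) : linear f -> forall k x, f (k *: x) = k *: f x.
Proof. by move=> fl k x; have := fl k x 0; rewrite (lin0 fl) !addr0. Qed.

Lemma eq_tfold V W (X : zmodType) (f g : V -> W -> X) (t : V ⊗ W) :
  (forall v w, f v w = g v w) -> tfold f t = tfold g t.
Proof. by move=> e; apply: eq_bigr => p _; apply: e. Qed.

(** A Sweedler sum is a finite sum over a chosen decomposition, so independent
    sums commute without any linearity assumption. *)
Lemma tfold_exch V W V' W' (X : zmodType) (F : V -> W -> V' -> W' -> X)
    (t : V ⊗ W) (u : V' ⊗ W') :
  \sw_(a, b <- t) \sw_(x, y <- u) F a b x y =
  \sw_(x, y <- u) \sw_(a, b <- t) F a b x y.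
Proof. exact: exchange_big. Qed.

Lemma pull_step V W V' W' (X : zmodType) (G : V -> W -> X)
    (F : V' -> W' -> V -> W -> X) (t : V ⊗ W) (u : V' ⊗ W') :
  (forall a b, G a b = \sw_(x, y <- u) F x y a b) ->
  tfold G t = \sw_(x, y <- u) \sw_(a, b <- t) F x y a b.
Proof. by move=> e; rewrite (eq_tfold _ e) tfold_exch. Qed.

Lemma lin_sw V W U U' (f : U -> U') (g : V -> W -> U) (t : V ⊗ W) : linear f ->
  f (tfold g t) = \sw_(x, y <- t) f (g x y).
Proof.
by move=> fl; rewrite /tfold /fsum (big_morph _ (linD fl) (lin0 fl)).
Qed.

Lemma lin_tfold V W U U' (t : V ⊗ W) (F : U' -> V -> W -> U) :
  (forall v w, linear (fun x => F x v w)) -> linear (fun x => tfold (F x) t).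
Proof.
move=> Fl k x y; rewrite /tfold /fsum scaler_sumr -big_split /=.
by apply: eq_bigr => p _; rewrite Fl.
Qed.

Lemma sw_tens V W U (F : V -> W -> U) v w :
  is_bilinear F -> tfold F (v ⊗ w) = F v w.
Proof. exact: tfold_tens. Qed.

Lemma sw_sw V W V' W' U (F : V -> W -> U) (g : V' -> W' -> V ⊗ W) t :
  is_bilinear F -> tfold F (tfold g t) = \sw_(x, y <- t) tfold F (g x y).
Proof. by move=> Fb; rewrite (lin_sw _ _ (tfold_linear Fb)). Qed.

Lemma swZ V W U (F : V -> W -> U) k t :
  is_bilinear F -> tfold F (k *: t) = k *: tfold F t.
Proof. by move=> Fb; rewrite (linZ (tfold_linear Fb)). Qed.

Lemma bil_swl V W U V' W' (f : V -> W -> U) (g : V' -> W' -> V) t w :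
  is_bilinear f -> f (tfold g t) w = \sw_(x, y <- t) f (g x y) w.
Proof. by move=> fb; rewrite (lin_sw _ _ (fb.1 w)). Qed.

Lemma bil_swr V W U V' W' (f : V -> W -> U) (g : V' -> W' -> W) t v :
  is_bilinear f -> f v (tfold g t) = \sw_(x, y <- t) f v (g x y).
Proof. by move=> fb; rewrite (lin_sw _ _ (fb.2 v)). Qed.

Lemma bilZl V W U (f : V -> W -> U) k v w :
  is_bilinear f -> f (k *: v) w = k *: f v w.
Proof. by move=> fb; rewrite (linZ (fb.1 w)). Qed.

Lemma bilZr V W U (f : V -> W -> U) k v w :
  is_bilinear f -> f v (k *: w) = k *: f v w.
Proof. by move=> fb; rewrite (linZ (fb.2 v)). Qed.

Lemma scale_swl V W U (k : V -> W -> K) (t : V ⊗ W) (u : U) :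
  tfold k t *: u = \sw_(x, y <- t) (k x y *: u).
Proof. by rewrite /tfold /fsum scaler_suml. Qed.

Lemma scale_swr V W U k (f : V -> W -> U) (t : V ⊗ W) :
  k *: tfold f t = \sw_(x, y <- t) (k *: f x y).
Proof. by rewrite /tfold /fsum scaler_sumr. Qed.

Lemma mul_swl V W (k : V -> W -> K) (t : V ⊗ W) (u : K) :
  tfold k t * u = \sw_(x, y <- t) (k x y * u).
Proof. by rewrite /tfold /fsum mulr_suml. Qed.

Lemma mul_swr V W (k : V -> W -> K) (t : V ⊗ W) (u : K) :
  u * tfold k t = \sw_(x, y <- t) (u * k x y).
Proof. by rewrite /tfold /fsum mulr_sumr. Qed.

Lemma tens_swl V W V' W' (f : V' -> W' -> V) t (w : W) :
  tfold f t ⊗ w = \sw_(x, y <- t) (f x y ⊗ w).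
Proof. by rewrite (bil_swl _ _ _ (tens_bilinear V W)). Qed.
Lemma tens_swr V W V' W' (f : V' -> W' -> W) t (v : V) :
  v ⊗ tfold f t = \sw_(x, y <- t) (v ⊗ f x y).
Proof. by rewrite (bil_swr _ _ _ (tens_bilinear V W)). Qed.
Lemma tensZl V W k (v : V) (w : W) : (k *: v) ⊗ w = k *: (v ⊗ w).
Proof. by rewrite (bilZl _ _ _ (tens_bilinear V W)). Qed.
Lemma tensZr V W k (v : V) (w : W) : v ⊗ (k *: w) = k *: (v ⊗ w).
Proof. by rewrite (bilZr _ _ _ (tens_bilinear V W)). Qed.

Section Alg.
Variable A : ualgType K.
Lemma amul_swl V W (f : V -> W -> A) t (w : A) :
  tfold f t ∙ w = \sw_(x, y <- t) (f x y ∙ w).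
Proof. by rewrite (bil_swl _ _ _ (@amul_bilinear K A)). Qed.
Lemma amul_swr V W (f : V -> W -> A) t (w : A) :
  w ∙ tfold f t = \sw_(x, y <- t) (w ∙ f x y).
Proof. by rewrite (bil_swr _ _ _ (@amul_bilinear K A)). Qed.
End Alg.

Lemma lin_scalel V U (k : V -> K) (u : U) :
  linear (k : V -> K^o) -> linear (fun x => k x *: u).
Proof. by move=> kl a x y; rewrite (kl a x y) scalerDl scalerA. Qed.

Lemma lin_mull V (k : V -> K) (l : K) :
  linear (k : V -> K^o) -> linear (fun x => k x * l : K^o).
Proof. by move=> kl a x y; rewrite (kl a x y) mulrDl /= scalerAl. Qed.

Lemma lin_mulr V (k : V -> K) (l : K) :
  linear (k : V -> K^o) -> linear (fun x => l * k x : K^o).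
Proof. by move=> kl a x y; rewrite (kl a x y) mulrDr /= scalerAr. Qed.

Lemma lin_scaler V U (f : V -> U) (k : K) :
  linear f -> linear (fun x => k *: f x).
Proof. by move=> fl a x y; rewrite fl scalerDr !scalerA mulrC. Qed.

End Linear.

Create HintDb lin.
(** [lin] proves that an expression is linear in a variable by descending to the
    unique place where the variable occurs: each operation on the way is linear
    in that argument, by a hypothesis or by the hint database [lin]. *)
Ltac lin_const :=
  match goal with
  | h : is_alg_hom _ _ _ _ ?f |- _ => exact (alg_hom_linear h)
  | |- _ => solve [eauto 2 with lin nocore]
  end.
Ltac lin :=
  cbv beta;
  lazymatch goal with
  | |- is_bilinear _ => split; [move=> ? | move=> ?]; lin
  | |- linear (fun x => x) => exact: lin_id
  | |- linear (tfold _) => refine (tfold_linear _); lin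
  | |- linear ( *:%R _) => exact: (lin_scaler _ (@lin_id _ _))
  | |- linear (fun x => tfold (@?F x) (@?t x)) =>
      lazymatch t with
      | fun _ => ?t0 => refine (@lin_tfold _ _ _ _ _ t0 _ _); move=> ? ?; lin
      | _ => lazymatch F with fun _ => ?F0 =>
          refine (@lin_comp _ _ _ _ (tfold F0) _ (tfold_linear _) _); lin end
      end
  | |- linear (fun x => @?k x *: @?v x) =>
      lazymatch v with
      | fun _ => ?v0 => refine (@lin_scalel _ _ _ _ v0 _); lin
      | _ => lazymatch k with fun _ => ?k0 =>
          refine (@lin_scaler _ _ _ _ k0 _); lin end
      end
  | |- linear (fun x => @?k x * @?l x) =>
      lazymatch l with
      | fun _ => ?l0 => refine (@lin_mull _ _ _ l0 _); lin
      | _ => lazymatch k with fun _ => ?k0 =>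
          refine (@lin_mulr _ _ _ k0 _); lin end
      end
  | |- linear (fun x => ?f (@?g x) (@?a x) (@?b x)) =>
      lazymatch g with
      | fun _ => ?g0 => lin_app
      | _ => lazymatch a with fun _ => ?a0 => lazymatch b with fun _ => ?b0 =>
          refine (@lin_comp _ _ _ _ (fun y => f y a0 b0) _ _ _); [lin_const | lin]
          end end
      end
  | _ => lin_app
  end
with lin_app :=
  lazymatch goal with
  | |- linear (fun x => ?f (@?g x) (@?b x)) =>
      lazymatch b with
      | fun _ => ?b0 =>
        refine (@lin_comp _ _ _ _ (fun y => f y b0) _ (@lin_bil_l _ _ _ _ f b0 _) _);
        [lin_const | lin]
      | _ => lazymatch g with fun _ => ?g0 =>
          first [ refine (@lin_comp _ _ _ _ (f g0) _ (@lin_bil_r _ _ _ _ f g0 _) _);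
              [lin_const | lin]
            | refine (@lin_comp _ _ _ _ (f g0) _ _ _); [lin_const | lin]
            | refine (@lin_compK _ _ _ (f g0) _ _ _); [lin_const | lin]] end
      end
  | |- linear (fun x => ?f (@?g x)) =>
      first [ refine (@lin_comp _ _ _ _ f _ _ _); [lin_const | lin]
            | refine (@lin_compK _ _ _ f _ _ _); [lin_const | lin]]
  | |- linear ?f => first [lin_const | solve [eauto 2 using lin_bil_l,
      lin_bil_r with lin nocore]]
  end.

#[export] Hint Extern 0 => exact: tens_bilinear : lin.
#[export] Hint Extern 0 => exact: amul_bilinear : lin.

(** For a goal [l = ?e], [sw_norm] instantiates [?e] with a normal form of [l] in
    which the Sweedler sums are outermost, sums over explicit tensors have been
    evaluated by bilinearity, and products are associated to the left. [sw_hook]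
    and [sw_split] hold rewriting rules which are added as the structures they
    speak of are introduced. *)
Ltac sw_hook := fail.
Ltac sw_split t := fail.
Ltac sw_norm :=
  cbv beta;
  lazymatch goal with |- ?l = _ =>
  lazymatch l with
  | tfold _ (tens _ _) => etransitivity; [apply: sw_tens; lin | sw_norm]
  | tfold _ (tfold _ _) => etransitivity; [apply: sw_sw; lin | sw_norm]
  | tfold _ (_ *: _) => etransitivity; [apply: swZ; lin | sw_norm]
  | tfold _ ?t =>
    first [ sw_split t; [lin | sw_norm]
          | etransitivity; [apply: congr1; solve [sw_redex t] | sw_norm]
          | apply: eq_tfold => ? ?; sw_norm ]
  | _ => first [ etransitivity; [solve [sw_redex l] | sw_norm] | reflexivity ]
  end end
with sw_redex l :=
  first [ progress rewrite ?(amul_swl, amul_swr, tens_swl, tens_swr, scale_swl,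
             scale_swr, mul_swl, mul_swr, ascalel, ascaler, tensZl, tensZr,
             amulA, amul1l, amul1r)
        | sw_hook ]; reflexivity.

(** [sw_perm] proves equalities up to a permutation of independent sums: it
    moves a sum over the outermost tensor of one side to the front of the other
    side, and backtracks over the choices when this tensor occurs several times,
    as the R-matrix does. *)
Ltac sw_pull t :=
  lazymatch goal with |- tfold ?F ?u = _ =>
    (reflexivity + (apply: pull_step => ? ?; sw_pull t)) end.
Ltac sw_perm :=
  lazymatch goal with
  | |- tfold ?F ?t = tfold _ _ =>
     first [ apply: eq_tfold => ? ?; solve [sw_perm]
           | symmetry; etransitivity;
             [ refine (@pull_step _ _ _ _ _ _ _ _ _ t _) => ? ?; sw_pull t |];
             symmetry; apply: eq_tfold => ? ?; sw_perm ]
  | |- _ => reflexivity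
  end.
Ltac sw_simp := etransitivity; [sw_norm | symmetry; etransitivity;
    [sw_norm | symmetry]].

Lemma tens_bil_ext (K : fieldType) (V W V' W' U : lmodType K)
    (f g : V ⊗ W -> V' ⊗ W' -> U) : is_bilinear f -> is_bilinear g ->
  (forall v w v' w', f (v ⊗ w) (v' ⊗ w') = g (v ⊗ w) (v' ⊗ w')) -> f =2 g.
Proof.
move=> [f1 f2] [g1 g2] e x y; move: y; apply: tens_ext => // v' w'.
by move: x; apply: tens_ext => // v w.
Qed.

Section TensorAlgebra.
Variable K : fieldType.

Lemma tmul_bilinear (A B : ualgType K) :
  is_bilinear (tmul amul amul : A ⊗ B -> A ⊗ B -> A ⊗ B).
Proof. rewrite /tmul; lin. Qed.
Hint Extern 0 => exact: tmul_bilinear : lin.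

Variables A B : ualgType K.

Lemma tmul_tens (a a' : A) (b b' : B) :
  tmul amul amul (a ⊗ b) (a' ⊗ b') = (a ∙ a') ⊗ (b ∙ b').
Proof. rewrite /tmul; etransitivity; [sw_norm|]; reflexivity. Qed.

Lemma tensor_is_algebra :
  is_algebra (tmul amul amul : A ⊗ B -> A ⊗ B -> A ⊗ B) (𝟙 ⊗ 𝟙).
Proof.
split=> [|x y z|x|x]; first exact: tmul_bilinear.
- move: z; apply: tens_ext; [lin|lin|] => a b.
  move: x y; apply: tens_bil_ext; [lin|lin|] => a' b' a'' b''.
  by rewrite !tmul_tens !amulA.
- by move: x; apply: tens_ext; [lin|lin|] => a b; rewrite tmul_tens !amul1l.
- by move: x; apply: tens_ext; [lin|lin|] => a b; rewrite tmul_tens !amul1r.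
Qed.

HB.instance Definition _ :=
  Lmodule_isUAlgebra.Build K (A ⊗ B)%type tensor_is_algebra.

Lemma amul_tens (a a' : A) (b b' : B) :
  (a ⊗ b) ∙ (a' ⊗ b') = (a ∙ a') ⊗ (b ∙ b').
Proof. exact: tmul_tens. Qed.
End TensorAlgebra.

Lemma sw_amul (K : fieldType) (A B : ualgType K) (U : lmodType K)
    (F : A -> B -> U) (t u : A ⊗ B) : is_bilinear F ->
  tfold F (t ∙ u) = \sw_(a, b <- t) \sw_(a', b' <- u) F (a ∙ a') (b ∙ b').
Proof.
move=> FP; have FPP : linear (tfold F) by exact: tfold_linear.
rewrite [t ∙ u]/(tmul amul amul t u) /tmul sw_sw //.
apply: eq_tfold => a b; rewrite sw_sw //.
by apply: eq_tfold => a' b'; rewrite sw_tens.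
Qed.

Lemma sw_one (K : fieldType) (A B : ualgType K) (U : lmodType K)
    (F : A -> B -> U) : is_bilinear F -> tfold F (𝟙 : A ⊗ B) = F 𝟙 𝟙.
Proof. exact: sw_tens. Qed.

Ltac sw_hook ::= progress rewrite ?(amul_tens).
Ltac sw_split t ::=
  lazymatch t with
  | amul _ _ => etransitivity; [apply: sw_amul|]
  | aone => etransitivity; [apply: sw_one|]
  end.

Section Trilinear.
Variable K : fieldType.
(** Coassociativity and the hexagon axioms are equations between elements of
    triple tensor products; they are used by applying a trilinear map to both
    sides. *)
Definition is_trilinear (V W X U : lmodType K) (F : V -> W -> X -> U) :=
  [/\ forall w x, linear (fun v => F v w x), forall v x, linear (fun w => F v w x)
    & forall v w, linear (fun x => F v w x)].

Definition tfold3 (V W X U : lmodType K) (F : V -> W -> X -> U) (t : V ⊗ (W ⊗ X)) :=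
  \sw_(v, u <- t) \sw_(w, x <- u) F v w x.

Variables (V W X U : lmodType K) (F : V -> W -> X -> U).
Hypothesis FP : is_trilinear F.

Lemma tri1 w x : linear (fun v => F v w x). Proof. by case: FP. Qed.
Lemma tri2 v x : linear (fun w => F v w x). Proof. by case: FP. Qed.
Lemma tri3 v w : linear (fun x => F v w x). Proof. by case: FP. Qed.

Lemma tri_bil v : is_bilinear (F v).
Proof. split; [exact: tri2 | exact: tri3]. Qed.

Lemma tfold3_linear : linear (tfold3 F).
Proof.
apply: tfold_linear; split=> [u|v]; first by apply: lin_tfold => *; apply: tri1.
by apply: tfold_linear; apply: tri_bil.
Qed.

Lemma tfold3_tens v w x : tfold3 F (v ⊗ (w ⊗ x)) = F v w x.
Proof.
rewrite /tfold3 !sw_tens //; first exact: tri_bil.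
split=> [u|v']; first by apply: lin_tfold => *; apply: tri1.
by apply: tfold_linear; apply: tri_bil.
Qed.
Lemma tfold3_sw (V' W' : lmodType K) (f : V' -> W' -> V ⊗ (W ⊗ X)) t :
  tfold3 F (tfold f t) = \sw_(x, y <- t) tfold3 F (f x y).
Proof. exact: (lin_sw _ _ tfold3_linear). Qed.
End Trilinear.

Ltac trilin := solve [split=> ? ?; lin].

(** [tri_transfer F FP e] proves the equation obtained by applying the trilinear
    map [F] to the equation [e]. *)
Ltac tri_compute FP :=
  rewrite ?(tfold3_tens FP) ?(tfold3_sw FP) //;
  try (apply: eq_tfold => ? ?; tri_compute FP).
Ltac tri_transfer F FP e :=
  let E := fresh in
  have E := congr1 (tfold3 F) e;
  etransitivity; last (etransitivity; first exact: E);
  [symmetry|]; tri_compute FP.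

(** * The universal R-matrix *)

Section Coalgebra.
Variables (K : fieldType) (V : lmodType K) (D : V -> V ⊗ V) (e : V -> K).
Hypothesis hD : is_coalgebra D e.
Variable U : lmodType K.

Lemma sw_counitl (F : V -> U) v : linear F ->
  \sw_(x, y <- D v) (e x *: F y) = F v.
Proof.
move=> Fl; rewrite -{2}(counitl hD v) lin_sw //.
by apply: eq_tfold => x y; rewrite linZ.
Qed.

Lemma sw_counitr (F : V -> U) v : linear F ->
  \sw_(x, y <- D v) (e y *: F x) = F v.
Proof.
move=> Fl; rewrite -{2}(counitr hD v) lin_sw //.
by apply: eq_tfold => x y; rewrite linZ.
Qed.

Lemma sw_coassoc (F : V -> V -> V -> U) v : is_trilinear F ->
  \sw_(x, y <- D v) \sw_(x1, x2 <- D x) F x1 x2 y =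
  \sw_(x, y <- D v) \sw_(y1, y2 <- D y) F x y1 y2.
Proof. by move=> FP; tri_transfer F FP (coassoc hD v). Qed.
End Coalgebra.

Lemma hcomul_linear (K : fieldType) (H : qtHopf K) : linear (@hcomul K H).
Proof. exact: comul_linear (bialg_coalg (hbialgP H)). Qed.
Lemma hcounit_linear (K : fieldType) (H : qtHopf K) :
  linear (@hcounit K H : H -> K^o).
Proof. exact: counit_linear (bialg_coalg (hbialgP H)). Qed.
#[export] Hint Extern 0 => exact: hcomul_linear : lin.
#[export] Hint Extern 0 => exact: hcounit_linear : lin.

Section Rmatrix.
Variables (K : fieldType) (H : qtHopf K).

Section Transfer.
Variable (U : lmodType K).

Lemma sw_hcounitl (F : H -> U) h : linear F ->
  \sw_(x, y <- hcomul h) (hcounit x *: F y) = F h.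
Proof. by move=> Fl; exact: (sw_counitl (bialg_coalg (hbialgP H)) h Fl). Qed.

Lemma sw_hcounitr (F : H -> U) h : linear F ->
  \sw_(x, y <- hcomul h) (hcounit y *: F x) = F h.
Proof. by move=> Fl; exact: (sw_counitr (bialg_coalg (hbialgP H)) h Fl). Qed.

Variable F : H -> H -> H -> U.
Hypothesis FP : is_trilinear F.

Lemma sw_hcoassoc h :
  \sw_(x, y <- hcomul h) \sw_(x1, x2 <- hcomul x) F x1 x2 y =
  \sw_(x, y <- hcomul h) \sw_(y1, y2 <- hcomul y) F x y1 y2.
Proof. exact: (sw_coassoc (bialg_coalg (hbialgP H)) h FP). Qed.

Lemma sw_Rmat_comull :
  \sw_(r, r' <- Rmat H) \sw_(x, y <- hcomul r) F x y r' =
  \sw_(r, r' <- Rmat H) \sw_(s, s' <- Rmat H) F r s (r' ∙ s').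
Proof. tri_transfer F FP (Rmat_comull H). Qed.

Lemma sw_Rmat_comulr :
  \sw_(r, r' <- Rmat H) \sw_(x, y <- hcomul r') F r x y =
  \sw_(r, r' <- Rmat H) \sw_(s, s' <- Rmat H) F (r ∙ s) s' r'.
Proof. tri_transfer F FP (Rmat_comulr H). Qed.
End Transfer.

(** The form with the middle one of three components split is the one in which
    an identity for the coproduct can be applied between the two legs. *)
Lemma sw_hcoassoc4 (U : lmodType K) (G : H -> H -> H -> H -> U) h :
  (forall x y, is_bilinear (G x y)) ->
  (forall z w, is_bilinear (fun x y => G x y z w)) ->
  \sw_(h1, h2 <- hcomul h) \sw_(x, y <- hcomul h1) \sw_(z, w <- hcomul h2) G x y z w =
  \sw_(x, h' <- hcomul h) \sw_(k, w <- hcomul h') \sw_(y, z <- hcomul k) G x y z w.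
Proof.
move=> GP GP'.
have G1 y z w : linear (fun x => G x y z w) by exact: (GP' z w).1.
have G2 x z w : linear (fun y => G x y z w) by exact: (GP' z w).2.
have G3 x y w : linear (fun z => G x y z w) by exact: (GP x y).1.
have G4 x y z : linear (fun w => G x y z w) by exact: (GP x y).2.
rewrite (sw_hcoassoc (F := fun x y h2 => \sw_(z, w <- hcomul h2) G x y z w)).
  by apply: eq_tfold => x h'; rewrite sw_hcoassoc.
split=> *; first by apply: lin_tfold => *; apply: G1.
  by apply: lin_tfold => *; apply: G2.
by apply: (lin_comp (tfold_linear (GP _ _))); apply: hcomul_linear.
Qed.

Lemma sw_RmatK (U : lmodType K) (F : H -> H -> U) : is_bilinear F ->
  \sw_(r, r' <- Rmat H) \sw_(s, s' <- Rinv H) F (r ∙ s) (r' ∙ s') = F 𝟙 𝟙.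
Proof.
move=> FP; rewrite -(sw_tens _ _ FP) -(RmatK H) /tmul; symmetry.
etransitivity; last reflexivity.
by sw_norm.
Qed.

Lemma sw_RinvK (U : lmodType K) (F : H -> H -> U) : is_bilinear F ->
  \sw_(s, s' <- Rinv H) \sw_(r, r' <- Rmat H) F (s ∙ r) (s' ∙ r') = F 𝟙 𝟙.
Proof.
move=> FP; rewrite -(sw_tens _ _ FP) -(RinvK H) /tmul; symmetry.
by sw_norm.
Qed.

Definition hcomulM : forall g h : H, hcomul (g ∙ h) = hcomul g ∙ hcomul h :=
  alg_homM (bialg_comul (hbialgP H)).
Definition hcomul1 : hcomul (𝟙 : H) = 𝟙 ⊗ 𝟙 := alg_hom1 (bialg_comul (hbialgP H)).
Definition hcounitM : forall g h : H, hcounit (g ∙ h) = hcounit g * hcounit h :=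
  alg_homM (bialg_counit (hbialgP H)).
Definition hcounit1 : hcounit (𝟙 : H) = 1 := alg_hom1 (bialg_counit (hbialgP H)).

Ltac sw_hook ::= progress rewrite ?(amul_tens, hcomulM, hcounitM).

(** Both sides are inverse, on different sides, to the image of R under Δ ⊗ id,
    which is a product of two copies of R by the hexagon axiom. *)
Lemma Rinv_comull :
  \sw_(s, s' <- Rinv H) \sw_(x, y <- hcomul s) x ⊗ (y ⊗ s') =
  \sw_(s, s' <- Rinv H) \sw_(t, t' <- Rinv H) s ⊗ (t ⊗ (t' ∙ s')).
Proof.
set X := LHS; set Y := RHS.
pose P := \sw_(r, r' <- Rmat H) \sw_(x, y <- hcomul r) x ⊗ (y ⊗ r').
have PX : P ∙ X = 𝟙 ⊗ (𝟙 ⊗ 𝟙).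
  transitivity (\sw_(r, r' <- Rmat H) \sw_(s, s' <- Rinv H)
     \sw_(x, y <- hcomul (r ∙ s)) x ⊗ (y ⊗ (r' ∙ s'))).
    rewrite /P /X; sw_simp; sw_perm.
  have FP : is_bilinear (fun a b : H => \sw_(x, y <- hcomul a) x ⊗ (y ⊗ b)) by lin.
  by rewrite (sw_RmatK FP) hcomul1; sw_norm.
have YP : Y ∙ P = 𝟙 ⊗ (𝟙 ⊗ 𝟙).
  rewrite /Y /P (sw_Rmat_comull (F := fun x y z => x ⊗ (y ⊗ z))); last trilin.
  transitivity (\sw_(s, s' <- Rinv H) \sw_(r, r' <- Rmat H)
     \sw_(t, t' <- Rinv H) \sw_(q, q' <- Rmat H)
      (s ∙ r) ⊗ ((t ∙ q) ⊗ ((t' ∙ (s' ∙ r')) ∙ q'))).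
    sw_simp; sw_perm.
  have FP : is_bilinear (fun a b : H => \sw_(t, t' <- Rinv H) \sw_(q, q' <- Rmat H)
      a ⊗ ((t ∙ q) ⊗ ((t' ∙ b) ∙ q'))) by lin.
  rewrite (sw_RinvK FP).
  have FP' : is_bilinear (fun a b : H => (𝟙 : H) ⊗ (a ⊗ b)) by lin.
  by rewrite -(sw_RinvK FP'); sw_simp.
transitivity (Y ∙ P ∙ X); first by rewrite YP; exact/esym/amul1l.
by rewrite -amulA PX; exact: amul1r.
Qed.

Lemma Rinv_comulr :
  \sw_(s, s' <- Rinv H) \sw_(x, y <- hcomul s') s ⊗ (x ⊗ y) =
  \sw_(s, s' <- Rinv H) \sw_(t, t' <- Rinv H) (s ∙ t) ⊗ (s' ⊗ t').
Proof.
set X := LHS; set Y := RHS.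
pose P := \sw_(r, r' <- Rmat H) \sw_(x, y <- hcomul r') r ⊗ (x ⊗ y).
have PX : P ∙ X = 𝟙 ⊗ (𝟙 ⊗ 𝟙).
  transitivity (\sw_(r, r' <- Rmat H) \sw_(s, s' <- Rinv H)
     \sw_(x, y <- hcomul (r' ∙ s')) (r ∙ s) ⊗ (x ⊗ y)).
    rewrite /P /X; sw_simp; sw_perm.
  have FP : is_bilinear (fun a b : H => \sw_(x, y <- hcomul b) a ⊗ (x ⊗ y)) by lin.
  by rewrite (sw_RmatK FP) hcomul1; sw_norm.
have YP : Y ∙ P = 𝟙 ⊗ (𝟙 ⊗ 𝟙).
  rewrite /Y /P (sw_Rmat_comulr (F := fun x y z => x ⊗ (y ⊗ z))); last trilin.
  transitivity (\sw_(s, s' <- Rinv H) \sw_(q, q' <- Rmat H)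
     \sw_(t, t' <- Rinv H) \sw_(r, r' <- Rmat H)
      (s ∙ (t ∙ r) ∙ q) ⊗ ((s' ∙ q') ⊗ (t' ∙ r'))).
    sw_simp; sw_perm.
  transitivity (\sw_(s, s' <- Rinv H) \sw_(q, q' <- Rmat H)
      (s ∙ q) ⊗ ((s' ∙ q') ⊗ (𝟙 : H))).
    apply: eq_tfold => s s'; apply: eq_tfold => q q'.
    have FP : is_bilinear (fun a b : H => (s ∙ a ∙ q) ⊗ ((s' ∙ q') ⊗ b)) by lin.
    by rewrite (sw_RinvK FP) amul1r.
  have FP : is_bilinear (fun a b : H => a ⊗ (b ⊗ (𝟙 : H))) by lin.
  by rewrite (sw_RinvK FP).
transitivity (Y ∙ P ∙ X); first by rewrite YP; exact/esym/amul1l.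
by rewrite -amulA PX; exact: amul1r.
Qed.

Section RinvTransfer.
Variables (U : lmodType K) (F : H -> H -> H -> U).
Hypothesis FP : is_trilinear F.

Lemma sw_Rinv_comull :
  \sw_(s, s' <- Rinv H) \sw_(x, y <- hcomul s) F x y s' =
  \sw_(s, s' <- Rinv H) \sw_(t, t' <- Rinv H) F s t (t' ∙ s').
Proof. tri_transfer F FP Rinv_comull. Qed.

Lemma sw_Rinv_comulr :
  \sw_(s, s' <- Rinv H) \sw_(x, y <- hcomul s') F s x y =
  \sw_(s, s' <- Rinv H) \sw_(t, t' <- Rinv H) F (s ∙ t) s' t'.
Proof. tri_transfer F FP Rinv_comulr. Qed.
End RinvTransfer.

Lemma tens1_inj (x : H) : x ⊗ (𝟙 : H) = 𝟙 ⊗ 𝟙 -> x = 𝟙.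
Proof.
have FP : is_bilinear (fun a b : H => hcounit b *: a) by lin.
by move/(congr1 (tfold (fun a b : H => hcounit b *: a)));
  rewrite !(sw_tens _ _ FP) hcounit1 !scale1r.
Qed.

Lemma tens1l_inj (x : H) : (𝟙 : H) ⊗ x = 𝟙 ⊗ 𝟙 -> x = 𝟙.
Proof.
have FP : is_bilinear (fun a b : H => hcounit a *: b) by lin.
by move/(congr1 (tfold (fun a b : H => hcounit a *: b)));
  rewrite !(sw_tens _ _ FP) hcounit1 !scale1r.
Qed.

Lemma RmatRinv : Rmat H ∙ Rinv H = 𝟙. Proof. exact: RmatK. Qed.
Lemma RinvRmat : Rinv H ∙ Rmat H = 𝟙. Proof. exact: RinvK. Qed.

(** Applying the counit to one component of the hexagon axiom gives
    R = (1 ⊗ e) R for the left-hand side e; as R is invertible, e = 1. The three lemmas below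
    are variants of this argument. *)
Lemma Rmat_counitl : \sw_(r, r' <- Rmat H) (hcounit r *: r') = 𝟙.
Proof.
set e := LHS; apply: tens1l_inj; transitivity (Rmat H ∙ Rinv H); last exact: RmatRinv.
have FP : is_trilinear (fun x y z : H => hcounit x *: (y ⊗ z)) by trilin.
have -> : Rmat H = (𝟙 ⊗ e) ∙ Rmat H.
  rewrite [LHS]tens_sum.
  transitivity (\sw_(r, r' <- Rmat H) \sw_(x, y <- hcomul r) (hcounit x *: (y ⊗ r'))).
    by apply: eq_tfold => r r'; rewrite (sw_hcounitl (F := fun y => y ⊗ r')) //; lin.
  rewrite (sw_Rmat_comull FP) [X in _ = _ ∙ X]tens_sum /e; sw_simp; sw_perm.
by rewrite -amulA RmatRinv amul1r.
Qed.

Lemma Rmat_counitr : \sw_(r, r' <- Rmat H) (hcounit r' *: r) = 𝟙.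
Proof.
set e := LHS; apply: tens1_inj; transitivity (Rmat H ∙ Rinv H); last exact: RmatRinv.
have FP : is_trilinear (fun x y z : H => hcounit z *: (x ⊗ y)) by trilin.
have -> : Rmat H = (e ⊗ 𝟙) ∙ Rmat H.
  rewrite [LHS]tens_sum.
  transitivity (\sw_(r, r' <- Rmat H) \sw_(x, y <- hcomul r') (hcounit y *: (r ⊗ x))).
    by apply: eq_tfold => r r'; rewrite (sw_hcounitr (F := fun y => r ⊗ y)) //; lin.
  rewrite (sw_Rmat_comulr FP) [X in _ = _ ∙ X]tens_sum /e; sw_simp; sw_perm.
by rewrite -amulA RmatRinv amul1r.
Qed.

Lemma Rinv_counitl : \sw_(r, r' <- Rinv H) (hcounit r *: r') = 𝟙.
Proof.
set e := LHS; apply: tens1l_inj; transitivity (Rmat H ∙ Rinv H); last exact: RmatRinv.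
have FP : is_trilinear (fun x y z : H => hcounit x *: (y ⊗ z)) by trilin.
have -> : Rinv H = Rinv H ∙ (𝟙 ⊗ e).
  rewrite [LHS]tens_sum.
  transitivity (\sw_(r, r' <- Rinv H) \sw_(x, y <- hcomul r) (hcounit x *: (y ⊗ r'))).
    by apply: eq_tfold => r r'; rewrite (sw_hcounitl (F := fun y => y ⊗ r')) //; lin.
  rewrite (sw_Rinv_comull FP) [X in _ = X ∙ _]tens_sum /e; sw_simp; sw_perm.
by rewrite amulA RmatRinv amul1l.
Qed.

Lemma Rinv_counitr : \sw_(r, r' <- Rinv H) (hcounit r' *: r) = 𝟙.
Proof.
set e := LHS; apply: tens1_inj; transitivity (Rmat H ∙ Rinv H); last exact: RmatRinv.
have FP : is_trilinear (fun x y z : H => hcounit z *: (x ⊗ y)) by trilin.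
have -> : Rinv H = Rinv H ∙ (e ⊗ 𝟙).
  rewrite [LHS]tens_sum.
  transitivity (\sw_(r, r' <- Rinv H) \sw_(x, y <- hcomul r') (hcounit y *: (r ⊗ x))).
    by apply: eq_tfold => r r'; rewrite (sw_hcounitr (F := fun y => r ⊗ y)) //; lin.
  rewrite (sw_Rinv_comulr FP) [X in _ = X ∙ _]tens_sum /e; sw_simp; sw_perm.
by rewrite amulA RmatRinv amul1l.
Qed.

Section CounitTransfer.
Variables (U : lmodType K) (F : H -> U).
Hypothesis Fl : linear F.
Lemma sw_counit_transfer (f : H -> H -> H) (k : H -> H -> K) (t : H ⊗ H) (u : H) :
  \sw_(r, r' <- t) (k r r' *: f r r') = u ->
  \sw_(r, r' <- t) (k r r' *: F (f r r')) = F u.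
Proof. by move=> <-; rewrite lin_sw //; apply: eq_tfold => r r'; rewrite linZ. Qed.
Lemma sw_Rmat_counitl : \sw_(r, r' <- Rmat H) (hcounit r *: F r') = F 𝟙.
Proof. exact: sw_counit_transfer Rmat_counitl. Qed.
Lemma sw_Rmat_counitr : \sw_(r, r' <- Rmat H) (hcounit r' *: F r) = F 𝟙.
Proof. exact: sw_counit_transfer Rmat_counitr. Qed.
Lemma sw_Rinv_counitl : \sw_(r, r' <- Rinv H) (hcounit r *: F r') = F 𝟙.
Proof. exact: sw_counit_transfer Rinv_counitl. Qed.
Lemma sw_Rinv_counitr : \sw_(r, r' <- Rinv H) (hcounit r' *: F r) = F 𝟙.
Proof. exact: sw_counit_transfer Rinv_counitr. Qed.
End CounitTransfer.

Section Commutation.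
Variables (U : lmodType K) (F : H -> H -> U) (h : H).
Hypothesis FP : is_bilinear F.

Lemma sw_Rmat_comm :
  \sw_(r, r' <- Rmat H) \sw_(x, y <- hcomul h) F (r ∙ x) (r' ∙ y) =
  \sw_(r, r' <- Rmat H) \sw_(x, y <- hcomul h) F (y ∙ r) (x ∙ r').
Proof.
have e := congr1 (tfold F) (Rmat_comm h).
etransitivity; last (etransitivity; first exact: e); [symmetry|]; sw_norm.
Qed.

(** The relation R Δ(h) = Δ^op(h) R, multiplied on both sides by the inverse of
    R. *)
Lemma sw_Rinv_comm :
  \sw_(s, s' <- Rinv H) \sw_(x, y <- hcomul h) F (x ∙ s) (y ∙ s') =
  \sw_(s, s' <- Rinv H) \sw_(x, y <- hcomul h) F (s ∙ y) (s' ∙ x).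
Proof.
pose hop := \sw_(x, y <- hcomul h) y ⊗ x.
have e : Rmat H ∙ hcomul h = hop ∙ Rmat H.
  rewrite [Rmat H]tens_sum [hcomul h]tens_sum /hop; sw_simp.
  rewrite Rmat_comm; sw_perm.
have {}e : hcomul h ∙ Rinv H = Rinv H ∙ hop.
  transitivity (Rinv H ∙ (Rmat H ∙ hcomul h) ∙ Rinv H).
    by rewrite amulA RinvRmat amul1l.
  by rewrite e -!amulA RmatRinv amul1r.
have := congr1 (tfold F) e; rewrite [Rinv H]tens_sum [hcomul h]tens_sum /hop => {}e.
etransitivity; last (etransitivity; first exact: e); [symmetry|];
  sw_simp; sw_perm.
Qed.
End Commutation.
End Rmatrix.

(** * Module algebras and the coactions on generators *)

Notation ahom f := (is_alg_hom amul 𝟙 amul 𝟙 f).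

Section Linearity.
Variables (K : fieldType) (H : qtHopf K).

Lemma act_bil (M : moduleAlg H) : is_bilinear (@act K H M).
Proof. by case: (act_module M). Qed.
Lemma bcomul_linear (B : braidedBialg H) : linear (@bcomul K H B).
Proof. exact: comul_linear (bcoalgP B). Qed.
Lemma bcounit_linear (B : braidedBialg H) : linear (@bcounit K H B : B -> K^o).
Proof. exact: counit_linear (bcoalgP B). Qed.
Lemma coact_lin (B : braidedBialg H) (A : braidedComodAlg B) :
  linear (@coact K H B A).
Proof. exact: coact_linear. Qed.
Lemma ev_lin (C B : braidedBialg H) (d : weakDuality C B) :
  linear (ev d : C ⊗ B -> K^o).
Proof. exact: ev_linear. Qed.
End Linearity.
#[export] Hint Extern 0 => exact: act_bil : lin.
#[export] Hint Extern 0 => exact: bcomul_linear : lin.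
#[export] Hint Extern 0 => exact: bcounit_linear : lin.
#[export] Hint Extern 0 => exact: coact_lin : lin.
#[export] Hint Extern 0 => exact: ev_lin : lin.

Section Modules.
Variables (K : fieldType) (H : qtHopf K).

Section Action.
Variable M : moduleAlg H.
Lemma act_swl (V W : lmodType K) (f : V -> W -> H) t (m : M) :
  tfold f t ▷ m = \sw_(x, y <- t) (f x y ▷ m).
Proof. by rewrite (bil_swl _ _ _ (act_bil M)). Qed.
Lemma act_swr (V W : lmodType K) (f : V -> W -> M) t (h : H) :
  h ▷ tfold f t = \sw_(x, y <- t) (h ▷ f x y).
Proof. by rewrite (bil_swr _ _ _ (act_bil M)). Qed.
Lemma actZl k h (m : M) : (k *: h) ▷ m = k *: (h ▷ m).
Proof. by rewrite (bilZl _ _ _ (act_bil M)). Qed.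
Lemma actZr k h (m : M) : h ▷ (k *: m) = k *: (h ▷ m).
Proof. by rewrite (bilZr _ _ _ (act_bil M)). Qed.
Lemma act1E (m : M) : (𝟙 : H) ▷ m = m.
Proof. by case: (act_module M). Qed.
Lemma actME (g h : H) (m : M) : (g ∙ h) ▷ m = g ▷ h ▷ m.
Proof. by case: (act_module M). Qed.
End Action.

Section Coaction.
Variables (B : braidedBialg H) (A : braidedComodAlg B).
Lemma coact_sw (V W : lmodType K) (f : V -> W -> A) t :
  coact (tfold f t) = \sw_(x, y <- t) coact (f x y).
Proof. exact: (lin_sw _ _ (@coact_linear K H B A)). Qed.
Lemma coactZ k (a : A) : coact (k *: a) = k *: coact a.
Proof. exact: (linZ (@coact_linear K H B A)). Qed.
End Coaction.

Definition covariant (M : moduleAlg H) (U : ualgType K) (iH : H -> U) (iM : M -> U) :=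
  forall h m, iH h ∙ iM m = \sw_(h1, h2 <- hcomul h) (iM (h1 ▷ m) ∙ iH h2).
End Modules.

Ltac hom_step :=
  match goal with
  | h : is_alg_hom _ _ _ _ ?f |- context [?f (_ ∙ _)] => rewrite (alg_homM h)
  | h : is_alg_hom _ _ _ _ ?f |- context [?f (tfold _ _)] =>
      rewrite (lin_sw _ _ (alg_hom_linear h))
  | h : is_alg_hom _ _ _ _ ?f |- context [?f (_ *: _)] =>
      rewrite (linZ (alg_hom_linear h))
  | h : is_alg_hom _ _ _ _ ?f |- context [?f 𝟙] => rewrite (alg_hom1 h)
  end.
Ltac sw_hook ::=
  first [ progress rewrite ?(amul_tens, hcomulM, hcounitM, act_swl, act_swr, actZl,
            actZr, act1E, actME, act_mul, act_one, hcomul1, hcounit1)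
        | progress rewrite ?(bcomul_act, bcomulM, bcomul1, coact_act, coactM, coact1,
            coact_sw, coactZ)
            /tens_act /braid
        | hom_step ].

Section TwoLegs.
Variables (K : fieldType) (H : qtHopf K).
Variables (U V : ualgType K) (iH : H -> U) (jH : H -> V).
Hypotheses (hiH : ahom iH) (hjH : ahom jH).

(** C, H and B or A are represented in the legs U and V. With both legs equal to
    the double these are the coproducts of the generators; with the second leg a
    comodule algebra they are the coactions. *)
Definition coactH (h : H) : U ⊗ V := \sw_(h1, h2 <- hcomul h) iH h1 ⊗ jH h2.

Lemma coactH_hom : ahom coactH.
Proof.
rewrite /coactH; split=> [|x y|]; first lin; last by sw_norm.
sw_simp; sw_perm.
Qed.

Section C.
Variables (C : braidedBialg H) (iC : C -> U) (jC : C -> V).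
Hypotheses (hiC : ahom iC) (hjC : ahom jC).
Hypotheses (ciC : covariant iH iC) (cjC : covariant jH jC).

Definition coactC (c : C) : U ⊗ V :=
  \sw_(c1, c2 <- bcomul c) \sw_(s, s' <- Rinv H) (iH s ∙ iC c2) ⊗ jC (s' ▷ c1).

(** Moving t past R^(1) ▷ c produces t_1 ▷ R^(1) ▷ c, and the first hexagon
    identity for the inverse of R turns this into R^{-1} R, which cancels. *)
Lemma exchangeC (X : lmodType K) (M : moduleAlg H) (F : U -> M -> X) c m :
  is_bilinear F ->
  \sw_(t, t' <- Rinv H) \sw_(r, r' <- Rmat H) F (iH t ∙ iC (r ▷ c)) (t' ▷ r' ▷ m) =
  \sw_(t, t' <- Rinv H) F (iC c ∙ iH t) (t' ▷ m).
Proof.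
move=> FP; have ? := FP.1; have ? := FP.2.
transitivity (\sw_(t, t' <- Rinv H) \sw_(r, r' <- Rmat H) \sw_(x, y <- hcomul t)
    F (iC (x ▷ r ▷ c) ∙ iH y) (t' ▷ r' ▷ m)).
  apply: eq_tfold => t t'; apply: eq_tfold => r r'.
  by rewrite ciC (lin_sw _ _ (FP.1 _)).
transitivity (\sw_(t, t' <- Rinv H) \sw_(x, y <- hcomul t) \sw_(r, r' <- Rmat H)
    F (iC (x ▷ r ▷ c) ∙ iH y) (t' ▷ r' ▷ m)); first by sw_perm.
rewrite (sw_Rinv_comull (F := fun x y t' => \sw_(r, r' <- Rmat H)
    F (iC (x ▷ r ▷ c) ∙ iH y) (t' ▷ r' ▷ m))); last trilin.
transitivity (\sw_(u, u' <- Rinv H) \sw_(t, t' <- Rinv H) \sw_(r, r' <- Rmat H)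
    F (iC ((t ∙ r) ▷ c) ∙ iH u) (u' ▷ (t' ∙ r') ▷ m)).
  sw_simp; sw_perm.
apply: eq_tfold => u u'.
rewrite (sw_RinvK (F := fun a b => F (iC (a ▷ c) ∙ iH u) (u' ▷ b ▷ m))); last lin.
by rewrite !act1E.
Qed.

(** In Δ(c c') the R-matrix of the braiding acts on c_2 and c'_1. By [exchangeC]
    this is the price of moving the first leg of the copy of R^{-1} that belongs
    to c' past c_2. *)
Lemma coactC_hom : ahom coactC.
Proof.
split=> [|c c'|]; [rewrite /coactC; lin | | ]; last first.
- rewrite /coactC; etransitivity; [sw_norm|].
  by rewrite (sw_Rinv_counitr (F := fun s => iH s ⊗ (𝟙 : V)));
      [rewrite (alg_hom1 hiH) | lin].
- transitivity (\sw_(c1, c2 <- bcomul c) \sw_(e1, e2 <- bcomul c')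
    \sw_(r, r' <- Rmat H) \sw_(s, s' <- Rinv H) \sw_(x, y <- hcomul s')
    (iH s ∙ iC (r ▷ c2) ∙ iC e2) ⊗ (jC (x ▷ c1) ∙ jC (y ▷ r' ▷ e1))).
    rewrite /coactC; sw_simp; sw_perm.
  transitivity (\sw_(c1, c2 <- bcomul c) \sw_(e1, e2 <- bcomul c')
    \sw_(s, s' <- Rinv H) \sw_(t, t' <- Rinv H) \sw_(r, r' <- Rmat H)
    (iH s ∙ (iH t ∙ iC (r ▷ c2)) ∙ iC e2) ⊗ (jC (s' ▷ c1) ∙ jC (t' ▷ r' ▷ e1))).
    apply: eq_tfold => c1 c2; apply: eq_tfold => e1 e2.
    transitivity (\sw_(r, r' <- Rmat H) \sw_(s, s' <- Rinv H) \sw_(t, t' <- Rinv H)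
    (iH (s ∙ t) ∙ iC (r ▷ c2) ∙ iC e2) ⊗ (jC (s' ▷ c1) ∙ jC (t' ▷ r' ▷ e1))).
      apply: eq_tfold => r r'.
      by rewrite (sw_Rinv_comulr (F := fun s x y => (iH s ∙ iC (r ▷ c2) ∙ iC e2)
          ⊗ (jC (x ▷ c1) ∙ jC (y ▷ r' ▷ e1)))); last trilin.
    sw_simp; sw_perm.
  transitivity (\sw_(c1, c2 <- bcomul c) \sw_(e1, e2 <- bcomul c')
    \sw_(s, s' <- Rinv H) \sw_(t, t' <- Rinv H)
    (iH s ∙ (iC c2 ∙ iH t) ∙ iC e2) ⊗ (jC (s' ▷ c1) ∙ jC (t' ▷ e1))).
    apply: eq_tfold => c1 c2; apply: eq_tfold => e1 e2; apply: eq_tfold => s s'.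
    rewrite (exchangeC (F := fun u e => (iH s ∙ u ∙ iC e2)
        ⊗ (jC (s' ▷ c1) ∙ jC e))) //; lin.
  rewrite /coactC; sw_simp; sw_perm.
Qed.

(** Both sides are brought to sums over three components of h; the component
    between the two legs is moved by quasi-cocommutativity. *)
Lemma coactC_cov h c :
  coactH h ∙ coactC c = \sw_(h1, h2 <- hcomul h) (coactC (h1 ▷ c) ∙ coactH h2).
Proof.
rewrite /coactC /coactH.
transitivity (\sw_(c1, c2 <- bcomul c) \sw_(s, s' <- Rinv H) \sw_(h1, h2 <- hcomul h)
    \sw_(x, y <- hcomul h2) ((iH (h1 ∙ s) ∙ iC c2) ⊗ (jC ((x ∙ s') ▷ c1) ∙ jH y))).
  transitivity (\sw_(c1, c2 <- bcomul c) \sw_(s, s' <- Rinv H) \sw_(h1, h2 <- hcomul h)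
    ((iH h1 ∙ (iH s ∙ iC c2)) ⊗ (jH h2 ∙ jC (s' ▷ c1)))); first by sw_simp; sw_perm.
  apply: eq_tfold => c1 c2; apply: eq_tfold => s s'; apply: eq_tfold => h1 h2.
  by rewrite cjC; sw_simp.
transitivity (\sw_(c1, c2 <- bcomul c) \sw_(h1, h2 <- hcomul h)
    \sw_(s, s' <- Rinv H) \sw_(x, y <- hcomul h1)
     ((iH (s ∙ y) ∙ iC c2) ⊗ (jC ((s' ∙ x) ▷ c1) ∙ jH h2))).
  apply: eq_tfold => c1 c2.
  transitivity (\sw_(s, s' <- Rinv H) \sw_(h1, h2 <- hcomul h)
    \sw_(x, y <- hcomul h1) ((iH (x ∙ s) ∙ iC c2) ⊗ (jC ((y ∙ s') ▷ c1) ∙ jH h2))).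
    apply: eq_tfold => s s'; symmetry; apply: (sw_hcoassoc (F := fun x y h2 =>
     (iH (x ∙ s) ∙ iC c2) ⊗ (jC ((y ∙ s') ▷ c1) ∙ jH h2))); trilin.
  rewrite tfold_exch; apply: eq_tfold => h1 h2.
  apply: (sw_Rinv_comm (F := fun a b => (iH a ∙ iC c2) ⊗ (jC (b ▷ c1) ∙ jH h2))); lin.
transitivity (\sw_(c1, c2 <- bcomul c) \sw_(s, s' <- Rinv H) \sw_(h1, h2 <- hcomul h)
    \sw_(x, y <- hcomul h1) \sw_(y1, y2 <- hcomul y)
     ((iH s ∙ (iC (y1 ▷ c2) ∙ iH y2)) ⊗ (jC (s' ▷ x ▷ c1) ∙ jH h2))).
  apply: eq_tfold => c1 c2; rewrite tfold_exch; apply: eq_tfold => s s'.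
  apply: eq_tfold => h1 h2; apply: eq_tfold => x y.
  rewrite (alg_homM hiH) actME -amulA ciC; sw_norm.
transitivity (\sw_(c1, c2 <- bcomul c) \sw_(s, s' <- Rinv H) \sw_(h1, h2 <- hcomul h)
    \sw_(x, y <- hcomul h1) \sw_(z, w <- hcomul h2)
     ((iH s ∙ (iC (y ▷ c2) ∙ iH z)) ⊗ (jC (s' ▷ x ▷ c1) ∙ jH w))); last first.
  sw_simp; sw_perm.
apply: eq_tfold => c1 c2; apply: eq_tfold => s s'.
rewrite sw_hcoassoc4; [|move=> ? ?; lin..].
apply: (sw_hcoassoc (F := fun x y h2 => \sw_(y1, y2 <- hcomul y)
     ((iH s ∙ (iC (y1 ▷ c2) ∙ iH y2)) ⊗ (jC (s' ▷ x ▷ c1) ∙ jH h2)))); trilin.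
Qed.
End C.

Section A.
Variables (B : braidedBialg H) (A : braidedComodAlg B) (iB : B -> U) (jA : A -> V).
Hypotheses (hiB : ahom iB) (hjA : ahom jA).
Hypothesis ciB : covariant iH iB.

Definition coactA (a : A) : U ⊗ V :=
  \sw_(b, a0 <- coact a) \sw_(r, r' <- Rmat H) (iB b ∙ iH r') ⊗ jA (r ▷ a0).

(** The other hexagon identity, read backwards: R^(2) passes b at the price of
    the braiding of b with m. *)
Lemma exchangeA (X : lmodType K) (M : moduleAlg H) (F : U -> M -> X) b m :
  is_bilinear F ->
  \sw_(r, r' <- Rmat H) \sw_(s, s' <- Rmat H) F (iB (s' ▷ b) ∙ iH r') (r ▷ s ▷ m) =
  \sw_(r, r' <- Rmat H) F (iH r' ∙ iB b) (r ▷ m).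
Proof.
move=> FP; have ? := FP.1; have ? := FP.2.
transitivity (\sw_(r, r' <- Rmat H)
    \sw_(x, y <- hcomul r') F (iB (x ▷ b) ∙ iH y) (r ▷ m)).
  rewrite (sw_Rmat_comulr (F := fun r x y => F (iB (x ▷ b) ∙ iH y) (r ▷ m)));
      last trilin.
  by sw_simp.
by apply: eq_tfold => r r'; rewrite ciB (lin_sw _ _ (FP.1 _)).
Qed.

Lemma coactA_hom : ahom coactA.
Proof.
split=> [|a a'|]; [rewrite /coactA; lin | | ]; last first.
- rewrite /coactA; etransitivity; [sw_norm|].
  by rewrite (sw_Rmat_counitl (F := fun s => iH s ⊗ (𝟙 : V)));
      [rewrite (alg_hom1 hiH) | lin].
- transitivity (\sw_(b, x <- coact a) \sw_(b', x' <- coact a')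
    \sw_(s, s' <- Rmat H) \sw_(r, r' <- Rmat H) \sw_(y, z <- hcomul r)
    (iB b ∙ iB (s' ▷ b') ∙ iH r') ⊗ (jA (y ▷ s ▷ x) ∙ jA (z ▷ x'))).
    rewrite /coactA; sw_simp; sw_perm.
  transitivity (\sw_(b, x <- coact a) \sw_(b', x' <- coact a')
    \sw_(t, t' <- Rmat H) \sw_(r, r' <- Rmat H) \sw_(s, s' <- Rmat H)
    (iB b ∙ (iB (s' ▷ b') ∙ iH r') ∙ iH t') ⊗ (jA (r ▷ s ▷ x) ∙ jA (t ▷ x'))).
    apply: eq_tfold => b x; apply: eq_tfold => b' x'.
    transitivity (\sw_(s, s' <- Rmat H) \sw_(r, r' <- Rmat H) \sw_(t, t' <- Rmat H)
    (iB b ∙ iB (s' ▷ b') ∙ iH (r' ∙ t')) ⊗ (jA (r ▷ s ▷ x) ∙ jA (t ▷ x'))).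
      apply: eq_tfold => s s'.
      by rewrite (sw_Rmat_comull (F := fun y z r' => (iB b ∙ iB (s' ▷ b')
          ∙ iH r') ⊗ (jA (y ▷ s ▷ x) ∙ jA (z ▷ x')))); last trilin.
    sw_simp; sw_perm.
  transitivity (\sw_(b, x <- coact a) \sw_(b', x' <- coact a')
    \sw_(t, t' <- Rmat H) \sw_(r, r' <- Rmat H)
    (iB b ∙ (iH r' ∙ iB b') ∙ iH t') ⊗ (jA (r ▷ x) ∙ jA (t ▷ x'))).
    apply: eq_tfold => b x; apply: eq_tfold => b' x'; apply: eq_tfold => t t'.
    rewrite (exchangeA (F := fun u y => (iB b ∙ u ∙ iH t')
        ⊗ (jA y ∙ jA (t ▷ x')))) //; lin.
  rewrite /coactA; sw_simp; sw_perm.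
Qed.

End A.
End TwoLegs.

(** * Smash products *)

Section Homs.
Variable K : fieldType.

Lemma scalars_is_algebra : is_algebra ( *%R : K^o -> K^o -> K^o) (1 : K^o).
Proof. exact: algType_is_algebra. Qed.

HB.instance Definition _ := Lmodule_isUAlgebra.Build K K^o scalars_is_algebra.

Lemma ahom_comp (U V W : ualgType K) (f : V -> W) (g : U -> V) :
  ahom f -> ahom g -> ahom (fun x => f (g x)).
Proof.
move=> [fl fM f1] [gl gM g1]; split; first exact: lin_comp.
  by move=> x y; rewrite gM fM.
by rewrite g1 f1.
Qed.

Lemma tens_hom (U V W X : ualgType K) (f : U -> W) (g : V -> X) :
  ahom f -> ahom g -> ahom (fun t : U ⊗ V => \sw_(x, y <- t) f x ⊗ g y).
Proof.
move=> hf hg; split=> [|s t|]; first lin; last by sw_norm.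
move: s t; apply: tens_bil_ext; [lin|lin|] => v w v' w'.
sw_simp; sw_perm.
Qed.

Section Bialgebra.
Variables (X : ualgType K) (D : X -> X ⊗ X) (e : X -> K).
Hypothesis hX : is_bialgebra D e.
Lemma bialg_comulM x y : D (x ∙ y) = D x ∙ D y.
Proof. exact: (alg_homM (bialg_comul hX)). Qed.
Lemma bialg_comul1 : D 𝟙 = 𝟙 ⊗ 𝟙. Proof. exact: (alg_hom1 (bialg_comul hX)). Qed.
Lemma bialg_comul_lin : linear D. Proof. exact: comul_linear (bialg_coalg hX). Qed.
Lemma bialg_counit_lin : linear (e : X -> K^o).
Proof. exact: counit_linear (bialg_coalg hX). Qed.
End Bialgebra.

(** Module algebras over an ordinary bialgebra, for which smash products are
    formed; here it is either H itself or the bialgebra C ⋊ H. *)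
Record module_algebra (X : ualgType K) (D : X -> X ⊗ X) (e : X -> K)
    (A : ualgType K) (ac : X -> A -> A) : Prop := {
  malg_bil : is_bilinear ac;
  malg_1 : forall a, ac 𝟙 a = a;
  malg_M : forall x y a, ac (x ∙ y) a = ac x (ac y a);
  malg_mul : forall x a b, ac x (a ∙ b) = \sw_(x1, x2 <- D x) (ac x1 a ∙ ac x2 b);
  malg_one : forall x, ac x 𝟙 = e x *: 𝟙
}.
End Homs.

#[export] Hint Extern 0 => match goal with
  | h : is_bialgebra ?D _ |- _ => exact: (bialg_comul_lin h)
  | h : is_bialgebra _ ?e |- _ => exact: (bialg_counit_lin h)
  | h : module_algebra _ _ ?ac |- _ => exact: (malg_bil h)
  end : lin.

Ltac bialg_step :=
  match goal with
  | h : is_bialgebra ?D _ |- context [?D (_ ∙ _)] => rewrite (bialg_comulM h)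
  | h : is_bialgebra ?D _ |- context [?D 𝟙] => rewrite (bialg_comul1 h)
  | h : module_algebra _ _ ?ac |- context [?ac (_ ∙ _) _] => rewrite (malg_M h)
  | h : module_algebra _ _ ?ac |- context [?ac 𝟙 _] => rewrite (malg_1 h)
  | h : module_algebra _ _ ?ac |- context [?ac _ (_ ∙ _)] => rewrite (malg_mul h)
  | h : module_algebra _ _ ?ac |- context [?ac _ 𝟙] => rewrite (malg_one h)
  | h : module_algebra _ _ ?ac |- context [?ac (tfold _ _) _] => rewrite (bil_swl _
      _ _ (malg_bil h))
  | h : module_algebra _ _ ?ac |- context [?ac _ (tfold _ _)] => rewrite (bil_swr _
      _ _ (malg_bil h))
  | h : module_algebra _ _ ?ac |- context [?ac (_ *: _) _] => rewrite (bilZl _ _ _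
      (malg_bil h))
  | h : module_algebra _ _ ?ac |- context [?ac _ (_ *: _)] => rewrite (bilZr _ _ _
      (malg_bil h))
  end.
Ltac sw_hook ::=
  first [ progress rewrite ?(amul_tens, hcomulM, hcounitM, act_swl, act_swr, actZl,
            actZr, act1E, actME, act_mul, act_one, hcomul1, hcounit1)
        | progress rewrite ?(bcomul_act, bcomulM, bcomul1, coact_act, coactM, coact1,
            coact_sw, coactZ)
            /tens_act /braid
        | hom_step | bialg_step ].

Section SmashProduct.
Variables (K : fieldType) (X : ualgType K) (D : X -> X ⊗ X) (e : X -> K).
Variables (A : ualgType K) (ac : X -> A -> A).
Hypotheses (hX : is_bialgebra D e) (hA : module_algebra D e ac).

Definition smash_mul (s t : A ⊗ X) : A ⊗ X :=
  \sw_(a, x <- s) \sw_(b, y <- t) \sw_(x1, x2 <- D x) (a ∙ ac x1 b) ⊗ (x2 ∙ y).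

Lemma smash_mul_bil : is_bilinear smash_mul.
Proof. rewrite /smash_mul; lin. Qed.
Hint Extern 0 => exact: smash_mul_bil : lin.

Lemma smash_mul_tens a x b y : smash_mul (a ⊗ x) (b ⊗ y) =
  \sw_(x1, x2 <- D x) (a ∙ ac x1 b) ⊗ (x2 ∙ y).
Proof. rewrite /smash_mul; etransitivity; [sw_norm|]; reflexivity. Qed.

Lemma smash_is_algebra : is_algebra smash_mul (𝟙 ⊗ 𝟙).
Proof.
split=> [|x y z|s|s]; first exact: smash_mul_bil.
- move: z; apply: tens_ext; [lin|lin|] => a3 x3.
  move: x y; apply: tens_bil_ext; [lin|lin|] => a1 x1 a2 x2.
  rewrite !smash_mul_tens.
  rewrite (bil_swr _ _ _ smash_mul_bil) (bil_swl _ _ _ smash_mul_bil).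
  transitivity (\sw_(z, w <- D x2) \sw_(x, y <- D x1) \sw_(y1, y2 <- D y)
    (a1 ∙ ac x a2 ∙ ac y1 (ac z a3)) ⊗ (y2 ∙ (w ∙ x3))).
    apply: eq_tfold => z w; rewrite smash_mul_tens.
    rewrite -(sw_coassoc (F := fun x y1 y2 => (a1 ∙ ac x a2 ∙ ac y1 (ac z a3))
        ⊗ (y2 ∙ (w ∙ x3))) (bialg_coalg hX)); last trilin.
    sw_simp; sw_perm.
  transitivity (\sw_(x, y <- D x1) smash_mul ((a1 ∙ ac x a2) ⊗ (y ∙ x2)) (a3
      ⊗ x3)); last by [].
  transitivity (\sw_(x, y <- D x1) \sw_(z, w <- D (y ∙ x2)) ((a1 ∙ ac x a2)
      ∙ ac z a3) ⊗ (w ∙ x3)).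
    sw_simp; sw_perm.
  by apply: eq_tfold => x y; rewrite smash_mul_tens.
- move: s; apply: tens_ext; [lin|lin|] => a x.
  rewrite smash_mul_tens; sw_norm.
- move: s; apply: tens_ext; [lin|lin|] => a x.
  rewrite smash_mul_tens; etransitivity; [sw_norm|].
  rewrite (sw_counitl (F := fun y => a ⊗ y) (bialg_coalg hX)) //; lin.
Qed.

End SmashProduct.

Section Pack.
Variables (K : fieldType) (X : ualgType K) (D : X -> X ⊗ X) (e : X -> K).
Variables (A : ualgType K) (ac : X -> A -> A).
(** The tensor product A ⊗ X already carries the componentwise product, so the
    smash product needs a carrier of another name. *)
Definition smash_of (_ : is_bialgebra D e) (_ : module_algebra D e ac) : Type :=
  (A ⊗ X)%type.
Variables (hX : is_bialgebra D e) (hA : module_algebra D e ac).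
HB.instance Definition _ := GRing.Lmodule.on (smash_of hX hA).
HB.instance Definition _ :=
  Lmodule_isUAlgebra.Build K (smash_of hX hA) (smash_is_algebra hX hA).
End Pack.

Section Smash.
Variables (K : fieldType) (X : ualgType K) (D : X -> X ⊗ X) (e : X -> K).
Variables (A : ualgType K) (ac : X -> A -> A).
Hypotheses (hX : is_bialgebra D e) (hA : module_algebra D e ac).
Local Notation smash := (smash_of hX hA).
Local Notation smash_mul := (smash_mul D ac).
Let smash_mul_bil := smash_mul_bil hX hA.
Let smash_mul_tens := smash_mul_tens hX hA.
Hint Extern 0 => exact: smash_mul_bil : lin.

Definition sinl (a : A) : smash := a ⊗ 𝟙.
Definition sinr (x : X) : smash := 𝟙 ⊗ x.

Lemma smash_amul (s t : smash) : s ∙ t = smash_mul s t. Proof. by []. Qed.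

Lemma sinl_hom : ahom sinl.
Proof.
split=> [|a b|] //; first by rewrite /sinl; lin.
rewrite smash_amul [RHS]smash_mul_tens; symmetry; sw_norm.
Qed.

Lemma sinr_hom : ahom sinr.
Proof.
split=> [|x y|] //; first by rewrite /sinr; lin.
rewrite smash_amul [RHS]smash_mul_tens; symmetry; etransitivity; [sw_norm|].
rewrite (sw_counitl (F := fun x => 𝟙 ⊗ (x ∙ y)) (bialg_coalg hX)) //; lin.
Qed.

Lemma sinlr a x : sinl a ∙ sinr x = a ⊗ x.
Proof. rewrite smash_amul [LHS]smash_mul_tens; sw_norm. Qed.

Lemma sinrl x a : sinr x ∙ sinl a = \sw_(x1, x2 <- D x) (sinl (ac x1 a) ∙ sinr x2).
Proof.
rewrite smash_amul [LHS]smash_mul_tens; symmetry.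
under eq_tfold => x1 x2 do rewrite sinlr.
by sw_simp.
Qed.

Lemma smash_hom_ext (U : ualgType K) (f g : smash -> U) : ahom f -> ahom g ->
  (forall a, f (sinl a) = g (sinl a)) -> (forall x, f (sinr x) = g (sinr x)) ->
  f =1 g.
Proof.
move=> hf hg el er; apply: tens_ext;
    [exact: alg_hom_linear hf | exact: alg_hom_linear hg|].
by move=> a x; rewrite -sinlr (alg_homM hf) (alg_homM hg) el er.
Qed.

Section Lift.
Variables (U : ualgType K) (fA : A -> U) (fX : X -> U).
Hypotheses (hfA : ahom fA) (hfX : ahom fX).
Hypothesis cross : forall x a,
  fX x ∙ fA a = \sw_(x1, x2 <- D x) (fA (ac x1 a) ∙ fX x2).

Definition smash_lift (t : smash) : U := \sw_(a, x <- t) (fA a ∙ fX x).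

Lemma smash_lift_tens a x : smash_lift (a ⊗ x) = fA a ∙ fX x.
Proof. rewrite /smash_lift sw_tens //; lin. Qed.

(** The universal property of the smash product: representations of A and X
    glue as soon as the relation x a = (x_1 ▶ a) x_2 holds. *)
Lemma smash_lift_hom : ahom smash_lift.
Proof.
have ll : linear smash_lift by rewrite /smash_lift; lin.
split=> // [s t|]; last by rewrite smash_lift_tens (alg_hom1 hfA) (alg_hom1 hfX) amul1l.
have mb : is_bilinear (fun s t : smash => smash_lift (smash_mul s t)) by lin.
rewrite smash_amul; move: s t; apply: tens_bil_ext; [exact: mb|lin|] => a x b y.
rewrite smash_mul_tens (lin_sw _ _ ll) !smash_lift_tens.
transitivity (fA a ∙ (fX x ∙ fA b) ∙ fX y); last by rewrite !amulA.
rewrite cross; sw_simp.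
by apply: eq_tfold => x1 x2; rewrite smash_lift_tens; sw_simp.
Qed.

Lemma smash_lift_l a : smash_lift (sinl a) = fA a.
Proof. by rewrite smash_lift_tens (alg_hom1 hfX) amul1r. Qed.
Lemma smash_lift_r x : smash_lift (sinr x) = fX x.
Proof. by rewrite smash_lift_tens (alg_hom1 hfA) amul1l. Qed.
End Lift.
End Smash.

(** * Coassociativity *)

Section Coassociativity.
Variables (K : fieldType) (U V : ualgType K) (D : U -> U ⊗ U) (delta : V -> U ⊗ V).
Hypotheses (hD : ahom D) (hdelta : ahom delta).

(** The two sides of the coassociativity axiom, as maps on U ⊗ V. They are
    algebra homomorphisms, so that the axiom can be tested on generators. *)
Definition coassl (t : U ⊗ V) : U ⊗ (U ⊗ V) :=
  \sw_(d, y <- t) \sw_(d1, d2 <- D d) d1 ⊗ (d2 ⊗ y).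
Definition coassr (t : U ⊗ V) : U ⊗ (U ⊗ V) :=
  \sw_(d, y <- t) \sw_(d', z <- delta y) d ⊗ (d' ⊗ z).

Lemma coassl_hom : ahom coassl.
Proof.
rewrite /coassl; split=> [|s t|]; first lin; last by sw_norm.
move: s t; apply: tens_bil_ext; [lin|lin|] => v w v' w'.
sw_simp; sw_perm.
Qed.

Lemma coassr_hom : ahom coassr.
Proof.
rewrite /coassr; split=> [|s t|]; first lin; last by sw_norm.
move: s t; apply: tens_bil_ext; [lin|lin|] => v w v' w'.
sw_simp; sw_perm.
Qed.

Lemma counit_hom (e : U -> K) : ahom (e : U -> K^o) ->
  ahom (fun t : U ⊗ V => \sw_(d, y <- t) (e d *: y)).
Proof.
move=> he; split=> [|s t|]; first lin; last first.
  by etransitivity; [sw_norm|]; exact: scale1r.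
move: s t; apply: tens_bil_ext; [lin|lin|] => v w v' w'.
sw_simp.
by rewrite scalerA.
Qed.
End Coassociativity.

Section TwoLegsCoassoc.
Variables (K : fieldType) (H : qtHopf K) (X : lmodType K).
Variables (U V : ualgType K) (iH : H -> U) (jH : H -> V).
Hypotheses (hiH : ahom iH) (hjH : ahom jH).

Section C.
Variables (C : braidedBialg H) (iC : C -> U) (jC : C -> V).
Hypotheses (hiC : ahom iC) (hjC : ahom jC).
Variable G : U -> V -> C -> X.
Hypothesis GP : is_trilinear G.

(** Coassociativity of c ↦ R^{-(1)} c_2 ⊗ R^{-(2)} ▷ c_1 before the coproduct is
    defined on products: the values of Δ on h and c_2 are multiplied in U ⊗ V.
    The two hexagon identities, one for each side, lead to the same sum. *)
Lemma coactC_coassoc c :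
  \sw_(c1, c2 <- bcomul c) \sw_(s, s' <- Rinv H)
    \sw_(u, v <- coactH iH jH s ∙ coactC iH iC jC c2) G u v (s' ▷ c1) =
  \sw_(c1, c2 <- bcomul c) \sw_(s, s' <- Rinv H) \sw_(e1, e2 <- bcomul (s' ▷ c1))
    \sw_(t, t' <- Rinv H) G (iH s ∙ iC c2) (jH t ∙ jC e2) (t' ▷ e1).
Proof.
have ? := tri1 GP; have ? := tri2 GP; have ? := tri3 GP.
have G1 a : is_bilinear (G a) := tri_bil GP a.
have G2 b : is_bilinear (fun u v => G u v b) by split=> ?.
pose R := \sw_(c1, c2 <- bcomul c) \sw_(e1, e2 <- bcomul c1)
  \sw_(s, s' <- Rinv H) \sw_(t, t' <- Rinv H) \sw_(x, x' <- Rinv H)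
   G (iH s ∙ iH t ∙ iC c2) (jH x ∙ jC (t' ▷ e2)) (x' ▷ s' ▷ e1).
transitivity R; last first.
  rewrite /R; apply: eq_tfold => c1 c2; symmetry.
  transitivity (\sw_(e1, e2 <- bcomul c1) \sw_(t, t' <- Rinv H) \sw_(s, s' <- Rinv H)
    \sw_(x, y <- hcomul s') G (iH s ∙ iC c2) (jH t ∙ jC (y ▷ e2)) (t' ▷ x ▷ e1)).
    sw_simp; sw_perm.
  transitivity (\sw_(e1, e2 <- bcomul c1) \sw_(x, x' <- Rinv H) \sw_(s, s' <- Rinv H)
    \sw_(t, t' <- Rinv H) G (iH (s ∙ t) ∙ iC c2) (jH x ∙ jC (t' ▷ e2)) (x' ▷ s' ▷ e1));
    last by sw_simp; sw_perm.
  apply: eq_tfold => e1 e2; apply: eq_tfold => x x'.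
  apply: (sw_Rinv_comulr (F := fun s y z => G (iH s ∙ iC c2) (jH x
      ∙ jC (z ▷ e2)) (x' ▷ y ▷ e1))).
  trilin.
transitivity (\sw_(c1, c2 <- bcomul c) \sw_(e1, e2 <- bcomul c2)
  \sw_(s, s' <- Rinv H) \sw_(t, t' <- Rinv H) \sw_(x, x' <- Rinv H)
   G (iH s ∙ iH t ∙ iC e2) (jH x ∙ jC (t' ▷ e1)) (x' ▷ s' ▷ c1)); last first.
  symmetry; apply: (sw_coassoc (F := fun c1 c2 c3 =>
  \sw_(s, s' <- Rinv H) \sw_(t, t' <- Rinv H) \sw_(x, x' <- Rinv H)
   G (iH s ∙ iH t ∙ iC c3) (jH x ∙ jC (t' ▷ c2)) (x' ▷ s' ▷ c1)) (bcoalgP C)); trilin.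
apply: eq_tfold => c1 c2; rewrite /coactH /coactC.

transitivity (\sw_(e1, e2 <- bcomul c2) \sw_(t, t' <- Rinv H) \sw_(s, s' <- Rinv H)
    \sw_(x, y <- hcomul s) G (iH x ∙ (iH t ∙ iC e2)) (jH y ∙ jC (t' ▷ e1)) (s' ▷ c1)).
  sw_simp; sw_perm.
transitivity (\sw_(e1, e2 <- bcomul c2) \sw_(t, t' <- Rinv H) \sw_(s, s' <- Rinv H)
    \sw_(x, x' <- Rinv H) G (iH s ∙ (iH t ∙ iC e2)) (jH x ∙ jC (t' ▷ e1)) ((x'
        ∙ s') ▷ c1));
  last by sw_simp; sw_perm.
apply: eq_tfold => e1 e2; apply: eq_tfold => t t'.
apply: (sw_Rinv_comull (F := fun x y s' => G (iH x ∙ (iH t ∙ iC e2)) (jH y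
    ∙ jC (t' ▷ e1)) (s' ▷ c1))).
trilin.
Qed.
End C.

End TwoLegsCoassoc.

(** * Comodule algebras and the Yetter-Drinfeld condition *)

Section Regular.
Variables (K : fieldType) (H : qtHopf K) (B : braidedBialg H).

(** Through this comodule algebra, statements about A specialize to B and
    thereby to the double. *)
Definition regular : braidedComodAlg B :=
  BraidedComodAlg (@bcomul_linear K H B) (@bcomul_act K H B) (coassoc (bcoalgP B))
    (counitl (bcoalgP B)) (@bcomulM K H B) (@bcomul1 K H B).

Lemma sw_coact_coassoc (A : braidedComodAlg B) (U : lmodType K)
    (F : B -> B -> A -> U) a :
  is_trilinear F ->
  \sw_(b, x <- coact a) \sw_(b1, b2 <- bcomul b) F b1 b2 x =
  \sw_(b, x <- coact a) \sw_(b', y <- coact x) F b b' y.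
Proof. by move=> FP; tri_transfer F FP (coact_coassoc a). Qed.

Lemma sw_coact_counit (A : braidedComodAlg B) (U : lmodType K) (F : A -> U) a :
  linear F -> \sw_(b, x <- coact a) (bcounit b *: F x) = F a.
Proof.
move=> Fl; rewrite -{2}(coact_counit a) lin_sw //.
by apply: eq_tfold => x y; rewrite linZ.
Qed.
End Regular.

Section CoactACoassoc.
Variables (K : fieldType) (H : qtHopf K) (X : lmodType K).
Variables (U V : ualgType K) (iH : H -> U) (jH : H -> V).
Hypotheses (hiH : ahom iH) (hjH : ahom jH).
Variables (B : braidedBialg H) (A : braidedComodAlg B) (iB : B -> U) (jB : B -> V).
Hypotheses (hiB : ahom iB) (hjB : ahom jB).
Variable G : U -> V -> A -> X.
Hypothesis GP : is_trilinear G.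

(** The analogue of [coactC_coassoc] for a ↦ a^(-1) R^(2) ⊗ R^(1) ▷ a^(0). The
    case A = B is the coassociativity needed for the double itself. *)
Lemma coactA_coassoc a :
  \sw_(b, a0 <- coact a) \sw_(r, r' <- Rmat H)
    \sw_(u, v <- coactA (A := regular B) iH iB jB b ∙ coactH iH jH r') G u v (r ▷ a0) =
  \sw_(b, a0 <- coact a) \sw_(r, r' <- Rmat H) \sw_(b', z <- coact (r ▷ a0))
    \sw_(q, q' <- Rmat H) G (iB b ∙ iH r') (jB b' ∙ jH q') (q ▷ z).
Proof.
have ? := tri1 GP; have ? := tri2 GP; have ? := tri3 GP.
have G1 x : is_bilinear (G x) := tri_bil GP x.
have G2 x : is_bilinear (fun u v => G u v x) by split=> ?.
transitivity (\sw_(b, a0 <- coact a) \sw_(b1, b2 <- bcomul b)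
  \sw_(s, s' <- Rmat H) \sw_(t, t' <- Rmat H) \sw_(r, r' <- Rmat H)
    G (iB b1 ∙ iH s' ∙ iH t') (jB (s ▷ b2) ∙ jH r') (r ▷ t ▷ a0)).
  apply: eq_tfold => b a0; rewrite /coactA /coactH /=.
  transitivity (\sw_(b1, b2 <- bcomul b) \sw_(s, s' <- Rmat H) \sw_(r, r' <- Rmat H)
    \sw_(x, y <- hcomul r') G (iB b1 ∙ iH s' ∙ iH x) (jB (s ▷ b2) ∙ jH y) (r ▷ a0)).
    sw_simp; sw_perm.
  transitivity (\sw_(b1, b2 <- bcomul b) \sw_(s, s' <- Rmat H) \sw_(r, r' <- Rmat H)
    \sw_(t, t' <- Rmat H) G (iB b1 ∙ iH s' ∙ iH t') (jB (s ▷ b2) ∙ jH r') ((r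
        ∙ t) ▷ a0)); last first.
    by sw_simp; sw_perm.
  apply: eq_tfold => b1 b2; apply: eq_tfold => s s'.
  apply: (sw_Rmat_comulr (F := fun r x y => G (iB b1 ∙ iH s' ∙ iH x) (jB (s ▷ b2)
      ∙ jH y) (r ▷ a0))).
  trilin.
transitivity (\sw_(b, a0 <- coact a) \sw_(b', z <- coact a0)
  \sw_(s, s' <- Rmat H) \sw_(t, t' <- Rmat H) \sw_(r, r' <- Rmat H)
    G (iB b ∙ iH s' ∙ iH t') (jB (s ▷ b') ∙ jH r') (r ▷ t ▷ z)).
  apply: (sw_coact_coassoc (F := fun b1 b2 a0 =>
  \sw_(s, s' <- Rmat H) \sw_(t, t' <- Rmat H) \sw_(r, r' <- Rmat H)
    G (iB b1 ∙ iH s' ∙ iH t') (jB (s ▷ b2) ∙ jH r') (r ▷ t ▷ a0))); trilin.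
apply: eq_tfold => b a0; symmetry.
transitivity (\sw_(b', z <- coact a0) \sw_(q, q' <- Rmat H) \sw_(r, r' <- Rmat H)
  \sw_(x, y <- hcomul r) G (iB b ∙ iH r') (jB (x ▷ b') ∙ jH q') (q ▷ y ▷ z)).
  sw_simp; sw_perm.
transitivity (\sw_(b', z <- coact a0) \sw_(q, q' <- Rmat H) \sw_(r, r' <- Rmat H)
  \sw_(t, t' <- Rmat H) G (iB b ∙ iH (r' ∙ t')) (jB (r ▷ b') ∙ jH q') (q ▷ t ▷ z));
      last first.
  by sw_simp; sw_perm.
apply: eq_tfold => b' z; apply: eq_tfold => q q'.
apply: (sw_Rmat_comull (F := fun x y r' => G (iB b ∙ iH r') (jB (x ▷ b')
    ∙ jH q') (q ▷ y ▷ z))).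
trilin.
Qed.
End CoactACoassoc.

Section YetterDrinfeld.
Variables (K : fieldType) (X : ualgType K) (D : X -> X ⊗ X) (e : X -> K).
Variables (A : ualgType K) (ac : X -> A -> A).
Hypotheses (hX : is_bialgebra D e) (hA : module_algebra D e ac).
Variables (U : ualgType K) (iX : X -> U) (rho : A -> U ⊗ A).
Hypotheses (hiX : ahom iX) (rhol : linear rho).
Hint Extern 0 => exact: rhol : lin.

(** In a Yetter-Drinfeld module the coaction takes values in X; here it takes
    values in an algebra U in which X is represented. *)
Definition yd_compatible (x : X) := forall a,
  \sw_(x1, x2 <- D x) \sw_(u, a0 <- rho a) (iX x1 ∙ u) ⊗ ac x2 a0 =
  \sw_(x1, x2 <- D x) \sw_(u, a0 <- rho (ac x1 a)) (u ∙ iX x2) ⊗ a0.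

(** Thanks to this, the condition has to be tested on algebra generators only. *)
Lemma yd_mul x y : yd_compatible x -> yd_compatible y -> yd_compatible (x ∙ y).
Proof.
move=> hx hy a.
transitivity (\sw_(x1, x2 <- D x) \sw_(y1, y2 <- D y) \sw_(u, a0 <- rho a)
  (iX x1 ∙ (iX y1 ∙ u)) ⊗ ac x2 (ac y2 a0)); first by sw_simp; sw_perm.
transitivity (\sw_(x1, x2 <- D x) \sw_(y1, y2 <- D y) \sw_(u, a0 <- rho (ac y1 a))
  (iX x1 ∙ (u ∙ iX y2)) ⊗ ac x2 a0).
  apply: eq_tfold => x1 x2.
  have FP : is_bilinear (fun u a0 => (iX x1 ∙ u) ⊗ ac x2 a0) by lin.
  have := congr1 (tfold (fun u a0 => (iX x1 ∙ u) ⊗ ac x2 a0)) (hy a).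
  move=> E; etransitivity; last (etransitivity; first exact: E); [symmetry|]; sw_norm.
transitivity (\sw_(y1, y2 <- D y) \sw_(x1, x2 <- D x) \sw_(u, a0 <- rho (ac y1 a))
  (iX x1 ∙ u ∙ iX y2) ⊗ ac x2 a0); first by sw_simp; sw_perm.
transitivity (\sw_(y1, y2 <- D y) \sw_(x1, x2 <- D x)
    \sw_(u, a0 <- rho (ac x1 (ac y1 a)))
  (u ∙ iX x2 ∙ iX y2) ⊗ a0); last first.
  by sw_simp; sw_perm.
apply: eq_tfold => y1 y2.
have := congr1 (tfold (fun u a0 => (u ∙ iX y2) ⊗ a0)) (hx (ac y1 a)).
move=> E; etransitivity; last (etransitivity; first exact: E); [symmetry|]; sw_norm.
Qed.

Section Cross.
Variables (V : ualgType K) (jX : X -> V) (jA : A -> V).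
Hypotheses (hjX : ahom jX) (hjA : ahom jA).

Definition yd_coactX (x : X) : U ⊗ V := \sw_(x1, x2 <- D x) iX x1 ⊗ jX x2.
Definition yd_coactA (a : A) : U ⊗ V := \sw_(u, a0 <- rho a) u ⊗ jA a0.

(** The left-hand side is δ(x) δ(a) with the second legs multiplied by the rule
    x a = (x_1 ▶ a) x_2. The rule need not hold in V: it does in a crossed product,
    while in the double the inner sum is one side of the cross relation. *)
Lemma yd_cross x a : (forall x, yd_compatible x) ->
  \sw_(x1, x2 <- D x) \sw_(u, a0 <- rho a) \sw_(y, z <- D x2)
     (iX x1 ∙ u) ⊗ (jA (ac y a0) ∙ jX z) =
  \sw_(x1, x2 <- D x) (yd_coactA (ac x1 a) ∙ yd_coactX x2).
Proof.
move=> hyd.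
transitivity (\sw_(x1, x2 <- D x) \sw_(y, z <- D x2) \sw_(u, a0 <- rho a)
     (iX x1 ∙ u) ⊗ (jA (ac y a0) ∙ jX z)); first by sw_perm.
rewrite -(sw_coassoc (F := fun x1 y z => \sw_(u, a0 <- rho a)
     (iX x1 ∙ u) ⊗ (jA (ac y a0) ∙ jX z)) (bialg_coalg hX)); last trilin.
transitivity (\sw_(x', z <- D x) \sw_(x1, x2 <- D x') \sw_(u, a0 <- rho (ac x1 a))
     (u ∙ iX x2) ⊗ (jA a0 ∙ jX z)).
  apply: eq_tfold => x' z.
  have E := congr1 (tfold (fun u a0 => u ⊗ (jA a0 ∙ jX z))) (hyd x' a).
  etransitivity; last (etransitivity; first exact: E); [symmetry|]; sw_norm.
rewrite (sw_coassoc (F := fun x1 x2 z => \sw_(u, a0 <- rho (ac x1 a))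
     (u ∙ iX x2) ⊗ (jA a0 ∙ jX z)) (bialg_coalg hX)); last trilin.
rewrite /yd_coactA /yd_coactX; sw_simp; sw_perm.
Qed.
End Cross.
End YetterDrinfeld.

Section Generators.
Variables (K : fieldType) (H : qtHopf K).
Variables (U V : ualgType K) (iH : H -> U) (jH : H -> V).
Hypotheses (hiH : ahom iH) (hjH : ahom jH).
Variables (D : U -> U ⊗ U) (delta : V -> U ⊗ V).
Hypotheses (hD : ahom D) (hdelta : ahom delta).
Hypotheses (DH : forall h, D (iH h) = coactH iH iH h)
           (deltaH : forall h, delta (jH h) = coactH iH jH h).
Variable e : U -> K.
Hypotheses (he : ahom (e : U -> K^o)) (eH : forall h, e (iH h) = hcounit h).

Lemma coactH_coassociative h :
  coassl D (coactH iH jH h) = coassr delta (coactH iH jH h).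
Proof.
rewrite /coassl /coassr /coactH; sw_simp.
transitivity (\sw_(x, y <- hcomul h) \sw_(x1, x2 <- hcomul x) (iH x1 ⊗ (iH x2 ⊗ jH y))).
  by apply: eq_tfold => x y; rewrite DH /coactH; sw_norm.
transitivity (\sw_(x, y <- hcomul h) \sw_(x1, x2 <- hcomul y) (iH x ⊗ (iH x1 ⊗ jH x2))).
  apply: (sw_hcoassoc (F := fun x y z => iH x ⊗ (iH y ⊗ jH z))); trilin.
by apply: eq_tfold => x y; rewrite deltaH /coactH; symmetry; sw_norm.
Qed.

Lemma coactH_counit h : \sw_(d, y <- coactH iH jH h) (e d *: y) = jH h.
Proof.
rewrite -(sw_hcounitl (F := jH)); last lin.
rewrite /coactH; etransitivity; [sw_norm|].
by apply: eq_tfold => x y; rewrite eH.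
Qed.

Section C.
Variables (C : braidedBialg H) (iC : C -> U) (jC : C -> V).
Hypotheses (hiC : ahom iC) (hjC : ahom jC).
Hypotheses (DC : forall c, D (iC c) = coactC iH iC iC c)
           (deltaC : forall c, delta (jC c) = coactC iH iC jC c)
           (eC : forall c, e (iC c) = bcounit c).

Lemma coactC_coassociative c :
  coassl D (coactC iH iC jC c) = coassr delta (coactC iH iC jC c).
Proof.
rewrite /coassl /coassr /coactC; sw_simp.
have GP : is_trilinear (fun (u v : U) e => u ⊗ (v ⊗ jC e)) by trilin.
have := coactC_coassoc hiH hiH hiC hiC GP c.
move=> E; etransitivity; last (etransitivity; first exact: E).
  apply: eq_tfold => c1 c2; apply: eq_tfold => s s'.
  by rewrite DH DC; symmetry; sw_norm.
apply: eq_tfold => c1 c2; apply: eq_tfold => s s'.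
by rewrite deltaC /coactC; symmetry; sw_norm.
Qed.

Lemma coactC_counit c : \sw_(d, y <- coactC iH iC jC c) (e d *: y) = jC c.
Proof.
rewrite -(sw_counitr (F := jC) (bcoalgP C)); last lin.
rewrite /coactC; etransitivity; [sw_norm|].
apply: eq_tfold => c1 c2.
transitivity (\sw_(s, s' <- Rinv H) (hcounit s *: (bcounit c2 *: jC (s' ▷ c1)))).
  by apply: eq_tfold => s s'; rewrite scalerA -eC -eH.
rewrite (sw_Rinv_counitl (F := fun s' => (bcounit c2 *: jC (s' ▷ c1)))); last lin.
by rewrite act1E.
Qed.
End C.

Section A.
Variables (B : braidedBialg H) (A : braidedComodAlg B) (iB : B -> U) (jA : A -> V).
Hypotheses (hiB : ahom iB) (hjA : ahom jA).
Hypotheses (DB : forall b, D (iB b) = coactA (A := regular B) iH iB iB b)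
           (deltaA : forall a, delta (jA a) = coactA iH iB jA a)
           (eB : forall b, e (iB b) = bcounit b).

Lemma coactA_coassociative a :
  coassl D (coactA iH iB jA a) = coassr delta (coactA iH iB jA a).
Proof.
rewrite /coassl /coassr /coactA; sw_simp.
have GP : is_trilinear (fun (u v : U) e => u ⊗ (v ⊗ jA e)) by trilin.
have := coactA_coassoc hiH hiH hiB hiB GP a.
move=> E; etransitivity; last (etransitivity; first exact: E).
  apply: eq_tfold => c1 c2; apply: eq_tfold => s s'.
  by rewrite DH DB; symmetry; sw_norm.
apply: eq_tfold => c1 c2; apply: eq_tfold => s s'.
by rewrite deltaA /coactA; symmetry; sw_norm.
Qed.

Lemma coactA_counit a : \sw_(d, y <- coactA iH iB jA a) (e d *: y) = jA a.
Proof.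
rewrite -(sw_coact_counit (F := jA)); last lin.
rewrite /coactA; etransitivity; [sw_norm|].
apply: eq_tfold => b a0.
transitivity (\sw_(r, r' <- Rmat H) (hcounit r' *: (bcounit b *: jA (r ▷ a0)))).
  by apply: eq_tfold => r r'; rewrite scalerA mulrC -eB -eH.
rewrite (sw_Rmat_counitr (F := fun r => (bcounit b *: jA (r ▷ a0)))); last lin.
by rewrite act1E.
Qed.
End A.
End Generators.

Section RightCounits.
Variables (K : fieldType) (H : qtHopf K).
Variables (U V : ualgType K) (iH : H -> U) (jH : H -> V).
Hypotheses (hiH : ahom iH) (hjH : ahom jH).
Variable e : V -> K.
Hypotheses (he : ahom (e : V -> K^o)) (eH : forall h, e (jH h) = hcounit h).

Lemma counitr_hom : ahom (fun t : U ⊗ V => \sw_(d, y <- t) (e y *: d)).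
Proof.
split=> [|s t|]; first lin; last first.
  by etransitivity; [sw_norm|]; exact: scale1r.
move: s t; apply: tens_bil_ext; [lin|lin|] => v w v' w'.
by sw_simp; rewrite scalerA.
Qed.

Lemma coactH_counitr h : \sw_(d, y <- coactH iH jH h) (e y *: d) = iH h.
Proof.
rewrite -(sw_hcounitr (F := iH)); last lin.
rewrite /coactH; etransitivity; [sw_norm|].
by apply: eq_tfold => x y; rewrite eH.
Qed.

Lemma coactC_counitr (C : braidedBialg H) (iC : C -> U) (jC : C -> V)
    (hiC : ahom iC) (hjC : ahom jC) c : (forall c, e (jC c) = bcounit c) ->
  \sw_(d, y <- coactC iH iC jC c) (e y *: d) = iC c.
Proof.
move=> eC; rewrite -(sw_counitl (F := iC) (bcoalgP C)); last lin.
rewrite /coactC; etransitivity; [sw_norm|].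
apply: eq_tfold => c1 c2.
transitivity (\sw_(s, s' <- Rinv H) (hcounit s' *: (bcounit c1 *: (iH s ∙ iC c2)))).
  by apply: eq_tfold => s s'; rewrite scalerA -bcounit_act -eC.
rewrite (sw_Rinv_counitr (F := fun s => (bcounit c1 *: (iH s ∙ iC c2)))); last lin.
by rewrite (alg_hom1 hiH) amul1l.
Qed.

Lemma coactB_counitr (B : braidedBialg H) (iB : B -> U) (jB : B -> V)
    (hiB : ahom iB) (hjB : ahom jB) b : (forall b, e (jB b) = bcounit b) ->
  \sw_(d, y <- coactA (A := regular B) iH iB jB b) (e y *: d) = iB b.
Proof.
move=> eB; rewrite -(sw_counitr (F := iB) (bcoalgP B)); last lin.
rewrite /coactA /=; etransitivity; [sw_norm|].
apply: eq_tfold => b1 b2.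
transitivity (\sw_(r, r' <- Rmat H) (hcounit r *: (bcounit b2 *: (iB b1 ∙ iH r')))).
  by apply: eq_tfold => r r'; rewrite scalerA -bcounit_act -eB.
rewrite (sw_Rmat_counitl (F := fun r' => (bcounit b2 *: (iB b1 ∙ iH r')))); last lin.
by rewrite (alg_hom1 hiH) amul1r.
Qed.
End RightCounits.

(** * The bosonization of the co-opposite of C *)

Section Boson.
Variables (K : fieldType) (H : qtHopf K).

Lemma act_module_algebra (M : moduleAlg H) :
  module_algebra (@hcomul K H) (@hcounit K H) (@act K H M).
Proof.
split; [exact: act_bil|exact: act1E|exact: actME|exact: act_mul|exact: act_one].
Qed.

Lemma hcounit_hom : ahom (@hcounit K H : H -> K^o).
Proof. exact: (bialg_counit (hbialgP H)). Qed.
Lemma bcounit_hom (C : braidedBialg H) : ahom (@bcounit K H C : C -> K^o).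
Proof. split; [exact: bcounit_linear|exact: (@bcounitM K H C)|exact: (@bcounit1 K H
    C)]. Qed.

Variable C : braidedBialg H.

(** The algebra C ⋊ H as a smash product; the relation h c = (h_1 ▷ c) h_2 is the
    rule for moving H past an H-module algebra. *)
Definition boson : ualgType K := smash_of (hbialgP H) (act_module_algebra C).
Definition bosC : C -> boson := sinl (hbialgP H) (act_module_algebra C).
Definition bosH : H -> boson := sinr (hbialgP H) (act_module_algebra C).

Lemma bosC_hom : ahom bosC. Proof. exact: sinl_hom. Qed.
Lemma bosH_hom : ahom bosH. Proof. exact: sinr_hom. Qed.
Lemma bos_cov : covariant bosH bosC.
Proof. by move=> h c; exact: sinrl. Qed.

Section BosonLift.
Variables (U : ualgType K) (iH : H -> U) (iC : C -> U).
Hypotheses (hiH : ahom iH) (hiC : ahom iC) (ciC : covariant iH iC).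
Definition boson_lift : boson -> U := smash_lift iC iH.
Lemma boson_lift_hom : ahom boson_lift. Proof. exact: smash_lift_hom. Qed.
Lemma boson_liftC c : boson_lift (bosC c) = iC c. Proof. exact: smash_lift_l. Qed.
Lemma boson_liftH h : boson_lift (bosH h) = iH h. Proof. exact: smash_lift_r. Qed.
End BosonLift.

Lemma boson_hom_ext (U : ualgType K) (f g : boson -> U) : ahom f -> ahom g ->
  (forall c, f (bosC c) = g (bosC c)) -> (forall h, f (bosH h) = g (bosH h)) ->
  f =1 g.
Proof. exact: smash_hom_ext. Qed.

Definition boson_comul : boson -> boson ⊗ boson :=
  boson_lift (coactH bosH bosH) (coactC bosH bosC bosC).
Definition boson_counit : boson -> K :=
  boson_lift (@hcounit K H : H -> K^o) (@bcounit K H C : C -> K^o).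

(** The lift exists because the two legs are covariant: this is the content
    of [coactC_hom] and [coactC_cov]. *)
Lemma boson_comul_hom : ahom boson_comul.
Proof.
apply: boson_lift_hom.
- exact: (coactH_hom bosH_hom bosH_hom).
- exact: (coactC_hom bosH_hom bosC_hom bosC_hom bos_cov).
- move=> h c; exact: (coactC_cov bosH_hom bosH_hom bosC_hom bosC_hom bos_cov bos_cov).
Qed.

Lemma boson_comulC c : boson_comul (bosC c) = coactC bosH bosC bosC c.
Proof. exact: (boson_liftC (coactH_hom bosH_hom bosH_hom) (coactC_hom bosH_hom
    bosC_hom bosC_hom bos_cov)). Qed.
Lemma boson_comulH h : boson_comul (bosH h) = coactH bosH bosH h.
Proof. exact: (boson_liftH (coactH_hom bosH_hom bosH_hom) (coactC_hom bosH_hom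
    bosC_hom bosC_hom bos_cov)). Qed.

Lemma counit_cov : covariant (@hcounit K H : H -> K^o) (@bcounit K H C : C -> K^o).
Proof.
move=> h c.
have Fl : linear (fun h : H => bcounit c * hcounit h : K^o) by lin.
transitivity (bcounit c * hcounit h : K^o); first exact: mulrC.
rewrite -(sw_hcounitr h Fl).
apply: eq_tfold => h1 h2; rewrite bcounit_act.
by rewrite -[LHS]/(_ * (_ * _)) -[RHS]/((_ * _) * _) mulrC [bcounit c * _]mulrC.
Qed.

Lemma boson_counit_hom : ahom (boson_counit : boson -> K^o).
Proof. apply: boson_lift_hom; [exact: hcounit_hom|exact: bcounit_hom|exact:
    counit_cov]. Qed.
Lemma boson_counitC c : boson_counit (bosC c) = bcounit c.
Proof. exact: (boson_liftC hcounit_hom (bcounit_hom C)). Qed.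
Lemma boson_counitH h : boson_counit (bosH h) = hcounit h.
Proof. exact: (boson_liftH hcounit_hom (bcounit_hom C)). Qed.

Let hc := bosC_hom. Let hh := bosH_hom. Let hd := boson_comul_hom.
Let he := boson_counit_hom.

Lemma ahom_id (U : ualgType K) : ahom (fun x : U => x). Proof. by []. Qed.

Lemma boson_bialgebra : is_bialgebra boson_comul boson_counit.
Proof.
split; [split| |].
- exact: (alg_hom_linear boson_comul_hom).
- exact: (alg_hom_linear boson_counit_hom).
- apply: (@boson_hom_ext _ (fun x => coassl boson_comul (boson_comul x))
            (fun x => coassr boson_comul (boson_comul x))).
  + exact: (ahom_comp (coassl_hom _ hd) hd).
  + exact: (ahom_comp (coassr_hom hd) hd).
  + move=> c; rewrite boson_comulC.
    exact: (coactC_coassociative hh hd hd boson_comulH hc hc boson_comulC boson_comulC).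
  + move=> h; rewrite boson_comulH.
    exact: (coactH_coassociative hh hh hd hd boson_comulH boson_comulH).
- apply: boson_hom_ext.
  + exact: (ahom_comp (counit_hom _ he) hd).
  + exact: ahom_id.
  + move=> c; rewrite boson_comulC.
    exact: (coactC_counit he boson_counitH hc boson_counitC).
  + by move=> h; rewrite boson_comulH; exact: (coactH_counit hh he boson_counitH).
- apply: boson_hom_ext.
  + exact: (ahom_comp (counitr_hom _ he) hd).
  + exact: ahom_id.
  + move=> c; rewrite boson_comulC.
    exact: (coactC_counitr hh he hc hc _ boson_counitC).
  + by move=> h; rewrite boson_comulH; exact: (coactH_counitr hh he boson_counitH).
- exact: boson_comul_hom.
- exact: boson_counit_hom.
Qed.
End Boson.

(** * The pairing as an action *)

Section Pairing.
Variables (K : fieldType) (H : qtHopf K) (C B : braidedBialg H).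
Variable d : weakDuality C B.

Lemma sw_ev_act (X : lmodType K) (v : X) h c b :
  \sw_(x, y <- hcomul h) (ev d ((x ▷ c) ⊗ (y ▷ b)) *: v) =
  hcounit h *: (ev d (c ⊗ b) *: v).
Proof.
rewrite scalerA -ev_act /tens_act.
rewrite (lin_sw (f := ev d : _ -> K^o)) //; last lin.
rewrite scale_swl; apply: eq_tfold => x y.
rewrite sw_tens //; lin.
Qed.

(** Inserting R^{-1} R between the two components, the inverse is absorbed by
    invariance of the pairing (through the second hexagon identity), and R acts
    on b alone. *)
Lemma ev_adjoint (X : lmodType K) (F : H -> X) c b : linear F ->
  \sw_(s, s' <- Rinv H) (ev d ((s' ▷ c) ⊗ b) *: F s) =
  \sw_(r, r' <- Rmat H) (ev d (c ⊗ (r' ▷ b)) *: F r).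
Proof.
move=> Fl.
transitivity (\sw_(s, s' <- Rinv H) \sw_(t, t' <- Rinv H) \sw_(r, r' <- Rmat H)
  (ev d ((s' ▷ c) ⊗ ((t' ∙ r') ▷ b)) *: F (s ∙ (t ∙ r)))).
  apply: eq_tfold => s s'.
  rewrite (sw_RinvK (F := fun x y => ev d ((s' ▷ c) ⊗ (y ▷ b)) *: F (s ∙ x))); last lin.
  by rewrite act1E amul1r.
transitivity (\sw_(r, r' <- Rmat H) \sw_(s, s' <- Rinv H) \sw_(t, t' <- Rinv H)
  (ev d ((s' ▷ c) ⊗ (t' ▷ r' ▷ b)) *: F ((s ∙ t) ∙ r))); first by sw_simp; sw_perm.
apply: eq_tfold => r r'.
rewrite -(sw_Rinv_comulr (F := fun s x y => ev d ((x ▷ c)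
    ⊗ (y ▷ r' ▷ b)) *: F (s ∙ r)));
  last trilin.
under eq_tfold => s s' do rewrite sw_ev_act.
rewrite (sw_Rinv_counitr (F := fun s => ev d (c ⊗ (r' ▷ b)) *: F (s ∙ r))); last lin.
by rewrite amul1l.
Qed.

Section Action.
Variable A : braidedComodAlg B.

(** The action c ▶ a. It is locked because it is itself a Sweedler sum, which
    [sw_norm] would otherwise open. *)
Definition pair_act (c : C) (a : A) : A :=
  locked (\sw_(b, a0 <- coact a) (ev d (c ⊗ b) *: a0)).
Lemma pair_actE : pair_act = fun c a => \sw_(b, a0 <- coact a) (ev d (c ⊗ b) *: a0).
Proof. by apply/funext => c; apply/funext => a; rewrite /pair_act -lock. Qed.

Lemma pair_act_bil : is_bilinear pair_act.
Proof.
by rewrite pair_actE; lin.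
Qed.
Hint Extern 0 => exact: pair_act_bil : lin.

Lemma pair_act1 a : pair_act 𝟙 a = a.
Proof.
rewrite pair_actE -[RHS](coact_counit a); apply: eq_tfold => b a0.
by rewrite ev_onel.
Qed.

Lemma pair_actM c c' a : pair_act (c ∙ c') a = pair_act c (pair_act c' a).
Proof.
rewrite pair_actE; symmetry; etransitivity; [sw_norm|]; symmetry.
rewrite -(sw_coact_coassoc (F := fun b b' (x : A) => ev d (c' ⊗ b) *: (ev d (c
    ⊗ b') *: x))); last trilin.
 apply: eq_tfold => b x.
rewrite ev_mull scale_swl; apply: eq_tfold => b1 b2.
by rewrite scalerA mulrC.
Qed.

Lemma pair_act_equivariant h c a :
  h ▷ pair_act c a = \sw_(h1, h2 <- hcomul h) pair_act (h1 ▷ c) (h2 ▷ a).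
Proof.
rewrite pair_actE; symmetry.
transitivity (\sw_(b, a0 <- coact a) \sw_(h1, h2 <- hcomul h) \sw_(x, y <- hcomul h2)
   (ev d ((h1 ▷ c) ⊗ (x ▷ b)) *: (y ▷ a0))); first by sw_simp; sw_perm.
symmetry; etransitivity; [sw_norm|]; symmetry; apply: eq_tfold => b a0.
rewrite -(sw_hcoassoc (F := fun h1 x y => ev d ((h1 ▷ c) ⊗ (x ▷ b)) *: (y ▷ a0)));
  last trilin.
under eq_tfold => x y do rewrite sw_ev_act.
rewrite (sw_hcounitl (F := fun y => ev d (c ⊗ b) *: (y ▷ a0))) //; lin.
Qed.

Lemma pair_act_one c : pair_act c 𝟙 = bcounit c *: 𝟙.
Proof.
rewrite pair_actE coact1 (sw_tens (F := fun b a0 => ev d (c ⊗ b) *: a0)); last lin.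
by rewrite ev_oner.
Qed.

(** The module algebra property for the coproduct of C ⋊ H: the braiding in the
    coaction of a product acts on the pairing through R, and [ev_adjoint]
    transforms it into the inverse R-matrix of the coproduct. *)
Lemma pair_act_mul c a a' : pair_act c (a ∙ a') =
  \sw_(c1, c2 <- bcomul c) \sw_(s, s' <- Rinv H)
    ((s ▷ pair_act c2 a) ∙ pair_act (s' ▷ c1) a').
Proof.
transitivity (\sw_(b, x <- coact a) \sw_(b', x' <- coact a')
   \sw_(c1, c2 <- bcomul c) \sw_(r, r' <- Rmat H)
     (ev d (c1 ⊗ (r' ▷ b')) *: (ev d (c2 ⊗ b) *: ((r ▷ x) ∙ x')))).
  transitivity (\sw_(b, x <- coact a) \sw_(b', x' <- coact a') \sw_(r, r' <- Rmat H)
     (ev d (c ⊗ (b ∙ (r' ▷ b'))) *: ((r ▷ x) ∙ x'))).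
    rewrite pair_actE; sw_simp; sw_perm.
  apply: eq_tfold => b x; apply: eq_tfold => b' x'; rewrite tfold_exch.
  apply: eq_tfold => r r'; rewrite ev_mulr scale_swl.
  by apply: eq_tfold => c1 c2; rewrite scalerA mulrC.
transitivity (\sw_(b, x <- coact a) \sw_(b', x' <- coact a')
   \sw_(c1, c2 <- bcomul c) \sw_(s, s' <- Rinv H)
     (ev d ((s' ▷ c1) ⊗ b') *: (ev d (c2 ⊗ b) *: ((s ▷ x) ∙ x')))).
  apply: eq_tfold => b x; apply: eq_tfold => b' x'; apply: eq_tfold => c1 c2.
  by rewrite (ev_adjoint (F := fun s => ev d (c2 ⊗ b) *: ((s ▷ x) ∙ x'))); last lin.
rewrite pair_actE; sw_simp; sw_perm.
Qed.

Definition boson_act (x : boson C) (a : A) : A :=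
  locked (tfold (fun (c : C) (h : H) => pair_act c (h ▷ a)) x).
Lemma boson_actE : boson_act = fun x a => tfold (fun (c : C) (h : H) => pair_act c
    (h ▷ a)) x.
Proof. by apply/funext => x; apply/funext => a; rewrite /boson_act -lock. Qed.

Lemma boson_act_bil : is_bilinear boson_act. Proof.
by rewrite boson_actE; split=> ?; lin.
Qed.
Hint Extern 0 => exact: boson_act_bil : lin.

Lemma boson_act_tens (c : C) (h : H) a : boson_act (c ⊗ h) a = pair_act c (h ▷ a).
Proof. rewrite boson_actE sw_tens //; lin. Qed.
Lemma boson_actC c a : boson_act (bosC c) a = pair_act c a.
Proof. by rewrite boson_act_tens act1E. Qed.
Lemma boson_actH h a : boson_act (bosH C h) a = h ▷ a.
Proof. by rewrite boson_act_tens pair_act1. Qed.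

Lemma boson_actM x y a : boson_act (x ∙ y) a = boson_act x (boson_act y a).
Proof.
have b1 : is_bilinear (fun x y : boson C => boson_act (x ∙ y) a) by lin.
have b2 : is_bilinear (fun x y : boson C => boson_act x (boson_act y a)) by lin.
move: x y; apply: tens_bil_ext; [exact: b1|exact: b2|] => c h c' h'.
rewrite smash_amul (smash_mul_tens (hbialgP H) (act_module_algebra C)).
rewrite !boson_act_tens pair_act_equivariant (bil_swr _ _ _ pair_act_bil) (lin_sw _
    _ (boson_act_bil.1 a)).
by apply: eq_tfold => h1 h2; rewrite boson_act_tens pair_actM actME.
Qed.

(** Compatibility with products of A is closed under products of x, so it is
    tested on C and on H. *)
Lemma boson_act_module_algebra :
  module_algebra (@boson_comul K H C) (@boson_counit K H C) boson_act.
Proof.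
split; [exact: boson_act_bil | | exact: boson_actM | |].
- by move=> a; rewrite boson_act_tens act1E pair_act1.
- move=> x a b.
have Dl := alg_hom_linear (boson_comul_hom C).
pose P x := forall a b, boson_act x (a ∙ b) =
  \sw_(x1, x2 <- boson_comul x) (boson_act x1 a ∙ boson_act x2 b).
have PM x' y' : P x' -> P y' -> P (x' ∙ y').
  move=> px py {}a {}b; rewrite boson_actM py (bil_swr _ _ _ boson_act_bil).
  rewrite (alg_homM (boson_comul_hom C)).
  rewrite (sw_amul (F := fun x1 x2 => boson_act x1 a ∙ boson_act x2 b)); last lin.
  rewrite tfold_exch; apply: eq_tfold => y1 y2.
  by rewrite px; apply: eq_tfold => x1 x2; rewrite !boson_actM.
have PC c : P (bosC c).
  move=> {}a {}b; rewrite boson_actC boson_comulC pair_act_mul /coactC.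
  symmetry; etransitivity; [sw_norm|]; apply: eq_tfold => c1 c2;
      apply: eq_tfold => s s'.
  by rewrite boson_actM boson_actH !boson_actC.
have PH h : P (bosH C h).
  move=> {}a {}b; rewrite boson_actH boson_comulH act_mul /coactH.
  symmetry; etransitivity; [sw_norm|]; apply: eq_tfold => h1 h2.
  by rewrite !boson_actH.
move: x; apply: tens_ext; [lin|lin|] => c h.
have -> : c ⊗ h = bosC c ∙ bosH C h by rewrite [RHS]sinlr.
exact: PM.
- move=> x.
have el := alg_hom_linear (boson_counit_hom C).
move: x; apply: tens_ext; [lin|lin|] => c h.
have -> : c ⊗ h = bosC c ∙ bosH C h by rewrite [RHS]sinlr.
rewrite boson_actM boson_actH boson_actC act_one (linZ (pair_act_bil.2 c))
    pair_act_one scalerA.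
rewrite (alg_homM (boson_counit_hom C)) boson_counitC boson_counitH.
by rewrite mulrC.
Qed.
End Action.
End Pairing.

(** * The Yetter-Drinfeld condition in the double *)

#[export] Hint Extern 0 => exact: pair_act_bil : lin.
#[export] Hint Extern 0 => exact: boson_act_bil : lin.

Section Compatibility.
Variables (K : fieldType) (H : qtHopf K) (C B : braidedBialg H).
Variables (d : weakDuality C B) (A : braidedComodAlg B).
Variables (U : ualgType K) (iC : C -> U) (iH : H -> U) (iB : B -> U).
Hypothesis hU : drin_relations d iC iH iB.
Variable iX : boson C -> U.
Hypotheses (hiX : ahom iX) (iXC : forall c, iX (bosC c) = iC c)
  (iXH : forall h, iX (bosH C h) = iH h).

Let hiC := drin_subC hU.
Let hiH := drin_subH hU.
Let hiB := drin_subB hU.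
Let ciB : covariant iH iB := drin_HB hU.
Let ciC : covariant iH iC := drin_HC hU.

(** The map a ↦ a^[-1] ⊗ a^[0] of the Yetter-Drinfeld condition. *)
Definition coactA_id : A -> U ⊗ A := coactA iH iB (fun a : A => a).

Lemma coactA_id_linear : linear coactA_id.
Proof. by rewrite /coactA_id /coactA; have := hiH; have := hiB; move=> ? ?; lin. Qed.

(** After h has been moved past B, the two sides contain R and the remaining two
    components of h in opposite orders; quasi-cocommutativity of R exchanges
    them. *)
Lemma yd_H h :
  yd_compatible (@boson_comul K H C) (@boson_act K H C B d A) iX coactA_id (bosH C h).
Proof.
have h1 := hiH; have h2 := hiB.
move=> a; rewrite boson_comulH /coactH.
transitivity (\sw_(h1, h2 <- hcomul h) \sw_(b, a0 <- coact a) \sw_(r, r' <- Rmat H)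
  (iH h1 ∙ iB b ∙ iH r') ⊗ (h2 ▷ r ▷ a0)).
  rewrite /coactA_id /coactA; etransitivity; [sw_norm|].
  apply: eq_tfold => ? ?; apply: eq_tfold => ? ?; apply: eq_tfold => ? ?.
  by rewrite iXH boson_actH.
transitivity (\sw_(h1, h2 <- hcomul h) \sw_(x, y <- hcomul h1)
    \sw_(b, a0 <- coact a) \sw_(r, r' <- Rmat H)
  (iB (x ▷ b) ∙ iH r' ∙ iH h2) ⊗ (r ▷ y ▷ a0)); last first.
  rewrite /coactA_id /coactA; symmetry; etransitivity; [sw_norm|].
  transitivity (\sw_(h1, h2 <- hcomul h)
      \sw_(b, a0 <- coact (boson_act d (bosH C h1) a))
      \sw_(r, r' <- Rmat H) (iB b ∙ iH r' ∙ iX (bosH C h2)) ⊗ (r ▷ a0)).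
    by [].
  transitivity (\sw_(h1, h2 <- hcomul h) \sw_(b, a0 <- coact (h1 ▷ a))
      \sw_(r, r' <- Rmat H) (iB b ∙ iH r' ∙ iH h2) ⊗ (r ▷ a0)).
    by apply: eq_tfold => ? ?; rewrite boson_actH iXH.
  sw_simp; sw_perm.
transitivity (\sw_(b, a0 <- coact a) \sw_(r, r' <- Rmat H) \sw_(h1, h2 <- hcomul h)
   \sw_(x, y <- hcomul h1) (iB (x ▷ b) ∙ iH (y ∙ r')) ⊗ ((h2 ∙ r) ▷ a0)).
  transitivity (\sw_(b, a0 <- coact a) \sw_(r, r' <- Rmat H) \sw_(h1, h2 <- hcomul h)
    ((iH h1 ∙ iB b) ∙ iH r') ⊗ (h2 ▷ r ▷ a0)); first by sw_perm.
  apply: eq_tfold => b a0; apply: eq_tfold => r r'; apply: eq_tfold => k1 k2.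
  by rewrite ciB; sw_simp.
transitivity (\sw_(b, a0 <- coact a) \sw_(x, h' <- hcomul h) \sw_(r, r' <- Rmat H)
   \sw_(y, z <- hcomul h') (iB (x ▷ b) ∙ iH (y ∙ r')) ⊗ ((z ∙ r) ▷ a0)).
  apply: eq_tfold => b a0; rewrite [RHS]tfold_exch; apply: eq_tfold => r r'.
  apply: (sw_hcoassoc (F := fun x y z => (iB (x ▷ b) ∙ iH (y ∙ r')) ⊗ ((z ∙ r) ▷ a0))).
  trilin.
transitivity (\sw_(b, a0 <- coact a) \sw_(x, h' <- hcomul h) \sw_(r, r' <- Rmat H)
   \sw_(y, z <- hcomul h') (iB (x ▷ b) ∙ iH (r' ∙ z)) ⊗ ((r ∙ y) ▷ a0)).
  apply: eq_tfold => b a0; apply: eq_tfold => x h'; symmetry.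
  apply: (sw_Rmat_comm (F := fun p q => (iB (x ▷ b) ∙ iH q) ⊗ (p ▷ a0))); lin.
transitivity (\sw_(b, a0 <- coact a) \sw_(r, r' <- Rmat H) \sw_(h1, h2 <- hcomul h)
   \sw_(x, y <- hcomul h1) (iB (x ▷ b) ∙ iH (r' ∙ h2)) ⊗ ((r ∙ y) ▷ a0)); last first.
  by sw_simp; sw_perm.
apply: eq_tfold => b a0; rewrite tfold_exch; apply: eq_tfold => r r'; symmetry.
apply: (sw_hcoassoc (F := fun x y z => (iB (x ▷ b) ∙ iH (r' ∙ z)) ⊗ ((r ∙ y) ▷ a0))).
trilin.
Qed.

(** The left-hand side contains the cross relation for the pair
    (a^(-1), c), multiplied on the right by a further copy of R: it arises from
    (Δ ⊗ id)R when R^(1) is moved through the coaction. On the right-hand side,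
    R^(2) is moved past C, which produces a copy of R cancelling the inverse
    R-matrix. Both sides become the sum T5. *)
Lemma yd_C c :
  yd_compatible (@boson_comul K H C) (@boson_act K H C B d A) iX coactA_id (bosC c).
Proof.
have h1 := hiH; have h2 := hiB; have h3 := hiC.
move=> a; rewrite boson_comulC /coactC.
pose T5 := \sw_(b, z <- coact a) \sw_(q, q' <- Rmat H) \sw_(b1, b2 <- bcomul b)
   \sw_(c1, c2 <- bcomul c) \sw_(s, s' <- Rinv H)
   (ev d (c2 ⊗ b1) *: ((iB (s ▷ b2) ∙ iC (s' ▷ c1) ∙ iH q') ⊗ (q ▷ z))).
transitivity T5.
  transitivity (\sw_(c1, c2 <- bcomul c) \sw_(s, s' <- Rinv H) \sw_(b, a0 <- coact a)
    \sw_(r, r' <- Rmat H) (iH s ∙ iC c2 ∙ iB b ∙ iH r')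
        ⊗ pair_act d (s' ▷ c1) (r ▷ a0)).
    rewrite /coactA_id /coactA; etransitivity; [sw_norm|].
    apply: eq_tfold => ? ?; apply: eq_tfold => ? ?; apply: eq_tfold => ? ?.
    apply: eq_tfold => ? ?.
    by rewrite ?(alg_homM hiX) iXH iXC boson_actC.
  rewrite pair_actE.
  transitivity (\sw_(b, a0 <- coact a) \sw_(b', z <- coact a0)
    \sw_(c1, c2 <- bcomul c) \sw_(s, s' <- Rinv H) \sw_(r, r' <- Rmat H)
        \sw_(x, y <- hcomul r)
    (ev d ((s' ▷ c1) ⊗ (x ▷ b')) *: ((iH s ∙ iC c2 ∙ iB b ∙ iH r') ⊗ (y ▷ z)))).
    sw_simp; sw_perm.
  transitivity (\sw_(b, a0 <- coact a) \sw_(b', z <- coact a0)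
    \sw_(c1, c2 <- bcomul c) \sw_(s, s' <- Rinv H) \sw_(r, r' <- Rmat H)
        \sw_(q, q' <- Rmat H)
    (ev d ((s' ▷ c1) ⊗ (r ▷ b')) *: ((iH s ∙ iC c2 ∙ iB b ∙ iH (r' ∙ q')) ⊗ (q ▷ z)))).
    do 4 apply: eq_tfold => ? ?.
    apply: (sw_Rmat_comull (F := fun x y r' => (ev d ((_ ▷ _)
        ⊗ (x ▷ _)) *: ((iH _ ∙ iC _ ∙ iB _ ∙ iH r') ⊗ (y ▷ _))))).
    trilin.
  transitivity (\sw_(b, z <- coact a) \sw_(b1, b2 <- bcomul b)
    \sw_(c1, c2 <- bcomul c) \sw_(s, s' <- Rinv H) \sw_(r, r' <- Rmat H)
        \sw_(q, q' <- Rmat H)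
    (ev d ((s' ▷ c1) ⊗ (r ▷ b2)) *: ((iH s ∙ iC c2 ∙ iB b1 ∙ iH (r' ∙ q')) ⊗ (q ▷ z)))).
    symmetry.
    apply: (sw_coact_coassoc (F := fun b1 b2 z => \sw_(c1, c2 <- bcomul c)
        \sw_(s, s' <- Rinv H) \sw_(r, r' <- Rmat H) \sw_(q, q' <- Rmat H)
    (ev d ((s' ▷ c1) ⊗ (r ▷ b2)) *: ((iH s ∙ iC c2 ∙ iB b1 ∙ iH (r' ∙ q'))
        ⊗ (q ▷ z))))).
    trilin.
  transitivity (\sw_(b, z <- coact a) \sw_(q, q' <- Rmat H)
    ((\sw_(b1, b2 <- bcomul b) \sw_(c1, c2 <- bcomul c) \sw_(s, s' <- Rinv H)
      \sw_(r, r' <- Rmat H)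
      (ev d ((s' ▷ c1) ⊗ (r ▷ b2)) *: (iH s ∙ iC c2 ∙ iB b1 ∙ iH r'))) ∙ iH q')
          ⊗ (q ▷ z)).
    sw_simp; sw_perm.
  transitivity (\sw_(b, z <- coact a) \sw_(q, q' <- Rmat H)
    ((\sw_(b1, b2 <- bcomul b) \sw_(c1, c2 <- bcomul c) \sw_(s, s' <- Rinv H)
      (ev d (c2 ⊗ b1) *: (iB (s ▷ b2) ∙ iC (s' ▷ c1)))) ∙ iH q') ⊗ (q ▷ z)).
    (* The inner sum is now one side of the cross relation for a^(-1) and c. *)
    by do 2 apply: eq_tfold => ? ?; rewrite (drin_cross hU).
  rewrite /T5; sw_simp; sw_perm.
symmetry.
transitivity (\sw_(c1, c2 <- bcomul c) \sw_(s, s' <- Rinv H)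
    \sw_(b, y <- coact (s ▷ pair_act d c2 a))
   \sw_(r, r' <- Rmat H) (iB b ∙ iH r' ∙ iC (s' ▷ c1)) ⊗ (r ▷ y)).
  rewrite /coactA_id /coactA; etransitivity; [sw_norm|].
  apply: eq_tfold => ? ?; apply: eq_tfold => ? ?.
  by rewrite boson_actM boson_actH boson_actC iXC.
rewrite pair_actE.
transitivity (\sw_(c1, c2 <- bcomul c) \sw_(b, z <- coact a) \sw_(b', y <- coact z)
   \sw_(s, s' <- Rinv H) \sw_(x, w <- hcomul s) \sw_(r, r' <- Rmat H)
     (ev d (c2 ⊗ b) *: ((iB (x ▷ b') ∙ iH r' ∙ iC (s' ▷ c1)) ⊗ (r ▷ w ▷ y)))).
  sw_simp; sw_perm.
transitivity (\sw_(c1, c2 <- bcomul c) \sw_(b, z <- coact a) \sw_(b1, b2 <- bcomul b)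
   \sw_(s, s' <- Rinv H) \sw_(x, w <- hcomul s) \sw_(r, r' <- Rmat H)
     (ev d (c2 ⊗ b1) *: ((iB (x ▷ b2) ∙ iH r' ∙ iC (s' ▷ c1)) ⊗ (r ▷ w ▷ z)))).
  apply: eq_tfold => c1 c2; symmetry.
  apply: (sw_coact_coassoc (F := fun b1 b2 z => \sw_(s, s' <- Rinv H)
      \sw_(x, w <- hcomul s) \sw_(r, r' <- Rmat H)
     (ev d (c2 ⊗ b1) *: ((iB (x ▷ b2) ∙ iH r' ∙ iC (s' ▷ c1)) ⊗ (r ▷ w ▷ z))))).
  trilin.
transitivity (\sw_(c1, c2 <- bcomul c) \sw_(b, z <- coact a) \sw_(b1, b2 <- bcomul b)
   \sw_(s, s' <- Rinv H) \sw_(t, t' <- Rinv H) \sw_(r, r' <- Rmat H)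
     (ev d (c2 ⊗ b1) *: ((iB (s ▷ b2) ∙ (iH r' ∙ iC (t' ▷ s' ▷ c1))) ⊗ (r ▷ t ▷ z)))).
  do 3 apply: eq_tfold => ? ?.
  rewrite (sw_Rinv_comull (F := fun x w s' => \sw_(r, r' <- Rmat H)
     (ev d (_ ⊗ _) *: ((iB (x ▷ _) ∙ iH r' ∙ iC (s' ▷ _)) ⊗ (r ▷ w ▷ _)))));
         last trilin.
  sw_simp; sw_perm.
transitivity (\sw_(c1, c2 <- bcomul c) \sw_(b, z <- coact a) \sw_(b1, b2 <- bcomul b)
   \sw_(s, s' <- Rinv H) \sw_(q, q' <- Rmat H)
     (ev d (c2 ⊗ b1) *: ((iB (s ▷ b2) ∙ (iC (s' ▷ c1) ∙ iH q')) ⊗ (q ▷ z))));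
         last first.
  rewrite /T5; sw_simp; sw_perm.
apply: eq_tfold => c1 c2; apply: eq_tfold => b z; apply: eq_tfold => b1 b2.
apply: eq_tfold => s s'.
transitivity (\sw_(t, t' <- Rinv H) \sw_(r, r' <- Rmat H) \sw_(q, q' <- Rmat H)
     (ev d (c2 ⊗ b1) *: ((iB (s ▷ b2) ∙ (iC (q' ▷ t' ▷ s' ▷ c1) ∙ iH r'))
         ⊗ (r ▷ q ▷ t ▷ z)))).
  apply: eq_tfold => t t'; symmetry.
  (* R^(2) passes C, leaving a copy of R to cancel the inverse R-matrix. *)
  apply: (exchangeA hiH hiC ciC (F := fun u m => ev d (c2
      ⊗ b1) *: ((iB (s ▷ b2) ∙ u) ⊗ m))); lin.
transitivity (\sw_(r, r' <- Rmat H) \sw_(q, q' <- Rmat H) \sw_(t, t' <- Rinv H)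
     (ev d (c2 ⊗ b1) *: ((iB (s ▷ b2) ∙ (iC ((q' ∙ t') ▷ s' ▷ c1) ∙ iH r'))
         ⊗ (r ▷ (q ∙ t) ▷ z)))).
  sw_simp; sw_perm.
apply: eq_tfold => r r'.
rewrite (sw_RmatK (F := fun x y =>
     (ev d (c2 ⊗ b1) *: ((iB (s ▷ b2) ∙ (iC (y ▷ s' ▷ c1) ∙ iH r'))
         ⊗ (r ▷ x ▷ z))))); last lin.
by rewrite !act1E.
Qed.

Lemma yd_boson x :
  yd_compatible (@boson_comul K H C) (@boson_act K H C B d A) iX coactA_id x.
Proof.
have hb := boson_bialgebra C; have hm := boson_act_module_algebra d A.
have rl := coactA_id_linear.
move=> a; move: x; apply: tens_ext.
- have Dl := alg_hom_linear (boson_comul_hom C); lin.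
- have Dl := alg_hom_linear (boson_comul_hom C); lin.
move=> c h; have -> : c ⊗ h = bosC c ∙ bosH C h by rewrite [RHS]sinlr.
by apply: (yd_mul hb hm hiX rl); [exact: yd_C|exact: yd_H].
Qed.
End Compatibility.

Section BosonSums.
Variables (K : fieldType) (H : qtHopf K) (C : braidedBialg H) (X : lmodType K).
Variable F : boson C -> boson C -> X.
Hypothesis FP : is_bilinear F.

Lemma sw_boson_comulC c : tfold F (boson_comul (bosC c)) =
  \sw_(c1, c2 <- bcomul c) \sw_(s, s' <- Rinv H)
     F (bosH C s ∙ bosC c2) (bosC (s' ▷ c1)).
Proof.
rewrite boson_comulC /coactC sw_sw //; apply: eq_tfold => c1 c2.
by rewrite sw_sw //; apply: eq_tfold => s s'; rewrite sw_tens.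
Qed.

Lemma sw_boson_comulH h : tfold F (boson_comul (bosH C h)) =
  \sw_(h1, h2 <- hcomul h) F (bosH C h1) (bosH C h2).
Proof.
by rewrite boson_comulH /coactH sw_sw //; apply: eq_tfold => h1 h2; rewrite sw_tens.
Qed.
End BosonSums.

Section BosonCross.
Variables (K : fieldType) (H : qtHopf K) (C B : braidedBialg H).
Variables (d : weakDuality C B) (A : braidedComodAlg B).
Variables (U : ualgType K) (iC : C -> U) (iH : H -> U) (iB : B -> U).
Hypothesis hU : drin_relations d iC iH iB.
Variable iX : boson C -> U.
Hypotheses (hiX : ahom iX) (iXC : forall c, iX (bosC c) = iC c)
  (iXH : forall h, iX (bosH C h) = iH h).
Variables (V : ualgType K) (jX : boson C -> V) (jA : A -> V).
Hypotheses (hjX : ahom jX) (hjA : ahom jA).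

(** On C and H this is the coproduct of the double if both legs are the double,
    and the coaction if V is the crossed product. *)
Definition coactX (x : boson C) : U ⊗ V :=
  \sw_(x1, x2 <- boson_comul x) (iX x1 ⊗ jX x2).

Lemma coactX_hom : ahom coactX.
Proof. exact: (ahom_comp (tens_hom hiX hjX) (boson_comul_hom C)). Qed.

Lemma coactXH h : coactX (bosH C h) = coactH iH (fun h => jX (bosH C h)) h.
Proof.
rewrite /coactX boson_comulH /coactH; etransitivity; [sw_norm|].
by apply: eq_tfold => x y; rewrite iXH.
Qed.

Lemma coactXC c : coactX (bosC c) = coactC iH iC (fun c => jX (bosC c)) c.
Proof.
rewrite /coactX boson_comulC /coactC; etransitivity; [sw_norm|].
by apply: eq_tfold => c1 c2; apply: eq_tfold => s s'; rewrite iXH iXC.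
Qed.

Lemma coactA_factor a :
  coactA iH iB jA a = \sw_(u, a0 <- coactA_id iH iB a) (u ⊗ jA a0).
Proof.
rewrite /coactA_id /coactA; symmetry; etransitivity; [sw_norm|].
by [].
Qed.

Lemma boson_cross x a :
  \sw_(x1, x2 <- boson_comul x) \sw_(u, a0 <- coactA_id iH iB a)
     ((iX x1 ∙ u) ⊗ (\sw_(y, z <- boson_comul x2) (jA (boson_act d y a0) ∙ jX z))) =
  \sw_(x1, x2 <- boson_comul x) (coactA iH iB jA (boson_act d x1 a) ∙ coactX x2).
Proof.
have hb := boson_bialgebra C; have hm := boson_act_module_algebra d A.
have rl := @coactA_id_linear _ _ _ _ d A _ _ _ _ hU.
have := yd_cross hb hm hiX rl hjX hjA x a (@yd_boson _ _ _ _ d A _ _ _ _ hU _ hiX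
    iXC iXH).
rewrite /yd_coactA /yd_coactX => E.
transitivity (\sw_(x1, x2 <- boson_comul x) \sw_(u, a0 <- coactA_id iH iB a)
    \sw_(y, z <- boson_comul x2)
     (iX x1 ∙ u) ⊗ (jA (boson_act d y a0) ∙ jX z)).
  by do 2 apply: eq_tfold => ? ?; rewrite tens_swr.
etransitivity; first exact: E.
by apply: eq_tfold => x1 x2; rewrite coactA_factor.
Qed.
End BosonCross.

Section DrinComul.
Variables (K : fieldType) (H : qtHopf K) (C B : braidedBialg H).
Variables (d : weakDuality C B).
Variables (U : ualgType K) (iC : C -> U) (iH : H -> U) (iB : B -> U).
Hypothesis hU : drin_relations d iC iH iB.

Let hiC := drin_subC hU.
Let hiH := drin_subH hU.
Let hiB := drin_subB hU.
Let ciB : covariant iH iB := drin_HB hU.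
Let ciC : covariant iH iC := drin_HC hU.

Definition boson_to := boson_lift iH iC.
Lemma boson_to_hom : ahom boson_to. Proof. exact: (boson_lift_hom hiH hiC ciC). Qed.
Lemma boson_toC c : boson_to (bosC c) = iC c. Proof. exact: (boson_liftC hiH hiC). Qed.
Lemma boson_toH h : boson_to (bosH C h) = iH h. Proof. exact: (boson_liftH hiH
    hiC). Qed.

Local Notation kC := (coactC iH iC iC).
Local Notation kH := (coactH iH iH).
Local Notation kB := (coactA (A := regular B) iH iB iB).

Lemma coactX_C c : coactX boson_to boson_to (bosC c) = kC c.
Proof.
rewrite (coactXC boson_to_hom boson_toC boson_toH boson_to_hom).
by apply: eq_tfold => ? ?; apply: eq_tfold => ? ?; rewrite boson_toC.
Qed.
Lemma coactX_H h : coactX boson_to boson_to (bosH C h) = kH h.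
Proof.
rewrite (coactXH boson_to_hom boson_toH boson_to_hom).
by apply: eq_tfold => ? ?; rewrite boson_toH.
Qed.

(** The left-hand side of the cross relation of the double is the expression
    (x_1 ▶ b) x_2 for x = c. *)
Lemma boson_cross_C (W : ualgType K) (f : B -> W) (g : boson C -> W) e b :
  linear f -> linear g ->
  \sw_(y, z <- boson_comul (bosC e)) (f (boson_act (A := regular B) d y b) ∙ g z) =
  \sw_(b1, b2 <- bcomul b) \sw_(c1, c2 <- bcomul e) \sw_(s, s' <- Rinv H)
    (ev d (c2 ⊗ b1) *: (f (s ▷ b2) ∙ g (bosC (s' ▷ c1)))).
Proof.
move=> fl gl; rewrite sw_boson_comulC; last lin.
transitivity (\sw_(c1, c2 <- bcomul e) \sw_(s, s' <- Rinv H)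
   (f (s ▷ pair_act (A := regular B) d c2 b) ∙ g (bosC (s' ▷ c1)))).
  by do 2 apply: eq_tfold => ? ?; rewrite boson_actM boson_actH boson_actC.
rewrite pair_actE /=.
transitivity (\sw_(c1, c2 <- bcomul e) \sw_(s, s' <- Rinv H) \sw_(b1, b2 <- bcomul b)
    (ev d (c2 ⊗ b1) *: (f (s ▷ b2) ∙ g (bosC (s' ▷ c1))))); last by sw_perm.
do 2 apply: eq_tfold => ? ?.
rewrite act_swr (lin_sw _ _ fl) amul_swl; apply: eq_tfold => ? ?.
by rewrite (bilZr _ _ _ (act_bil _)) (linZ fl) ascalel.
Qed.

Lemma sw_coactA_id (X : lmodType K) (F : U -> B -> X) b : is_bilinear F ->
  tfold F (coactA_id (A := regular B) iH iB b) =
  \sw_(b1, b2 <- bcomul b) \sw_(r, r' <- Rmat H) F (iB b1 ∙ iH r') (r ▷ b2).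
Proof.
move=> FP; rewrite /coactA_id /coactA sw_sw //; apply: eq_tfold => b1 b2.
by rewrite sw_sw //; apply: eq_tfold => r r'; rewrite sw_tens.
Qed.

(** For the cross relation, the left-hand side is Δ(x_1 ▶ b) Δ(x_2) with x = c. By
    the Yetter-Drinfeld condition it equals
    x_1 b^[-1] ⊗ (x_2 ▶ b^[0]) x_3, and the cross relation of U can be applied in the
    second leg, because b^[0] lies in B and the last component of c lies in C.
    Coassociativity then identifies the result with Δ of the right-hand side. *)
Lemma drin_comul_relations : drin_relations d kC kH kB.
Proof.
have h1 := hiH; have h2 := hiB; have h3 := hiC; have h4 := boson_to_hom.
have hkC : ahom kC := coactC_hom hiH hiC hiC ciC.
have hkH : ahom kH := coactH_hom hiH hiH.
have hkB : ahom kB := coactA_hom (A := regular B) hiH hiB hiB ciB.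
have bb : is_bilinear (boson_act (A := regular B) d : boson C -> B -> B).
  exact: (@boson_act_bil _ _ _ _ d (regular B)).
have bl x : linear (boson_act (A := regular B) d x : B -> B) := lin_bil_r x bb.
have cross := boson_cross (A := regular B) hU boson_to_hom boson_toC boson_toH
    boson_to_hom hiB.
split => //.
- move=> b c.
  transitivity (\sw_(x1, x2 <- boson_comul (bosC c))
      (kB (boson_act (A := regular B) d x1 b) ∙ coactX boson_to boson_to x2)).
    rewrite boson_cross_C; last exact: (alg_hom_linear (coactX_hom h4 h4)); last lin.
    by do 3 apply: eq_tfold => ? ?; rewrite coactX_C.
  (* The Yetter-Drinfeld condition, in the form of [boson_cross]. *)
  rewrite -cross.
  transitivity (\sw_(c1, c2 <- bcomul c) \sw_(s, s' <- Rinv H) \sw_(b1, b2 <- bcomul b)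
    \sw_(r, r' <- Rmat H) ((iH s ∙ iC c2) ∙ (iB b1 ∙ iH r')) ⊗
    (\sw_(y, z <- boson_comul (bosC (s' ▷ c1)))
        (iB (boson_act (A := regular B) d y (r ▷ b2)) ∙ boson_to z))).
    have Dl := alg_hom_linear (boson_comul_hom C).
    have rl := @coactA_id_linear _ _ _ _ d (regular B) _ _ _ _ hU.
    rewrite sw_boson_comulC; last by split=> ?; lin.
    do 2 apply: eq_tfold => ? ?; rewrite sw_coactA_id; last by split=> ?; lin.
    by do 2 apply: eq_tfold => ? ?; rewrite (alg_homM h4) boson_toH boson_toC.
  transitivity (\sw_(c1, c2 <- bcomul c) \sw_(s, s' <- Rinv H) \sw_(b1, b2 <- bcomul b)
    \sw_(r, r' <- Rmat H) ((iH s ∙ iC c2) ∙ (iB b1 ∙ iH r')) ⊗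
    (\sw_(b', z <- bcomul (r ▷ b2)) \sw_(e1, e2 <- bcomul (s' ▷ c1))
        \sw_(t, t' <- Rinv H)
      \sw_(q, q' <- Rmat H) (ev d ((t' ▷ e1)
          ⊗ (q ▷ z)) *: (iH t ∙ iC e2 ∙ iB b' ∙ iH q')))).
    do 4 apply: eq_tfold => ? ?.
    (* The cross relation of U, in the second leg. *)
    rewrite -(drin_cross hU) boson_cross_C; [|lin|lin].
    by congr (_ ⊗ _); do 3 apply: eq_tfold => ? ?; rewrite boson_toC.
  transitivity (\sw_(c1, c2 <- bcomul c) \sw_(s, s' <- Rinv H)
    \sw_(e1, e2 <- bcomul (s' ▷ c1)) \sw_(t, t' <- Rinv H)
    \sw_(b1, b2 <- bcomul b) \sw_(r, r' <- Rmat H) \sw_(b', z <- bcomul (r ▷ b2))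
    \sw_(q, q' <- Rmat H)
      (ev d ((t' ▷ e1) ⊗ (q ▷ z)) *:
        (((iH s ∙ iC c2) ∙ (iB b1 ∙ iH r')) ⊗ ((iH t ∙ iC e2) ∙ (iB b' ∙ iH q'))))).
    (* Generalized, so that the coproducts of r ▷ b2 and s' ▷ c1 stay folded. *)
    move: (bcomul (b0:=B)) (bcomul (b0:=C)) => DB DC; sw_simp; sw_perm.
  pose G (u v : U) (e : C) := \sw_(b1, b2 <- bcomul b) \sw_(r, r' <- Rmat H)
    \sw_(u', v' <- kB b1 ∙ kH r') (ev d (e ⊗ (r ▷ b2)) *: ((u ∙ u') ⊗ (v ∙ v'))).
  have GP : is_trilinear G by rewrite /G; trilin.
  transitivity (\sw_(c1, c2 <- bcomul c) \sw_(s, s' <- Rinv H)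
      \sw_(u, v <- kH s ∙ kC c2) G u v (s' ▷ c1)).
    (* Coassociativity for c, and then for b, recombines the components. *)
    rewrite (coactC_coassoc hiH hiH hiC hiC GP).
    do 4 apply: eq_tfold => ? ?; rewrite /G.
    symmetry; apply: (coactA_coassoc (A := regular B) hiH hiH hiB hiB
      (G := fun u' v' x => ev d (_ ⊗ x) *: ((_ ∙ u') ⊗ (_ ∙ v')))).
    trilin.
  transitivity (\sw_(b1, b2 <- bcomul b) \sw_(c1, c2 <- bcomul c) \sw_(s, s' <- Rinv H)
    \sw_(r, r' <- Rmat H) (ev d ((s' ▷ c1) ⊗ (r ▷ b2)) *:
       tmul amul amul (kH s ∙ kC c2) (kB b1 ∙ kH r'))).
    rewrite /G /tmul; move: coactC coactH coactA => a1 a2 a3; sw_simp; sw_perm.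
  by do 4 apply: eq_tfold => ? ?; rewrite -amulA.
- move=> h b.
  have Dl := alg_hom_linear (boson_comul_hom C).
  have rl := @coactA_id_linear _ _ _ _ d (regular B) _ _ _ _ hU.
  have := cross (bosH C h) b.
  rewrite sw_boson_comulH; last by split=> ?; lin.
  rewrite sw_boson_comulH; last first.
    by have := alg_hom_linear (coactX_hom h4 h4) => ?; split=> ?; lin.
  move=> E; etransitivity; last (etransitivity; first exact: E); last first.
    by apply: eq_tfold => ? ?; rewrite boson_actH coactX_H.
  rewrite (coactA_factor (A := regular B) _ _ hiB) /coactH; etransitivity;
      first exact: amul_swl.
  apply: eq_tfold => x y.
  etransitivity; first exact: amul_swr.
  apply: eq_tfold => u a0.
  rewrite amul_tens ciB sw_boson_comulH; last by split=> ?; lin.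
  by rewrite boson_toH; congr (_ ⊗ _); apply: eq_tfold => ? ?;
      rewrite boson_actH boson_toH.
- move=> h c; exact: (coactC_cov hiH hiH hiC hiC ciC ciC).
Qed.
End DrinComul.

(** * The bialgebra structure of the double *)

Section Presented.
Variables (K : fieldType) (G : choiceType).
Variable P : forall U : ualgType K, (G -> U) -> Prop.

Lemma peval_hom (U : ualgType K) (f : G -> U) : P f ->
  ahom (peval f : presented P -> U).
Proof.
move=> fP; split=> [k x y|x y|].
- by rewrite [LHS]peval_add // [peval f (k *: x)]peval_scale.
- exact: peval_mul.
- exact: peval_one.
Qed.

Lemma presented_words (x : presented P) :
  x = \sum_(m <- repr x) m.1 *: \big[amul/𝟙]_(g <- m.2) pgen P g.
Proof.
apply: pres_eq => U f fP; have [fl fM f1] := peval_hom fP.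
rewrite [RHS](big_morph _ (linD fl) (lin0 fl)).
apply: eq_bigr => m _; rewrite (linZ fl) (big_morph _ fM f1).
by congr (_ *: _); apply: eq_bigr => g _; rewrite peval_gen.
Qed.

Lemma presented_hom_ext (U : ualgType K) (f g : presented P -> U) :
  ahom f -> ahom g -> (forall x, f (pgen P x) = g (pgen P x)) -> f =1 g.
Proof.
move=> [fl fM f1] [gl gM g1] e x; rewrite (presented_words x).
rewrite (big_morph _ (linD fl) (lin0 fl)) (big_morph _ (linD gl) (lin0 gl)).
apply: eq_bigr => m _; rewrite (linZ fl) (linZ gl).
rewrite (big_morph _ fM f1) (big_morph _ gM g1).
by congr (_ *: _); apply: eq_bigr => y _; apply: e.
Qed.
End Presented.

Section Counit.
Variables (K : fieldType) (H : qtHopf K) (C B : braidedBialg H).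
Variable d : weakDuality C B.

(** Both sides of the cross relation become ev(c, b). *)
Lemma drin_counit_relations : drin_relations d
  (@bcounit K H C : C -> K^o) (@hcounit K H : H -> K^o) (@bcounit K H B : B -> K^o).
Proof.
split; [exact: bcounit_hom|exact: hcounit_hom|exact: bcounit_hom| | exact:
    counit_cov|exact: counit_cov].
move=> b c.
have evb c' : linear (fun b : B => ev d (c' ⊗ b) : K^o) by lin.
have evc b' : linear (fun c : C => ev d (c ⊗ b') : K^o) by lin.
transitivity (ev d (c ⊗ b) : K^o).
  rewrite -(sw_counitr (bcoalgP B) b (evb c)); apply: eq_tfold => b1 b2.
  rewrite -(sw_counitl (bcoalgP C) c (evc b1)) scale_swr; apply: eq_tfold => c1 c2.
  have Fl : linear (fun h : H =>
      bcounit b2 * (bcounit c1 * (ev d (c2 ⊗ b1) * hcounit h)) : K^o) by lin.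
  transitivity (bcounit b2 * (bcounit c1 * (ev d (c2 ⊗ b1) * hcounit (𝟙 : H))) : K^o);
    last by rewrite hcounit1 mulr1.
  rewrite -(sw_Rinv_counitl Fl); apply: eq_tfold => s s'; rewrite !bcounit_act.
  rewrite -[LHS]/(_ * (_ * _ * (_ * _))) -[RHS]/(_ * (_ * (_ * (_ * _)))).
  by move: (ev _ _ : K) (hcounit _) (bcounit _) (hcounit _) (bcounit _) => *; ring.
symmetry; rewrite -(sw_counitl (bcoalgP B) b (evb c)); apply: eq_tfold => b1 b2.
rewrite -(sw_counitr (bcoalgP C) c (evc b2)) scale_swr; apply: eq_tfold => c1 c2.
have Fl : linear (fun h : H => bcounit b1 * (bcounit c2 * ev d ((h ▷ c1) ⊗ b2)) : K^o)
  by lin.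
transitivity (bcounit b1 * (bcounit c2 * ev d (((𝟙 : H) ▷ c1) ⊗ b2)) : K^o);
  last by rewrite act1E.
rewrite -(sw_Rinv_counitl Fl); apply: eq_tfold => s s'.
have Gl : linear (fun h : H => hcounit s * (bcounit b1 * (bcounit c2 *
    ev d ((s' ▷ c1) ⊗ (h ▷ b2)))) : K^o) by lin.
transitivity (hcounit s * (bcounit b1 * (bcounit c2 *
    ev d ((s' ▷ c1) ⊗ ((𝟙 : H) ▷ b2)))) : K^o); last by rewrite act1E.
rewrite -(sw_Rmat_counitr Gl); apply: eq_tfold => r r'.
rewrite -[LHS]/(_ * (_ * _ * _ * _)) -[RHS]/(_ * (_ * (_ * (_ * _)))).
by move: (ev _ _ : K) (hcounit _) (bcounit _) (hcounit _) (bcounit _) => *; ring.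
Qed.
End Counit.

Section DrinBialgebra.
Variables (K : fieldType) (H : qtHopf K) (C B : braidedBialg H).
Variable d : weakDuality C B.

Lemma drin_hom_ext (U : ualgType K) (f g : Drin d -> U) : ahom f -> ahom g ->
  (forall c, f (inC d c) = g (inC d c)) -> (forall h, f (inH d h) = g (inH d h)) ->
  (forall b, f (inB d b) = g (inB d b)) -> f =1 g.
Proof.
move=> hf hg eC eH eB; apply: presented_hom_ext => // -[[c|h]|b];
  [exact: eC|exact: eH|exact: eB].
Qed.

Section Lift.
Variables (U : ualgType K) (iC : C -> U) (iH : H -> U) (iB : B -> U).
Hypothesis hU : drin_relations d iC iH iB.
Definition drin_gens (g : drin_gen C B) : U :=
  match g with inl (inl c) => iC c | inl (inr h) => iH h | inr b => iB b end.
Definition drin_lift : Drin d -> U := peval drin_gens.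
Lemma drin_lift_hom : ahom drin_lift.
Proof. exact: peval_hom. Qed.
Lemma drin_liftC c : drin_lift (inC d c) = iC c. Proof. exact: (@peval_gen _ _ _ _
    drin_gens (inl (inl c)) hU). Qed.
Lemma drin_liftH h : drin_lift (inH d h) = iH h. Proof. exact: (@peval_gen _ _ _ _
    drin_gens (inl (inr h)) hU). Qed.
Lemma drin_liftB b : drin_lift (inB d b) = iB b. Proof. exact: (@peval_gen _ _ _ _
    drin_gens (inr b) hU). Qed.
End Lift.

Let hD : drin_relations d (inC d) (inH d) (inB d) := drin_relationsP d.

Definition drin_comul : Drin d -> Drin d ⊗ Drin d :=
  drin_lift (coactC (inH d) (inC d) (inC d)) (coactH (inH d) (inH d))
            (coactA (A := regular B) (inH d) (inB d) (inB d)).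
Definition drin_counit : Drin d -> K :=
  drin_lift (@bcounit K H C : C -> K^o) (@hcounit K H : H -> K^o) (@bcounit K H B :
      B -> K^o).

Lemma drin_comul_hom : ahom drin_comul.
Proof. exact: (drin_lift_hom (drin_comul_relations hD)). Qed.
Lemma drin_comulCE c : drin_comul (inC d c) = coactC (inH d) (inC d) (inC d) c.
Proof. exact: (drin_liftC (drin_comul_relations hD)). Qed.
Lemma drin_comulHE h : drin_comul (inH d h) = coactH (inH d) (inH d) h.
Proof. exact: (drin_liftH (drin_comul_relations hD)). Qed.
Lemma drin_comulBE b :
  drin_comul (inB d b) = coactA (A := regular B) (inH d) (inB d) (inB d) b.
Proof. exact: (drin_liftB (drin_comul_relations hD)). Qed.

Lemma drin_counit_hom : ahom (drin_counit : Drin d -> K^o).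
Proof. exact: (drin_lift_hom (drin_counit_relations d)). Qed.
Lemma drin_counitCE c : drin_counit (inC d c) = bcounit c.
Proof. exact: (drin_liftC (drin_counit_relations d)). Qed.
Lemma drin_counitHE h : drin_counit (inH d h) = hcounit h.
Proof. exact: (drin_liftH (drin_counit_relations d)). Qed.
Lemma drin_counitBE b : drin_counit (inB d b) = bcounit b.
Proof. exact: (drin_liftB (drin_counit_relations d)). Qed.

Let hC := drin_subC hD. Let hH := drin_subH hD. Let hB := drin_subB hD.
Let hc := drin_comul_hom. Let he := drin_counit_hom.

Lemma drin_bialgebra : is_bialgebra drin_comul drin_counit.
Proof.
split; [split| |].
- exact: (alg_hom_linear drin_comul_hom).
- exact: (alg_hom_linear drin_counit_hom).
- apply: (@drin_hom_ext _ (fun x => coassl drin_comul (drin_comul x))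
            (fun x => coassr drin_comul (drin_comul x))).
  + exact: (ahom_comp (coassl_hom _ hc) hc).
  + exact: (ahom_comp (coassr_hom hc) hc).
  + move=> c; rewrite drin_comulCE.
    exact: (coactC_coassociative hH hc hc drin_comulHE hC hC drin_comulCE drin_comulCE).
  + move=> h; rewrite drin_comulHE.
    exact: (coactH_coassociative hH hH hc hc drin_comulHE drin_comulHE).
  + move=> b; rewrite drin_comulBE.
    exact: (coactA_coassociative (A := regular B) hH hc hc drin_comulHE hB hB
        drin_comulBE drin_comulBE).
- apply: drin_hom_ext.
  + exact: (ahom_comp (counit_hom _ he) hc).
  + exact: ahom_id.
  + move=> c; rewrite drin_comulCE.
    exact: (coactC_counit he drin_counitHE hC drin_counitCE).
  + by move=> h; rewrite drin_comulHE; exact: (coactH_counit hH he drin_counitHE).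
  + move=> b; rewrite drin_comulBE.
    exact: (coactA_counit (A := regular B) he drin_counitHE hB drin_counitBE).
- apply: drin_hom_ext.
  + exact: (ahom_comp (counitr_hom _ he) hc).
  + exact: ahom_id.
  + move=> c; rewrite drin_comulCE.
    exact: (coactC_counitr hH he hC hC _ drin_counitCE).
  + by move=> h; rewrite drin_comulHE; exact: (coactH_counitr hH he drin_counitHE).
  + move=> b; rewrite drin_comulBE.
    exact: (coactB_counitr hH he hB hB _ drin_counitBE).
- exact: drin_comul_hom.
- exact: drin_counit_hom.
Qed.

Lemma drin_bialgebraP : is_drin_bialgebra drin_comul drin_counit.
Proof.
split; [exact: drin_bialgebra|exact: drin_comulHE|exact: drin_comulBE|
        exact: drin_comulCE|exact: drin_counitHE|exact: drin_counitBE|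
        exact: drin_counitCE].
Qed.
End DrinBialgebra.

(** * The crossed product as a smash product *)

Section OrderedProduct.
Variables (K : fieldType) (H : qtHopf K) (C B : braidedBialg H).
Variables (d : weakDuality C B) (A : braidedComodAlg B).
Variables (U : ualgType K) (fA : A -> U) (fC : C -> U) (fH : H -> U).
Hypotheses (hA : ahom fA) (hC : ahom fC) (hH : ahom fH).
Hypotheses (relCA : forall c a, fC c ∙ fA a =
    \sw_(c1, c2 <- bcomul c) \sw_(s, s' <- Rinv H) (fA (s ▷ pair_act d c2 a)
        ∙ fC (s' ▷ c1)))
  (relHA : forall h a, fH h ∙ fA a = \sw_(h1, h2 <- hcomul h) (fA (h1 ▷ a) ∙ fH h2))
  (relHC : forall h c, fH h ∙ fC c = \sw_(h1, h2 <- hcomul h) (fC (h1 ▷ c) ∙ fH h2)).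

Lemma relCA_expanded c a : fC c ∙ fA a =
  \sw_(b, a0 <- coact a) \sw_(c1, c2 <- bcomul c) \sw_(s, s' <- Rinv H)
    (ev d (c2 ⊗ b) *: (fA (s ▷ a0) ∙ fC (s' ▷ c1))).
Proof. rewrite relCA pair_actE; sw_simp; sw_perm. Qed.

(** The relations alone determine the product of two ordered monomials. *)
Lemma ordered_product a c h a' c' h' :
  (fA a ∙ fC c ∙ fH h) ∙ (fA a' ∙ fC c' ∙ fH h') =
  \sw_(h1, h23 <- hcomul h) \sw_(h2, h3 <- hcomul h23)
  \sw_(b, a0 <- coact (h1 ▷ a')) \sw_(c1, c2 <- bcomul c) \sw_(s, s' <- Rinv H)
    (ev d (c2 ⊗ b) *:
      (fA (a ∙ (s ▷ a0)) ∙ fC ((s' ▷ c1) ∙ (h2 ▷ c')) ∙ fH (h3 ∙ h'))).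
Proof.
transitivity (fA a ∙ (fC c ∙ (fH h ∙ fA a')) ∙ fC c' ∙ fH h').
  by rewrite !amulA.
rewrite relHA.
transitivity (\sw_(h1, h23 <- hcomul h)
  (fA a ∙ (fC c ∙ fA (h1 ▷ a')) ∙ (fH h23 ∙ fC c') ∙ fH h')).
  by sw_simp.
apply: eq_tfold => k1 k23; rewrite relHC relCA_expanded.
transitivity (\sw_(h2, h3 <- hcomul k23)
   (fA a ∙ (\sw_(b, a0 <- coact (k1 ▷ a'))
   \sw_(c1, c2 <- bcomul c) \sw_(s, s' <- Rinv H)
    (ev d (c2 ⊗ b) *: (fA (s ▷ a0) ∙ fC (s' ▷ c1)))) ∙ (fC (h2 ▷ c') ∙ fH h3) ∙ fH h')).
  rewrite amul_swr amul_swl; apply: eq_tfold => ? ?; by rewrite !amulA.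
apply: eq_tfold => k2 k3; move: (coact _) => t; sw_simp; sw_perm.
Qed.
End OrderedProduct.

Section Crossed.
Variables (K : fieldType) (H : qtHopf K) (C B : braidedBialg H).
Variables (d : weakDuality C B) (A : braidedComodAlg B).

Local Notation E := (A ⊗ (C ⊗ H))%type.

Local Notation cmul := (@cross_mul K H C B d A).
Local Notation cone := (@cross_one K H C B A).

Let hb := boson_bialgebra C.
Let hm := boson_act_module_algebra d A.
Definition crossed : ualgType K := smash_of hb hm.
Definition crossedA : A -> crossed := sinl hb hm.
Definition crossedX : boson C -> crossed := sinr hb hm.
Definition crossedC (c : C) := crossedX (bosC c).
Definition crossedH (h : H) := crossedX (bosH C h).

Lemma crossedA_hom : ahom crossedA. Proof. exact: sinl_hom. Qed.
Lemma crossedX_hom : ahom crossedX. Proof. exact: sinr_hom. Qed.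
Lemma crossedC_hom : ahom crossedC. Proof. exact: (ahom_comp crossedX_hom (bosC_hom
    C)). Qed.
Lemma crossedH_hom : ahom crossedH. Proof. exact: (ahom_comp crossedX_hom (bosH_hom
    C)). Qed.

Lemma crossedXA x a : crossedX x ∙ crossedA a =
  \sw_(x1, x2 <- boson_comul x) (crossedA (boson_act d x1 a) ∙ crossedX x2).
Proof. exact: sinrl. Qed.

Lemma crossedCA c a : crossedC c ∙ crossedA a =
  \sw_(c1, c2 <- bcomul c) \sw_(s, s' <- Rinv H) (crossedA (s ▷ pair_act d c2 a)
      ∙ crossedC (s' ▷ c1)).
Proof.
have h1 := crossedA_hom; have h2 := crossedX_hom.
rewrite /crossedC crossedXA sw_boson_comulC; last by split=> ?; lin.
by do 2 apply: eq_tfold => ? ?; rewrite boson_actM boson_actH boson_actC.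
Qed.

Lemma crossedHA h a : crossedH h ∙ crossedA a =
    \sw_(h1, h2 <- hcomul h) (crossedA (h1 ▷ a) ∙ crossedH h2).
Proof.
have h1 := crossedA_hom; have h2 := crossedX_hom.
rewrite /crossedH crossedXA sw_boson_comulH; last by split=> ?; lin.
by apply: eq_tfold => ? ?; rewrite boson_actH.
Qed.

Lemma crossedHC h c : crossedH h ∙ crossedC c =
    \sw_(h1, h2 <- hcomul h) (crossedC (h1 ▷ c) ∙ crossedH h2).
Proof.
rewrite /crossedH /crossedC -(alg_homM crossedX_hom) bos_cov.
rewrite (lin_sw _ _ (alg_hom_linear crossedX_hom)).
by apply: eq_tfold => ? ?; rewrite (alg_homM crossedX_hom).
Qed.

Lemma crossedACH a c h : crossedA a ∙ crossedC c ∙ crossedH h = ach a c h.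
Proof.
rewrite -amulA -(alg_homM crossedX_hom) [LHS]sinlr.
by congr (_ ⊗ _); exact: sinlr.
Qed.

Lemma ach_ext (U : lmodType K) (f g : E -> U) : linear f -> linear g ->
  (forall a c h, f (ach a c h) = g (ach a c h)) -> f =1 g.
Proof.
move=> fl gl e; apply: tens_ext => // a.
have tl := lin_bil_r a (tens_bilinear A (C ⊗ H)%type).
apply: (tens_ext (lin_comp fl tl) (lin_comp gl tl)) => c h; exact: e.
Qed.

(** The module structure of the smash product is convertible to the one of
    A ⊗ (C ⊗ H), but presented differently. Sums are transported along this
    linear map term by term, rather than by conversion of whole expressions. *)
Definition crossed_val (x : crossed) : E := x.
Lemma crossed_val_linear : linear crossed_val. Proof. by []. Qed.

Lemma cross_mulE : cmul = (@amul K crossed : E -> E -> E).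
Proof.
have cb : is_bilinear (cmul : E -> E -> E).
  by rewrite /cross_mul /ach; split=> ?; lin.
have ab : is_bilinear (@amul K crossed : E -> E -> E) by exact: (@amul_bilinear K
    crossed).
apply/funext => x; apply/funext => y; move: x.
apply: ach_ext; [exact: cb.1|exact: ab.1|] => a c h; move: y.
apply: ach_ext; [exact: cb.2|exact: ab.2|] => a' c' h'.
rewrite -[in RHS]crossedACH -[in RHS]crossedACH.
rewrite -[RHS]/(crossed_val _).
rewrite (ordered_product crossedA_hom crossedC_hom crossedH_hom crossedCA crossedHA
    crossedHC).
transitivity (\sw_(h1, h23 <- hcomul h) \sw_(h2, h3 <- hcomul h23)
  \sw_(b, a0 <- coact (h1 ▷ a')) \sw_(c1, c2 <- bcomul c) \sw_(s, s' <- Rinv H)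
    (ev d (c2 ⊗ b) *:
      ach (a ∙ (s ▷ a0)) ((s' ▷ c1) ∙ (h2 ▷ c')) (h3 ∙ h'))).
  rewrite /cross_mul /ach.
  do 4 (etransitivity; [apply: sw_tens; lin|]; cbv beta).
  by [].
have vl := crossed_val_linear.
do 5 (rewrite (lin_sw _ _ vl); apply: eq_tfold => ? ?).
by rewrite (linZ vl) crossedACH.
Qed.

Lemma crossed_algebraP : crossed_algebra d A.
Proof.
split; rewrite ?cross_mulE.
- exact: (@ualgP K crossed).
- exact: crossedA_hom.
- exact: crossedC_hom.
- exact: crossedH_hom.
- by move=> a c h; rewrite -[LHS]crossedACH.
- move=> c a; exact: (relCA_expanded crossedA_hom crossedCA).
- by move=> h a; exact: crossedHA.
- by move=> h c; exact: crossedHC.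
Qed.

Let hD : drin_relations d (inC d) (inH d) (inB d) := drin_relationsP d.
Local Notation iX := (boson_to (inC d) (inH d)).

(** It extends to the smash product by [boson_cross]. *)
Definition crossed_coact : crossed -> Drin d ⊗ crossed :=
  smash_lift (coactA (inH d) (inB d) crossedA) (coactX iX crossedX).

Lemma crossed_coactA_hom : ahom (coactA (inH d) (inB d) crossedA).
Proof. exact: (coactA_hom (drin_subH hD) (drin_subB hD) crossedA_hom (drin_HB hD)). Qed.
Lemma crossed_coactX_hom : ahom (coactX iX crossedX).
Proof. exact: (coactX_hom (boson_to_hom hD) crossedX_hom). Qed.

Lemma crossed_coact_hom : ahom crossed_coact.
Proof.
have hiX := boson_to_hom hD.
apply: (smash_lift_hom hb hm crossed_coactA_hom crossed_coactX_hom) => x a.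
rewrite -(boson_cross hD hiX (boson_toC hD) (boson_toH hD) crossedX_hom crossedA_hom).
rewrite (coactA_factor _ _ crossedA_hom) /coactX.
etransitivity; first exact: amul_swl.
apply: eq_tfold => x1 x2; etransitivity; first exact: amul_swr.
by apply: eq_tfold => u a0; rewrite amul_tens crossedXA.
Qed.

Lemma crossed_coact_A a : crossed_coact (crossedA a) = coactA (inH d) (inB d)
    crossedA a.
Proof. exact: (smash_lift_l _ _ crossed_coactA_hom crossed_coactX_hom). Qed.
Lemma crossed_coact_X x : crossed_coact (crossedX x) = coactX iX crossedX x.
Proof. exact: (smash_lift_r _ _ crossed_coactA_hom crossed_coactX_hom). Qed.
Lemma crossed_coact_C c : crossed_coact (crossedC c) = coactC (inH d) (inC d)
    crossedC c.
Proof.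
by rewrite crossed_coact_X (coactXC (boson_to_hom hD) (boson_toC hD) (boson_toH hD)
    crossedX_hom).
Qed.
Lemma crossed_coact_H h : crossed_coact (crossedH h) = coactH (inH d) crossedH h.
Proof.
by rewrite crossed_coact_X (coactXH (boson_to_hom hD) (boson_toH hD) crossedX_hom).
Qed.

Lemma crossed_hom_ext (U : ualgType K) (f g : crossed -> U) : ahom f -> ahom g ->
  (forall a, f (crossedA a) = g (crossedA a)) -> (forall c,
      f (crossedC c) = g (crossedC c)) ->
  (forall h, f (crossedH h) = g (crossedH h)) -> f =1 g.
Proof.
move=> hf hg eA eC eH; apply: smash_hom_ext => //.
apply: (@boson_hom_ext _ _ _ _ (fun x => f (crossedX x)) (fun x => g (crossedX x)))
    => //.
  exact: (ahom_comp hf crossedX_hom).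
exact: (ahom_comp hg crossedX_hom).
Qed.

Lemma crossed_comodule_algebra :
  is_comodule_algebra (@drin_comul _ _ _ _ d) (@drin_counit _ _ _ _ d)
    (@amul K crossed) 𝟙 crossed_coact.
Proof.
have hc := drin_comul_hom d; have he := drin_counit_hom d; have hd := crossed_coact_hom.
have hC := drin_subC hD; have hH := drin_subH hD; have hB := drin_subB hD.
split.
- exact: drin_bialgebra.
- exact: (@ualgP K crossed).
- apply: (@crossed_hom_ext _ (fun x => coassl (@drin_comul _ _ _ _ d) (crossed_coact x))
            (fun x => coassr crossed_coact (crossed_coact x))).
  + exact: (ahom_comp (coassl_hom _ hc) hd).
  + exact: (ahom_comp (coassr_hom hd) hd).
  + move=> a; rewrite crossed_coact_A.
    exact: (coactA_coassociative hH hc hd (@drin_comulHE _ _ _ _ d) hB crossedA_hom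
      (@drin_comulBE _ _ _ _ d) crossed_coact_A).
  + move=> c; rewrite crossed_coact_C.
    exact: (coactC_coassociative hH hc hd (@drin_comulHE _ _ _ _ d) hC crossedC_hom
      (@drin_comulCE _ _ _ _ d) crossed_coact_C).
  + move=> h; rewrite crossed_coact_H.
    exact: (coactH_coassociative hH crossedH_hom hc hd (@drin_comulHE _ _ _ _ d)
        crossed_coact_H).
- apply: crossed_hom_ext.
  + exact: (ahom_comp (counit_hom _ he) hd).
  + exact: ahom_id.
  + move=> a; rewrite crossed_coact_A.
    exact: (coactA_counit he (@drin_counitHE _ _ _ _ d) crossedA_hom
        (@drin_counitBE _ _ _ _ d)).
  + move=> c; rewrite crossed_coact_C.
    exact: (coactC_counit he (@drin_counitHE _ _ _ _ d) crossedC_hom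
        (@drin_counitCE _ _ _ _ d)).
  + move=> h; rewrite crossed_coact_H.
    exact: (coactH_counit crossedH_hom he (@drin_counitHE _ _ _ _ d)).
- exact: crossed_coact_hom.
Qed.
End Crossed.

(** * The comodule algebra structure *)

Section ProductOfCoactions.
Variables (K : fieldType) (H : qtHopf K) (C B : braidedBialg H).
Variables (A : braidedComodAlg B) (U V : ualgType K).
Variables (iC : C -> U) (iH : H -> U) (iB : B -> U) (jA : A -> V) (jC : C -> V).

Lemma coactAC a c : coactA iH iB jA a ∙ coactC iH iC jC c =
  \sw_(b, a0 <- coact a) \sw_(r, r' <- Rmat H)
  \sw_(c1, c2 <- bcomul c) \sw_(s, s' <- Rinv H)
    (iB b ∙ iH r' ∙ (iH s ∙ iC c2)) ⊗ (jA (r ▷ a0) ∙ jC (s' ▷ c1)).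
Proof. rewrite /coactA /coactC; sw_simp; sw_perm. Qed.
End ProductOfCoactions.

Section Subalgebra.
Variables (K : fieldType) (H : qtHopf K) (C B : braidedBialg H).
Variables (d : weakDuality C B) (A : braidedComodAlg B).
Local Notation E := (A ⊗ (C ⊗ H))%type.
Local Notation cmul := (@cross_mul K H C B d A).

Lemma incl_AC_linear : linear (@incl_AC K H C B A).
Proof. by rewrite /incl_AC /ach; lin. Qed.

Lemma incl_AC_tens a c : incl_AC (a ⊗ c) = ach a c 𝟙 :> E.
Proof. by rewrite /incl_AC /ach sw_tens //; lin. Qed.

Lemma crossedAC a c : crossedA d a ∙ crossedC d A c = ach a c 𝟙 :> E.
Proof. by rewrite -[RHS](crossedACH d) (alg_hom1 (crossedH_hom d A)) amul1r. Qed.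

(** The product of A ⋊ C on A ⊗ C itself: it exhibits products of elements of the
    subalgebra as elements of the subalgebra. *)
Definition AC_product (t u : A ⊗ C) : A ⊗ C :=
  \sw_(a, c <- t) \sw_(a', c' <- u) \sw_(c1, c2 <- bcomul c) \sw_(s, s' <- Rinv H)
    (a ∙ (s ▷ pair_act d c2 a')) ⊗ ((s' ▷ c1) ∙ c').

Lemma incl_AC_mul t u : incl_AC (AC_product t u) = cmul (incl_AC t) (incl_AC u).
Proof.
have il := incl_AC_linear.
have vl := @crossed_val_linear K H C B d A.
have b1 : is_bilinear (fun t u => incl_AC (AC_product t u) : E).
  by rewrite /AC_product; split=> ?; lin.
have cb : is_bilinear (cmul : E -> E -> E).
  by rewrite /cross_mul /ach; split=> ?; lin.
have b2 : is_bilinear (fun t u => cmul (incl_AC t) (incl_AC u)) by lin.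
move: t u; apply: (tens_bil_ext b1 b2) => a c a' c'.
rewrite !incl_AC_tens cross_mulE -!crossedAC.
rewrite -[RHS]/(crossed_val _).
transitivity (crossed_val (crossedA d a ∙ (crossedC d A c ∙ crossedA d a')
    ∙ crossedC d A c'));
  last by congr crossed_val; rewrite !amulA.
rewrite crossedCA /AC_product sw_tens; last lin.
rewrite sw_tens; last lin.
rewrite (lin_sw _ _ il) amul_swr amul_swl (lin_sw _ _ vl); apply: eq_tfold => ? ?.
rewrite (lin_sw _ _ il) amul_swr amul_swl (lin_sw _ _ vl); apply: eq_tfold => ? ?.
rewrite incl_AC_tens -crossedAC (alg_homM (crossedA_hom d A)) (alg_homM
    (crossedC_hom d A)).
by rewrite !amulA.
Qed.

Definition drin_val (x : Drin d ⊗ crossed d A) : Drin d ⊗ E := x.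
Lemma drin_val_linear : linear drin_val. Proof. by []. Qed.

Lemma AC_coaction t : exists u : Drin d ⊗ (A ⊗ C),
  @crossed_coact K H C B d A (incl_AC t) = \sw_(g, t <- u) (g ⊗ incl_AC t).
Proof.
have il := incl_AC_linear.
pose F (a : A) (c : C) : Drin d ⊗ (A ⊗ C) :=
  \sw_(b, a0 <- coact a) \sw_(r, r' <- Rmat H)
  \sw_(c1, c2 <- bcomul c) \sw_(s, s' <- Rinv H)
    (inB d b ∙ inH d r' ∙ (inH d s ∙ inC d c2)) ⊗ ((r ▷ a0) ⊗ (s' ▷ c1)).
exists (tfold F t).
have hD : drin_relations d (inC d) (inH d) (inB d) := drin_relationsP d.
have hC := drin_subC hD; have hB := drin_subB hD; have hH := drin_subH hD.
have Fb : is_bilinear F by rewrite /F; lin.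
have dl : linear (fun x => drin_val (crossed_coact (x : crossed d A))).
  exact: (lin_comp drin_val_linear (alg_hom_linear (crossed_coact_hom d A))).
pose G (g : Drin d) (t : A ⊗ C) := g ⊗ (incl_AC t : E).
have Gb : is_bilinear G by rewrite /G; lin.
move: t; apply: (tens_ext (lin_comp dl il) (lin_comp (tfold_linear Gb)
    (tfold_linear Fb))) => a c.
rewrite (sw_tens _ _ Fb) incl_AC_tens -crossedAC.
rewrite (alg_homM (crossed_coact_hom d A)) crossed_coact_A crossed_coact_C coactAC /F.
do 4 (rewrite (lin_sw _ _ drin_val_linear) (sw_sw _ _ Gb); apply: eq_tfold => ? ?).
by rewrite (sw_tens _ _ Gb) /G incl_AC_tens -crossedAC.
Qed.

Lemma crossed_coact_a a :
  drin_val (crossed_coact (d := d) (A := A) (ach a (𝟙 : C) (𝟙 : H))) =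
  \sw_(b, a0 <- coact a) \sw_(r, r' <- Rmat H)
    ((inB d b ∙ inH d r') ⊗ ach (r ▷ a0) (𝟙 : C) (𝟙 : H)).
Proof.
rewrite -[LHS]/(drin_val (crossed_coact (crossedA d a))) crossed_coact_A /coactA.
by do 2 (rewrite (lin_sw _ _ drin_val_linear); apply: eq_tfold => ? ?).
Qed.

Lemma crossed_coact_c c :
  drin_val (crossed_coact (d := d) (A := A) (ach (A := A) 𝟙 c (𝟙 : H))) =
  \sw_(c1, c2 <- bcomul c) \sw_(s, s' <- Rinv H)
    ((inH d s ∙ inC d c2) ⊗ ach (A := A) 𝟙 (s' ▷ c1) (𝟙 : H)).
Proof.
rewrite -[LHS]/(drin_val (crossed_coact (crossedC d A c))) crossed_coact_C /coactC.
by do 2 (rewrite (lin_sw _ _ drin_val_linear); apply: eq_tfold => ? ?).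
Qed.

Lemma crossed_coact_h h :
  drin_val (crossed_coact (d := d) (A := A) (ach (A := A) 𝟙 (𝟙 : C) h)) =
  \sw_(h1, h2 <- hcomul h) (inH d h1 ⊗ ach (A := A) 𝟙 (𝟙 : C) h2).
Proof.
rewrite -[LHS]/(drin_val (crossed_coact (crossedH d A h))) crossed_coact_H /coactH.
by rewrite (lin_sw _ _ drin_val_linear); apply: eq_tfold => ? ?.
Qed.

Lemma AC_subalgebra : AC_comodule_subalgebra (@crossed_coact K H C B d A).
Proof.
split.
- by exists (𝟙 ⊗ 𝟙); rewrite incl_AC_tens.
- move=> _ _ [t ->] [u ->]; exists (AC_product t u); exact/esym/incl_AC_mul.
- by move=> _ [t ->]; exact: AC_coaction.
Qed.
End Subalgebra.

Theorem corollary3p12 (K : fieldType) (H : qtHopf K) (C B : braidedBialg H)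
    (d : weakDuality C B) (A : braidedComodAlg B) :
  crossed_algebra d A /\
  exists (comul : Drin d -> Drin d ⊗ Drin d) (counit : Drin d -> K)
         (delta : A ⊗ (C ⊗ H) -> Drin d ⊗ (A ⊗ (C ⊗ H))),
    [/\ is_drin_bialgebra comul counit,
        is_comodule_algebra comul counit
          (@cross_mul _ _ _ _ d A) (@cross_one _ _ C _ A) delta,
        AC_comodule_subalgebra delta
      & [/\ forall a : A, delta (ach a (𝟙 : C) (𝟙 : H)) =
              \sw_(b, a0 <- coact a) \sw_(r, r' <- Rmat H)
                ((inB d b ∙ inH d r') ⊗ ach (r ▷ a0) (𝟙 : C) (𝟙 : H)),
            forall c : C, delta (ach (𝟙 : A) c (𝟙 : H)) =
              \sw_(c1, c2 <- bcomul c) \sw_(s, s' <- Rinv H)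
                ((inH d s ∙ inC d c2) ⊗ ach (𝟙 : A) (s' ▷ c1) (𝟙 : H))
          & forall h : H, delta (ach (𝟙 : A) (𝟙 : C) h) =
              \sw_(h1, h2 <- hcomul h)
                (inH d h1 ⊗ ach (𝟙 : A) (𝟙 : C) h2)]].
Proof.
split; first exact: crossed_algebraP.
exists (@drin_comul _ _ _ _ d), (@drin_counit _ _ _ _ d), (@crossed_coact K H C B d A).
split.
- exact: drin_bialgebraP.
- rewrite cross_mulE; exact: crossed_comodule_algebra.
- exact: AC_subalgebra.
- split; [exact: crossed_coact_a|exact: crossed_coact_c|exact: crossed_coact_h].
Qed.
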